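(* Let $\mathfrak T$ be a triangulated category with at least countable direct sums, let $\mathfrak I$ be a stable homological ideal in $\mathfrak T$ that is compatible with countable direct sums and has enough projective objects, and let $F\colon\mathfrak T\to\mathfrak A$ be the universal $\mathfrak I$-exact stable homological functor. Assume that $\mathfrak A$ is even and has global dimension $2$. Then the functor $$F\delta\colon\langle\mathfrak P_{\mathfrak I}\rangle\to\mathfrak A\delta,\qquad \hat A\mapsto\bigl(F(\hat A),\delta(\hat A)\bigr),$$ is full and induces a bijection between isomorphism classes of objects $\hat A$ in $\langle\mathfrak P_{\mathfrak I}\rangle$ and isomorphism classes of objects in the category $\mathfrak A\delta$. Furthermore, every lift (to a morphism between objects of $\langle\mathfrak P_{\mathfrak I}\rangle$) of an isomorphism in $\mathfrak A\delta$ is an isomorphism in $\mathfrak T$.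
   Context: A stable Abelian category is an Abelian category with a suspension automorphism $[1]$ (inverse $[-1]$). It is called even if $\mathfrak A=\mathfrak A_+\times\mathfrak A_-$ with $\mathfrak A_+[-1]=\mathfrak A_-$ and $\mathfrak A_-[-1]=\mathfrak A_+$. A stable homological functor on $\mathfrak T$ is an additive functor to a stable Abelian category that maps exact triangles to exact sequences and commutes with suspensions. A stable homological ideal $\mathfrak I$ is the kernel on morphisms of some stable homological functor. It is compatible with countable direct sums if $\mathfrak T(\bigoplus A_n,B)\cong\prod\mathfrak T(A_n,B)$ restricts to $\mathfrak I(\bigoplus A_n,B)\cong\prod\mathfrak I(A_n,B)$ for countable families. An object $P$ is $\mathfrak I$-projective if $\mathfrak I(P,B)=0$ for all $B$; $f\colon P\to A$ is $\mathfrak I$-epic if $A\to\mathrm{cone}(f)$ lies in $\mathfrak I$; enough projective objects means that every object admits an $\mathfrak I$-epic morphism from an $\mathfrak I$-projective object. $B$ is $\mathfrak I$-contractible if $\mathrm{id}_B\in\mathfrak I$. A stable homological functor is $\mathfrak I$-exact if it vanishes on $\mathfrak I$; $F$ is universal if every $\mathfrak I$-exact stable homological functor factors through $F$, uniquely up to natural isomorphism, by an exact functor commuting with suspensions. $\langle\mathfrak P_{\mathfrak I}\rangle\subseteq\mathfrak T$ is the localising subcategory generated by the $\mathfrak I$-projective objects; $\hat A\in\langle\mathfrak P_{\mathfrak I}\rangle$ if and only if $\mathfrak T(\hat A,B)=0$ for all $\mathfrak I$-contractible $B$. For projective $P\in\mathfrak A$, $F^\vdash(P)\in\mathfrak T$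 denotes the value of the (partially defined) left adjoint of $F$: $\mathfrak T(F^\vdash(P),B)\cong\mathfrak A(P,F(B))$; it satisfies $F(F^\vdash(P))\cong P$. A lifting of $A\in\mathfrak A$ is a pair $(\hat A,\alpha)$ with $\hat A\in\langle\mathfrak P_{\mathfrak I}\rangle$ and an isomorphism $\alpha\colon F(\hat A)\to A$; an equivalence of liftings is an isomorphism $\varphi\colon\hat A_1\to\hat A_2$ with $\alpha_1=\alpha_2\circ F(\varphi)$. Relative obstruction class: let $0\to P_2\to P_1\to P_0\to A\to 0$ be a projective resolution, $\Omega A=\ker(P_0\to A)$, $\hat P_0=F^\vdash(P_0)$. For a lifting $\hat A_i$, the map $P_0\to A\cong F(\hat A_i)$ is adjoint to a map $\hat P_0\to\hat A_i$, which is completed to an exact triangle $D\xrightarrow{\varphi_i}\hat P_0\to\hat A_i\to D[1]$; here $D$ is a lifting of $\Omega A$, which is unique up to equivalence (so the same $D$ may be used for all liftings), and $F(\varphi_i)$ is the inclusion $\Omega A\hookrightarrow P_0$. For two liftings, $\varphi_2-\varphi_1$ lies in $\ker\bigl(\mathfrak T(D,\hat P_0)\to\mathrm{Hom}(\Omega A,P_0)\bigr)$, which equals $\mathrm{Ext}^1(\Omega A,P_0[-1])$ by the Universal Coefficient Theorem exact sequence. The relative obstruction class $\delta(\hat A_2,\hat A_1)$ is the image of $\varphi_2-\varphi_1$ under $\mathrm{Ext}^1(\Omega A,P_0[-1])\to\mathrm{Ext}^1(\Omega A,A[-1])\cong\mathrm{Ext}^2(A,A[-1])$. Canonical lifting and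 obstruction class (for $\mathfrak A$ even): write $A=A_+\oplus A_-$ with $A_\pm\in\mathfrak A_\pm$. Each of $A_+,A_-$ has a unique lifting $\hat A_\pm$ up to equivalence, because $\mathrm{Ext}^2(A_\pm,A_\pm[-1])=0$. The canonical lifting of $A$ is $\hat A_0=\hat A_+\oplus\hat A_-$, and $\delta(\hat A):=\delta(\hat A,\hat A_0)\in\mathrm{Ext}^2(A,A[-1])$ for any lifting $\hat A$ of $A$. For an object $\hat A\in\langle\mathfrak P_{\mathfrak I}\rangle$, $\delta(\hat A)$ is formed with $\hat A$ viewed as a lifting of $F(\hat A)$. The category $\mathfrak A\delta$: objects are pairs $(A,\delta)$ with $A\in\mathfrak A$ and $\delta\in\mathrm{Ext}^2(A,A[-1])$; morphisms $(A,\delta)\to(A',\delta')$ are morphisms $f\colon A\to A'$ in $\mathfrak A$ with $\delta' f=f\delta$ in $\mathrm{Ext}^2(A,A'[-1])$. *)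

(* Defs.v *)
From HB Require Import structures.
From mathcomp Require Import all_boot all_algebra ring_quotient.
From mathcomp Require Import boolp classical_sets.

Set Implicit Arguments.
Unset Strict Implicit.
Unset Printing Implicit Defensive.

Import GRing.Theory.
Local Open Scope ring_scope.
Local Open Scope quotient_scope.

Declare Scope cat_scope.
Delimit Scope cat_scope with cat.
Open Scope cat_scope.

Record category := Category {
  ob :> Type;
  mor : ob -> ob -> Type;
  idm : forall X, mor X X;
  mcomp : forall X Y Z, mor Y Z -> mor X Y -> mor X Z;
  mcomp1m : forall X Y (f : mor X Y), mcomp (idm Y) f = f;
  mcompm1 : forall X Y (f : mor X Y), mcomp f (idm X) = f;
  mcompA : forall X Y Z W (h : mor Z W) (g : mor Y Z) (f : mor X Y),
    mcomp h (mcomp g f) = mcomp (mcomp h g) f }.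

Arguments idm {c} X.
Arguments mcomp {c X Y Z} g f : rename.

Notation "g ∘ f" := (mcomp g f) (at level 40, left associativity) : cat_scope.

Definition is_iso (C : category) (X Y : C) (f : mor X Y) : Prop :=
  exists g : mor Y X, g ∘ f = idm X /\ f ∘ g = idm Y.

Definition isomorphic (C : category) (X Y : C) : Prop :=
  exists f : mor X Y, is_iso f.

Definition eq_hom (C : category) (X Y : C) (e : X = Y) : mor X Y :=
  match e in _ = Z return mor X Z with erefl => idm X end.

Lemma eq_homK (C : category) (X Y : C) (e : X = Y) :
  eq_hom (esym e) ∘ eq_hom e = idm X.
Proof. by case: Y / e; rewrite /= mcomp1m. Qed.

Lemma eq_homVK (C : category) (X Y : C) (e : X = Y) :
  eq_hom e ∘ eq_hom (esym e) = idm Y.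
Proof. by case: Y / e; rewrite /= mcomp1m. Qed.

Record functor (C D : category) := Functor {
  fob :> C -> D;
  fmap : forall X Y : C, mor X Y -> mor (fob X) (fob Y);
  fmap1 : forall X : C, fmap (idm X) = idm (fob X);
  fmapM : forall (X Y Z : C) (g : mor Y Z) (f : mor X Y),
    fmap (g ∘ f) = fmap g ∘ fmap f }.

Arguments fmap {C D} f {X Y} _ : rename.

Definition full_functor (C D : category) (G : functor C D) : Prop :=
  forall (X Y : C) (g : mor (G X) (G Y)), exists f : mor X Y, fmap G f = g.

(* Every functor induces a map on isomorphism classes; the two clauses are    *)
(* its injectivity and surjectivity.                                          *)
Definition bijective_on_iso_classes (C D : category) (G : functor C D) : Prop :=
  (forall X Y : C, isomorphic (G X) (G Y) -> isomorphic X Y) /\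
  (forall Z : D, exists X : C, isomorphic (G X) Z).

Definition naturally_isomorphic (C D : category) (G H : functor C D) : Prop :=
  exists eta : forall X : C, mor (G X) (H X),
    (forall X, is_iso (eta X)) /\
    (forall (X Y : C) (f : mor X Y), eta Y ∘ fmap G f = fmap H f ∘ eta X).

Definition full_subcategory (C : category) (L : C -> Prop) : category :=
  @Category {X : C | L X} (fun X Y => mor (sval X) (sval Y))
    (fun X => idm (sval X)) (fun X Y Z g f => g ∘ f)
    (fun X Y f => mcomp1m f) (fun X Y f => mcompm1 f)
    (fun X Y Z W h g f => mcompA h g f).

Definition mono (C : category) (X Y : C) (f : mor X Y) : Prop :=
  forall (W : C) (g h : mor W X), f ∘ g = f ∘ h -> g = h.

Definition epi (C : category) (X Y : C) (f : mor X Y) : Prop :=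
  forall (W : C) (g h : mor Y W), g ∘ f = h ∘ f -> g = h.

Definition projective (C : category) (P : C) : Prop :=
  forall (Y Z : C) (q : mor Y Z) (f : mor P Z), epi q ->
    exists g : mor P Y, q ∘ g = f.

Definition is_coproduct (C : category) (X : nat -> C) (S : C)
    (i : forall n, mor (X n) S) : Prop :=
  forall (B : C) (f : forall n, mor (X n) B),
    exists! g : mor S B, forall n, g ∘ i n = f n.

Definition has_countable_coproducts (C : category) : Prop :=
  forall X : nat -> C, exists (S : C) (i : forall n, mor (X n) S),
    is_coproduct i.

Record enriched_category := EnrichedCategory {
  enriched_cat :> category;
  hom_zmod : forall X Y : enriched_cat, GRing.Zmodule (mor X Y) }.

HB.instance Definition _ (C : enriched_category) (X Y : C) :
  GRing.Zmodule (mor X Y) := hom_zmod X Y.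

Definition zero_object (C : enriched_category) (Z : C) : Prop :=
  (forall (X : C) (f : mor X Z), f = 0) /\
  (forall (X : C) (f : mor Z X), f = 0).

Record biproduct (C : enriched_category) (X Y : C) := Biproduct {
  bp_ob :> C;
  bp_inl : mor X bp_ob;
  bp_inr : mor Y bp_ob;
  bp_prl : mor bp_ob X;
  bp_prr : mor bp_ob Y;
  bp_ll : bp_prl ∘ bp_inl = idm X;
  bp_rr : bp_prr ∘ bp_inr = idm Y;
  bp_lr : bp_prl ∘ bp_inr = 0;
  bp_rl : bp_prr ∘ bp_inl = 0;
  bp_sum : bp_inl ∘ bp_prl + bp_inr ∘ bp_prr = idm bp_ob }.

Record additive_category := AdditiveCategory {
  additive_cat :> enriched_category;
  mcompDl : forall (X Y Z : additive_cat) (g g' : mor Y Z) (f : mor X Y),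
    (g + g') ∘ f = g ∘ f + g' ∘ f;
  mcompDr : forall (X Y Z : additive_cat) (g : mor Y Z) (f f' : mor X Y),
    g ∘ (f + f') = g ∘ f + g ∘ f';
  ex_zero_object : exists Z : additive_cat, zero_object Z;
  ex_biproduct : forall X Y : additive_cat, inhabited (biproduct X Y) }.

Definition is_kernel (C : enriched_category) (X Y K : C) (f : mor X Y)
    (k : mor K X) : Prop :=
  f ∘ k = 0 /\
  forall (W : C) (g : mor W X), f ∘ g = 0 -> exists! h : mor W K, k ∘ h = g.

Definition is_cokernel (C : enriched_category) (X Y Q : C) (f : mor X Y)
    (q : mor Y Q) : Prop :=
  q ∘ f = 0 /\
  forall (W : C) (g : mor Y W), g ∘ f = 0 -> exists! h : mor Q W, h ∘ q = g.

Definition abelian (C : additive_category) : Prop :=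
  [/\ forall (X Y : C) (f : mor X Y), exists (K : C) (k : mor K X),
        is_kernel f k,
      forall (X Y : C) (f : mor X Y), exists (Q : C) (q : mor Y Q),
        is_cokernel f q,
      forall (X Y : C) (f : mor X Y), mono f ->
        exists (Z : C) (g : mor Y Z), is_kernel g f &
      forall (X Y : C) (f : mor X Y), epi f ->
        exists (W : C) (g : mor W X), is_cokernel g f].

(* The image of f is the kernel of g.                                         *)
Definition exact_at (C : enriched_category) (X Y Z : C) (f : mor X Y)
    (g : mor Y Z) : Prop :=
  exists (K : C) (k : mor K Y) (q : mor X K),
    [/\ is_kernel g k, epi q & f = k ∘ q].

Definition exact_functor (C D : enriched_category) (G : functor C D) : Prop :=
  forall (X Y Z : C) (f : mor X Y) (g : mor Y Z),
    exact_at f g -> exact_at (fmap G f) (fmap G g).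

(* The suspension X[1] = susp X is an automorphism: a functor that is         *)
(* bijective on objects, with inverse X[-1] = desusp X, and on morphisms.     *)
Record stable_category := StableCategory {
  stable_cat :> additive_category;
  susp : functor stable_cat stable_cat;
  suspD : forall (X Y : stable_cat) (f g : mor X Y),
    fmap susp (f + g) = fmap susp f + fmap susp g;
  desusp : stable_cat -> stable_cat;
  suspK : cancel susp desusp;
  desuspK : cancel desusp susp;
  unsusp : forall X Y : stable_cat, mor (susp X) (susp Y) -> mor X Y;
  fmap_suspK : forall X Y : stable_cat,
    cancel (fun f : mor X Y => fmap susp f) (@unsusp X Y);
  unsuspK : forall X Y : stable_cat,
    cancel (@unsusp X Y) (fun f : mor X Y => fmap susp f) }.

Arguments susp {s}.
Arguments desusp {s} X : rename.
Arguments suspK {s} X : rename.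
Arguments desuspK {s} X : rename.
Arguments unsusp {s X Y} f : rename.

(* The isomorphism Hom(X[1], Y) = Hom(X, Y[-1]).                              *)
Definition transpose (C : stable_category) (X Y : C) (w : mor (susp X) Y) :
    mor X (desusp Y) :=
  unsusp (eq_hom (esym (desuspK Y)) ∘ w).

Definition desusp_map (C : stable_category) (X Y : C) (f : mor X Y) :
    mor (desusp X) (desusp Y) :=
  transpose (f ∘ eq_hom (desuspK X)).

Lemma desusp_map1 (C : stable_category) (X : C) :
  desusp_map (idm X) = idm (desusp X).
Proof.
rewrite /desusp_map /transpose mcomp1m eq_homK -fmap1.
exact: fmap_suspK.
Qed.

Lemma desusp_mapM (C : stable_category) (X Y Z : C) (g : mor Y Z)
    (f : mor X Y) :
  desusp_map (g ∘ f) = desusp_map g ∘ desusp_map f.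
Proof.
rewrite /desusp_map /transpose.
apply: (can_inj (@fmap_suspK C _ _)); rewrite fmapM !unsuspK.
rewrite -!mcompA; congr (_ ∘ (_ ∘ _)).
by rewrite [RHS]mcompA eq_homVK mcomp1m.
Qed.

Record stable_abelian_category := StableAbelianCategory {
  stable_abelian_cat :> stable_category;
  stable_abelianP : abelian stable_abelian_cat }.

(* A stable functor comes with a natural isomorphism F(X)[1] = F(X[1]).       *)
Record stable_functor (C D : stable_category) := StableFunctor {
  stable_fun :> functor C D;
  fmapD : forall (X Y : C) (f g : mor X Y),
    fmap stable_fun (f + g) = fmap stable_fun f + fmap stable_fun g;
  fsusp : forall X : C, mor (susp (stable_fun X)) (stable_fun (susp X));
  fsusp_iso : forall X : C, is_iso (fsusp X);
  fsusp_nat : forall (X Y : C) (f : mor X Y),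
    fsusp Y ∘ fmap susp (fmap stable_fun f) =
    fmap stable_fun (fmap susp f) ∘ fsusp X }.

Arguments fsusp {C D} s X : rename.

(* G o F is isomorphic to H as a functor commuting with suspensions.          *)
Definition factors_through (C D E : stable_category) (F : stable_functor C D)
    (G : stable_functor D E) (H : stable_functor C E) : Prop :=
  exists gamma : forall X : C, mor (G (F X)) (H X),
    [/\ forall X, is_iso (gamma X),
        forall (X Y : C) (f : mor X Y),
          gamma Y ∘ fmap G (fmap F f) = fmap H f ∘ gamma X &
        forall X : C,
          gamma (susp X) ∘ (fmap G (fsusp F X) ∘ fsusp G (F X)) =
          fsusp H X ∘ fmap susp (gamma X)].

(* A = A_+ x A_-, with A_+ and A_- viewed as full replete subcategories of A; *)
(* their desuspensions are each other.                                        *)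
Record even_structure (A : stable_category) := EvenStructure {
  pos : A -> Prop;
  neg : A -> Prop;
  pos_replete : forall X Y : A, isomorphic X Y -> pos X -> pos Y;
  neg_replete : forall X Y : A, isomorphic X Y -> neg X -> neg Y;
  hom_pos_neg : forall (X Y : A) (f : mor X Y), pos X -> neg Y -> f = 0;
  hom_neg_pos : forall (X Y : A) (f : mor X Y), neg X -> pos Y -> f = 0;
  even_decomposition : forall X : A, exists (Xp Xm : A) (S : biproduct Xp Xm),
    [/\ pos Xp, neg Xm & isomorphic (S : A) X];
  pos_desusp : forall X : A, pos X <-> neg (desusp X);
  neg_desusp : forall X : A, neg X <-> pos (desusp X) }.

Record triangulated_category := TriangulatedCategory {
  triangulated_cat :> stable_category;
  triangle : forall X Y Z : triangulated_cat,
    mor X Y -> mor Y Z -> mor Z (susp X) -> Prop;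
  triangle_iso : forall (X Y Z X' Y' Z' : triangulated_cat)
      (f : mor X Y) (g : mor Y Z) (h : mor Z (susp X))
      (f' : mor X' Y') (g' : mor Y' Z') (h' : mor Z' (susp X'))
      (a : mor X X') (b : mor Y Y') (c : mor Z Z'),
    is_iso a -> is_iso b -> is_iso c ->
    b ∘ f = f' ∘ a -> c ∘ g = g' ∘ b -> fmap susp a ∘ h = h' ∘ c ->
    triangle f g h -> triangle f' g' h';
  triangle_id : forall X Z : triangulated_cat, zero_object Z ->
    triangle (idm X) (0 : mor X Z) 0;
  triangle_ex : forall (X Y : triangulated_cat) (f : mor X Y),
    exists (Z : triangulated_cat) (g : mor Y Z) (h : mor Z (susp X)),
      triangle f g h;
  triangle_rot : forall (X Y Z : triangulated_cat)
      (f : mor X Y) (g : mor Y Z) (h : mor Z (susp X)),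
    triangle f g h <-> triangle g h (- fmap susp f);
  triangle_mor : forall (X Y Z X' Y' Z' : triangulated_cat)
      (f : mor X Y) (g : mor Y Z) (h : mor Z (susp X))
      (f' : mor X' Y') (g' : mor Y' Z') (h' : mor Z' (susp X'))
      (a : mor X X') (b : mor Y Y'),
    triangle f g h -> triangle f' g' h' -> b ∘ f = f' ∘ a ->
    exists c : mor Z Z', c ∘ g = g' ∘ b /\ fmap susp a ∘ h = h' ∘ c;
  triangle_octahedron : forall (X Y Z U V W : triangulated_cat)
      (f : mor X Y) (f1 : mor Y U) (f2 : mor U (susp X))
      (g : mor Y Z) (g1 : mor Z W) (g2 : mor W (susp Y))
      (h1 : mor Z V) (h2 : mor V (susp X)),
    triangle f f1 f2 -> triangle g g1 g2 -> triangle (g ∘ f) h1 h2 ->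
    exists (u : mor U V) (v : mor V W),
      triangle u v (fmap susp f1 ∘ g2) /\
      [/\ u ∘ f1 = h1 ∘ g, h2 ∘ u = f2, v ∘ h1 = g1 &
          g2 ∘ v = fmap susp f ∘ h2] }.

Definition homological (T : triangulated_category) (A : stable_category)
    (F : stable_functor T A) : Prop :=
  forall (X Y Z : T) (f : mor X Y) (g : mor Y Z) (h : mor Z (susp X)),
    triangle f g h -> exact_at (fmap F f) (fmap F g).

(* Closed under countable, rather than all, coproducts: T is only assumed to  *)
(* have these.  Closedness under desuspension and the other instances of      *)
(* two-out-of-three follow by rotation.                                       *)
Definition localising (T : triangulated_category) (L : T -> Prop) : Prop :=
  [/\ forall X Y : T, isomorphic X Y -> L X -> L Y,
      forall X : T, L X <-> L (susp X),
      forall (X Y Z : T) (f : mor X Y) (g : mor Y Z) (h : mor Z (susp X)),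
        triangle f g h -> L X -> L Y -> L Z &
      forall (X : nat -> T) (S : T) (i : forall n, mor (X n) S),
        is_coproduct i -> (forall n, L (X n)) -> L S].

Definition generated_localising (T : triangulated_category) (P : T -> Prop)
    (X : T) : Prop :=
  forall L : T -> Prop, localising L -> (forall Y, P Y -> L Y) -> L X.

Definition morphism_class (C : category) := forall X Y : C, mor X Y -> Prop.

Definition stable_homological_ideal (T : triangulated_category)
    (I : morphism_class T) : Prop :=
  exists (A : stable_abelian_category) (H : stable_functor T A),
    homological H /\
    forall (X Y : T) (f : mor X Y), I X Y f <-> fmap H f = 0.

Definition compatible_with_countable_coproducts (T : triangulated_category)
    (I : morphism_class T) : Prop :=
  forall (X : nat -> T) (S : T) (i : forall n, mor (X n) S) (B : T)
    (f : mor S B),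
    is_coproduct i -> (I S B f <-> forall n, I (X n) B (f ∘ i n)).

Definition ideal_projective (T : triangulated_category) (I : morphism_class T)
    (P : T) : Prop :=
  forall (B : T) (f : mor P B), I P B f -> f = 0.

Definition ideal_epic (T : triangulated_category) (I : morphism_class T)
    (P X : T) (f : mor P X) : Prop :=
  exists (Z : T) (g : mor X Z) (h : mor Z (susp P)),
    triangle f g h /\ I X Z g.

Definition enough_projectives (T : triangulated_category)
    (I : morphism_class T) : Prop :=
  forall X : T, exists (P : T) (f : mor P X),
    ideal_projective I P /\ ideal_epic I f.

Definition ideal_exact (T : triangulated_category) (I : morphism_class T)
    (A : stable_category) (F : stable_functor T A) : Prop :=
  homological F /\ forall (X Y : T) (f : mor X Y), I X Y f -> fmap F f = 0.

Definition universal_exact (T : triangulated_category) (I : morphism_class T)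
    (A : stable_abelian_category) (F : stable_functor T A) : Prop :=
  ideal_exact I F /\
  forall (B : stable_abelian_category) (H : stable_functor T B),
    ideal_exact I H ->
    (exists G : stable_functor A B, exact_functor G /\ factors_through F G H) /\
    (forall G G' : stable_functor A B,
       exact_functor G -> factors_through F G H ->
       exact_functor G' -> factors_through F G' H ->
       naturally_isomorphic G G').

Definition projectively_generated (T : triangulated_category)
    (I : morphism_class T) : T -> Prop :=
  generated_localising (ideal_projective I).

(* Q, with unit eta, is the value at P of the partial left adjoint of F.      *)
Definition left_adjoint_value (C D : category) (F : functor C D) (P : D) (Q : C)
    (eta : mor P (F Q)) : Prop :=
  forall (B : C) (g : mor P (F B)), exists! k : mor Q B, fmap F k ∘ eta = g.

Record resolution (C : enriched_category) (X : C) := Resolution {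
  res0 : C;
  res1 : C;
  res2 : C;
  res_eps : mor res0 X;
  res_d1 : mor res1 res0;
  res_d2 : mor res2 res1;
  res_proj0 : projective res0;
  res_proj1 : projective res1;
  res_proj2 : projective res2;
  res_epi : epi res_eps;
  res_exact0 : exact_at res_d1 res_eps;
  res_exact1 : exact_at res_d2 res_d1;
  res_mono : mono res_d2 }.

Definition global_dimension_le2 (C : enriched_category) : Prop :=
  forall X : C, inhabited (resolution X).

Lemma mcomp0m (C : additive_category) (X Y Z : C) (f : mor X Y) :
  (0 : mor Y Z) ∘ f = 0.
Proof. by apply: (addrI (0 ∘ f)); rewrite -mcompDl !addr0. Qed.

Lemma mcompm0 (C : additive_category) (X Y Z : C) (g : mor Y Z) :
  g ∘ (0 : mor X Y) = 0.
Proof. by apply: (addrI (g ∘ 0)); rewrite -mcompDr !addr0. Qed.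

Lemma mcompNl (C : additive_category) (X Y Z : C) (g : mor Y Z) (f : mor X Y) :
  (- g) ∘ f = - (g ∘ f).
Proof. by apply: (addrI (g ∘ f)); rewrite -mcompDl !subrr mcomp0m. Qed.

Lemma mcompNr (C : additive_category) (X Y Z : C) (g : mor Y Z) (f : mor X Y) :
  g ∘ (- f) = - (g ∘ f).
Proof. by apply: (addrI (g ∘ f)); rewrite -mcompDr !subrr mcompm0. Qed.

Lemma mcompBl (C : additive_category) (X Y Z : C) (g g' : mor Y Z)
    (f : mor X Y) : (g - g') ∘ f = g ∘ f - g' ∘ f.
Proof. by rewrite mcompDl mcompNl. Qed.

Lemma mcompBr (C : additive_category) (X Y Z : C) (g : mor Y Z)
    (f f' : mor X Y) : g ∘ (f - f') = g ∘ f - g ∘ f'.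
Proof. by rewrite mcompDr mcompNr. Qed.

Lemma exact_mcomp0 (C : additive_category) (X Y Z : C) (f : mor X Y)
    (g : mor Y Z) : exact_at f g -> g ∘ f = 0.
Proof.
by move=> [K [k [q [[gk _] _ ->]]]]; rewrite mcompA gk mcomp0m.
Qed.

Lemma exact_lift (C : additive_category) (P X Y Z : C) (f : mor X Y)
    (g : mor Y Z) (x : mor P Y) :
  projective P -> exact_at f g -> g ∘ x = 0 ->
  exists y : mor P X, f ∘ y = x.
Proof.
move=> projP [K [k [q [[_ kerk] epiq ->]]]] gx0.
have [h [kh _]] := kerk _ x gx0.
have [y qy] := projP _ _ q h epiq.
by exists y; rewrite -mcompA qy.
Qed.

Definition boundary (C : additive_category) (X B : C) (r : resolution X) :
    {pred mor (res2 r) B} :=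
  fun u => `[< exists v : mor (res1 r) B, u = v ∘ res_d2 r >].

Arguments boundary {C X} B r u : rename.

Lemma boundary_zmod_closed (C : additive_category) (X B : C)
  (r : resolution X) : zmod_closed (boundary B r).
Proof.
split; first by apply/asboolP; exists 0; rewrite mcomp0m.
move=> u u' /asboolP[v ->] /asboolP[v' ->].
by apply/asboolP; exists (v - v'); rewrite mcompBl.
Qed.

HB.instance Definition _ (C : additive_category) (X B : C)
    (r : resolution X) :=
  GRing.isZmodClosed.Build (mor (res2 r) B) (boundary B r)
    (boundary_zmod_closed B r).

(* Ext^2(X, B) computed by R X, where R fixes a resolution of every object;   *)
(* Ext^2 does not depend on R up to canonical isomorphism.  The same group is *)
(* Ext^1(Omega X, B), computed by the resolution 0 -> P2 -> P1 -> Omega X,    *)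
(* and the isomorphism between the two is the identity.                       *)
Definition Ext2 (C : additive_category) (R : forall X : C, resolution X)
    (X B : C) : zmodType :=
  {ideal_quot (boundary B (R X) : zmodClosed (mor (res2 (R X)) B))}.

Definition ext_class (C : additive_category) (R : forall X : C, resolution X)
    (X B : C) (u : mor (res2 (R X)) B) : Ext2 R X B := \pi u.

Definition ext_repr (C : additive_category) (R : forall X : C, resolution X)
    (X B : C) (x : Ext2 R X B) : mor (res2 (R X)) B := repr x.

Lemma ext_reprK (C : additive_category) (R : forall X : C, resolution X)
    (X B : C) (x : Ext2 R X B) : ext_class (ext_repr x) = x.
Proof. exact: reprK. Qed.

Lemma ext_classP (C : additive_category) (R : forall X : C, resolution X)
    (X B : C) (u u' : mor (res2 (R X)) B) :
  ext_class u = ext_class u' <->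
  exists v : mor (res1 (R X)) B, u - u' = v ∘ res_d2 (R X).
Proof.
split.
  by move/eqP; rewrite /ext_class -Quotient.idealrBE => /asboolP.
by move=> h; apply/eqP; rewrite /ext_class -Quotient.idealrBE; apply/asboolP.
Qed.

Definition ext_push (C : additive_category) (R : forall X : C, resolution X)
    (X B B' : C) (g : mor B B') (x : Ext2 R X B) : Ext2 R X B' :=
  ext_class (g ∘ ext_repr x).

Lemma ext_pushE (C : additive_category) (R : forall X : C, resolution X)
    (X B B' : C) (g : mor B B') (u : mor (res2 (R X)) B) :
  ext_push g (ext_class u) = ext_class (g ∘ u).
Proof.
have /ext_classP[v hv] := ext_reprK (ext_class u).
by apply/ext_classP; exists (g ∘ v); rewrite -mcompBr hv mcompA.
Qed.

Lemma ext_push1 (C : additive_category) (R : forall X : C, resolution X)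
    (X B : C) (x : Ext2 R X B) : ext_push (idm B) x = x.
Proof. by rewrite /ext_push mcomp1m ext_reprK. Qed.

Lemma ext_pushM (C : additive_category) (R : forall X : C, resolution X)
    (X B B' B'' : C) (g' : mor B' B'') (g : mor B B') (x : Ext2 R X B) :
  ext_push (g' ∘ g) x = ext_push g' (ext_push g x).
Proof. by rewrite -(ext_reprK x) !ext_pushE mcompA. Qed.

(* c2 is the top component of a chain map between the resolutions over f.     *)
Definition chain_lift (C : additive_category) (R : forall X : C, resolution X)
    (X Y : C) (f : mor X Y) (c2 : mor (res2 (R X)) (res2 (R Y))) : Prop :=
  exists (c0 : mor (res0 (R X)) (res0 (R Y)))
         (c1 : mor (res1 (R X)) (res1 (R Y))),
    [/\ res_eps (R Y) ∘ c0 = f ∘ res_eps (R X),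
        res_d1 (R Y) ∘ c1 = c0 ∘ res_d1 (R X) &
        res_d2 (R Y) ∘ c2 = c1 ∘ res_d2 (R X)].

Arguments chain_lift {C} R {X Y} f c2.

Lemma chain_lift_ex (C : additive_category) (R : forall X : C, resolution X)
    (X Y : C) (f : mor X Y) : exists c2, chain_lift R f c2.
Proof.
have [c0 h0] := res_proj0 (f ∘ res_eps (R X)) (@res_epi _ _ (R Y)).
have [|c1 h1] := exact_lift (x := c0 ∘ res_d1 (R X)) (@res_proj1 _ _ (R X))
                   (@res_exact0 _ _ (R Y)).
  by rewrite mcompA h0 -mcompA (exact_mcomp0 (@res_exact0 _ _ (R X))) mcompm0.
have [|c2 h2] := exact_lift (x := c1 ∘ res_d2 (R X)) (@res_proj2 _ _ (R X))
                   (@res_exact1 _ _ (R Y)).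
  by rewrite mcompA h1 -mcompA (exact_mcomp0 (@res_exact1 _ _ (R X))) mcompm0.
by exists c2, c0, c1.
Qed.

Lemma chain_lift_unique (C : additive_category)
    (R : forall X : C, resolution X) (X Y : C) (f : mor X Y) c2 c2' :
  chain_lift R f c2 -> chain_lift R f c2' ->
  exists s : mor (res1 (R X)) (res2 (R Y)), c2 - c2' = s ∘ res_d2 (R X).
Proof.
move=> [c0 [c1 [h0 h1 h2]]] [c0' [c1' [h0' h1' h2']]].
have [|s0 hs0] := exact_lift (x := c0 - c0') (@res_proj0 _ _ (R X))
                    (@res_exact0 _ _ (R Y)).
  by rewrite mcompBr h0 h0' subrr.
have [|s1 hs1] := exact_lift (x := c1 - c1' - s0 ∘ res_d1 (R X))
                    (@res_proj1 _ _ (R X)) (@res_exact1 _ _ (R Y)).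
  by rewrite !mcompBr h1 h1' mcompA hs0 mcompBl subrr.
exists s1; apply: (@res_mono _ _ (R Y)).
rewrite mcompA hs1 mcompBr h2 h2' !mcompBl -[s0 ∘ _ ∘ _]mcompA.
by rewrite (exact_mcomp0 (@res_exact1 _ _ (R X))) mcompm0 subr0.
Qed.

Definition ext_pull (C : additive_category) (R : forall X : C, resolution X)
    (X Y B : C) (f : mor X Y) (y : Ext2 R Y B) : Ext2 R X B :=
  ext_class (ext_repr y ∘ projT1 (cid (chain_lift_ex R f))).

Lemma ext_pullE (C : additive_category) (R : forall X : C, resolution X)
    (X Y B : C) (f : mor X Y) c2 (u : mor (res2 (R Y)) B) :
  chain_lift R f c2 -> ext_pull f (ext_class u) = ext_class (u ∘ c2).
Proof.
move=> hc; rewrite /ext_pull; case: cid => c2' /= hc'.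
have [s hs] := chain_lift_unique hc' hc.
have /ext_classP[v hv] := ext_reprK (ext_class u).
have [c0 [c1 [_ _ h2]]] := hc'.
apply/ext_classP; exists (v ∘ c1 + u ∘ s).
rewrite mcompDl -!mcompA -h2 -hs mcompBr mcompA -hv mcompBl addrA.
by rewrite subrK.
Qed.

Lemma ext_pull1 (C : additive_category) (R : forall X : C, resolution X)
    (X B : C) (x : Ext2 R X B) : ext_pull (idm X) x = x.
Proof.
rewrite -(ext_reprK x) (ext_pullE (c2 := idm _)) ?mcompm1 //.
by exists (idm _), (idm _); rewrite !mcompm1 !mcomp1m.
Qed.

Lemma ext_pullM (C : additive_category) (R : forall X : C, resolution X)
    (X Y Z B : C) (g : mor Y Z) (f : mor X Y) (x : Ext2 R Z B) :
  ext_pull (g ∘ f) x = ext_pull f (ext_pull g x).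
Proof.
have [c2 hc] := chain_lift_ex R f; have [b2 hb] := chain_lift_ex R g.
rewrite -(ext_reprK x) (ext_pullE _ hb) (ext_pullE _ hc).
rewrite (ext_pullE (c2 := b2 ∘ c2)) ?mcompA //.
case: hc hb => [c0 [c1 [h0 h1 h2]]] [b0 [b1 [k0 k1 k2]]].
by exists (b0 ∘ c0), (b1 ∘ c1); split;
  rewrite mcompA ?(k0, k1, k2) -mcompA ?(h0, h1, h2) mcompA.
Qed.

Lemma ext_pull_push (C : additive_category) (R : forall X : C, resolution X)
    (X Y B B' : C) (g : mor B B') (f : mor X Y) (x : Ext2 R Y B) :
  ext_pull f (ext_push g x) = ext_push g (ext_pull f x).
Proof.
have [c2 hc] := chain_lift_ex R f.
by rewrite -(ext_reprK x) ext_pushE !(ext_pullE _ hc) ext_pushE mcompA.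
Qed.

Record delta_object (A : stable_category) (R : forall X : A, resolution X) :=
  DeltaObject {
    delta_ob :> A;
    delta_class : Ext2 R delta_ob (desusp delta_ob) }.

Definition delta_compatible (A : stable_category)
    (R : forall X : A, resolution X) (x y : delta_object R) (f : mor x y) :
    bool :=
  ext_pull f (delta_class y) == ext_push (desusp_map f) (delta_class x).

Definition delta_hom (A : stable_category) (R : forall X : A, resolution X)
    (x y : delta_object R) : Type :=
  {f : mor x y | delta_compatible f}.

Lemma delta_compatible1 (A : stable_category)
    (R : forall X : A, resolution X) (x : delta_object R) :
  delta_compatible (idm (x : A)).
Proof. by rewrite /delta_compatible desusp_map1 ext_push1 ext_pull1. Qed.

Lemma delta_compatibleM (A : stable_category)
    (R : forall X : A, resolution X) (x y z : delta_object R)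
    (g : mor (y : A) z) (f : mor (x : A) y) :
  delta_compatible g -> delta_compatible f -> delta_compatible (g ∘ f).
Proof.
rewrite /delta_compatible => /eqP hg /eqP hf; apply/eqP.
by rewrite ext_pullM hg ext_pull_push hf -ext_pushM -desusp_mapM.
Qed.

Definition delta_id (A : stable_category) (R : forall X : A, resolution X)
    (x : delta_object R) : delta_hom x x :=
  exist _ (idm (x : A)) (delta_compatible1 x).

Definition delta_comp (A : stable_category) (R : forall X : A, resolution X)
    (x y z : delta_object R) (g : delta_hom y z) (f : delta_hom x y) :
    delta_hom x z :=
  exist _ (sval g ∘ sval f) (delta_compatibleM (svalP g) (svalP f)).

Lemma delta_comp1m (A : stable_category) (R : forall X : A, resolution X)
    (x y : delta_object R) (f : delta_hom x y) : delta_comp (delta_id y) f = f.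
Proof. by apply/val_inj; rewrite /= mcomp1m. Qed.

Lemma delta_compm1 (A : stable_category) (R : forall X : A, resolution X)
    (x y : delta_object R) (f : delta_hom x y) : delta_comp f (delta_id x) = f.
Proof. by apply/val_inj; rewrite /= mcompm1. Qed.

Lemma delta_compA (A : stable_category) (R : forall X : A, resolution X)
    (x y z w : delta_object R) (h : delta_hom z w) (g : delta_hom y z)
    (f : delta_hom x y) :
  delta_comp h (delta_comp g f) = delta_comp (delta_comp h g) f.
Proof. by apply/val_inj; rewrite /= mcompA. Qed.

Definition delta_category (A : stable_category)
    (R : forall X : A, resolution X) : category :=
  Category (@delta_comp1m A R) (@delta_compm1 A R) (@delta_compA A R).

Record lifting (T : triangulated_category) (I : morphism_class T)
    (A : stable_category) (F : stable_functor T A) (X : A) := Lifting {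
  lift_ob :> T;
  lift_generated : projectively_generated I lift_ob;
  lift_map : mor (F lift_ob) X;
  lift_iso : is_iso lift_map }.

Lemma is_iso_idm (C : category) (X : C) : is_iso (idm X).
Proof. by exists (idm X); rewrite mcomp1m. Qed.

Definition self_lifting (T : triangulated_category) (I : morphism_class T)
    (A : stable_category) (F : stable_functor T A) (Y : T)
    (hY : projectively_generated I Y) : lifting I F (F Y) :=
  Lifting hY (is_iso_idm (F Y)).

Record syzygy (C : enriched_category) (X : C) (r : resolution X) := Syzygy {
  syz_ob :> C;
  syz_in : mor syz_ob (res0 r);
  syz_ker : is_kernel (res_eps r) syz_in;
  syz_pr : mor (res1 r) syz_ob;
  syz_prP : syz_in ∘ syz_pr = res_d1 r }.

(* For a lifting D of Omega X, the resolution 0 -> P2 -> P1 -> Omega X of     *)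
(* F(D) lifts to an exact triangle Q2 -> Q1 -> D -> Q2[1], where Qi is the    *)
(* value at Pi of the left adjoint of F.  Applying T(-, B) gives the exact    *)
(* sequence                                                                   *)
(*   T(Q1[1], B) -> T(Q2[1], B) -> T(D, B) -> T(Q1, B),                       *)
(* in which T(Qi[1], B) = Hom(Pi[1], F(B)) = Hom(Pi, F(B)[-1]): this is the   *)
(* Universal Coefficient sequence, and it identifies the kernel of            *)
(* T(D, B) -> Hom(Omega X, F(B)) with Ext^1(Omega X, F(B)[-1]).  The          *)
(* predicate says that x corresponds to c under this identification.          *)
(* Another sign convention for the identification would replace every         *)
(* obstruction class by its opposite.                                         *)
Definition uct_class (T : triangulated_category) (I : morphism_class T)
    (A : stable_category) (F : stable_functor T A)
    (R : forall X : A, resolution X) (X : A) (W : syzygy (R X))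
    (D : lifting I F W) (B : T) (x : mor (D : T) B)
    (c : Ext2 R X (desusp (F B))) : Prop :=
  exists (Q1 Q2 : T) (eta1 : mor (res1 (R X)) (F Q1))
         (eta2 : mor (res2 (R X)) (F Q2)) (q : mor Q2 Q1) (p : mor Q1 D)
         (b : mor (D : T) (susp Q2)) (u : mor (susp Q2) B),
    [/\ left_adjoint_value eta1, left_adjoint_value eta2,
        fmap F q ∘ eta2 = eta1 ∘ res_d2 (R X) &
        lift_map D ∘ fmap F p ∘ eta1 = syz_pr W] /\
    [/\ triangle q p b, x = u ∘ b &
        c = ext_class (transpose (fmap F u ∘ fsusp F Q2 ∘ fmap susp eta2))].

(* phi is the map obtained by completing the adjoint Q0 -> L of               *)
(* P0 -> X = F(L) to an exact triangle D -> Q0 -> L -> D[1]; moreover F(phi)  *)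
(* is the inclusion of F(D) = Omega X into F(Q0) = P0.                        *)
Definition presents (T : triangulated_category) (I : morphism_class T)
    (A : stable_category) (F : stable_functor T A)
    (R : forall X : A, resolution X) (X : A) (W : syzygy (R X)) (Q0 : T)
    (eta0 : mor (res0 (R X)) (F Q0)) (D : lifting I F W) (L : lifting I F X)
    (phi : mor (D : T) Q0) : Prop :=
  exists (a : mor Q0 L) (b : mor (L : T) (susp D)),
    [/\ lift_map L ∘ fmap F a ∘ eta0 = res_eps (R X), triangle phi a b &
        fmap F phi = eta0 ∘ syz_in W ∘ lift_map D].

(* d = delta(L2, L1): c0 is the class of phi2 - phi1, transported from        *)
(* Ext^1(Omega X, F(Q0)[-1]) to Ext^1(Omega X, P0[-1]).                       *)
Definition relative_obstruction (T : triangulated_category)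
    (I : morphism_class T) (A : stable_category) (F : stable_functor T A)
    (R : forall X : A, resolution X) (X : A) (L2 L1 : lifting I F X)
    (d : Ext2 R X (desusp X)) : Prop :=
  exists (W : syzygy (R X)) (Q0 : T) (eta0 : mor (res0 (R X)) (F Q0))
         (D : lifting I F W) (phi1 phi2 : mor (D : T) Q0)
         (c0 : Ext2 R X (desusp (res0 (R X)))),
    [/\ left_adjoint_value eta0, presents eta0 L1 phi1 &
        presents eta0 L2 phi2] /\
    uct_class (phi2 - phi1) (ext_push (desusp_map eta0) c0) /\
    d = ext_push (desusp_map (res_eps (R X))) c0.

Definition canonical_lifting (T : triangulated_category)
    (I : morphism_class T) (A : stable_category) (F : stable_functor T A)
    (E : even_structure A) (X : A) (L : lifting I F X) : Prop :=
  exists (Xp Xm : A) (ip : mor Xp X) (im : mor Xm X) (pp : mor X Xp)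
         (pm : mor X Xm) (Lp : lifting I F Xp) (Lm : lifting I F Xm)
         (jp : mor (Lp : T) L) (jm : mor (Lm : T) L) (qp : mor (L : T) Lp)
         (qm : mor (L : T) Lm),
    [/\ pos E Xp, neg E Xm,
        [/\ pp ∘ ip = idm Xp, pm ∘ im = idm Xm, pp ∘ im = 0, pm ∘ ip = 0 &
            ip ∘ pp + im ∘ pm = idm X],
        [/\ qp ∘ jp = idm (Lp : T), qm ∘ jm = idm (Lm : T), qp ∘ jm = 0,
            qm ∘ jp = 0 & jp ∘ qp + jm ∘ qm = idm (L : T)] &
        lift_map L =
          ip ∘ lift_map Lp ∘ fmap F qp + im ∘ lift_map Lm ∘ fmap F qm].

Definition is_obstruction_class (T : triangulated_category)
    (I : morphism_class T) (A : stable_category) (F : stable_functor T A)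
    (E : even_structure A) (R : forall X : A, resolution X)
    (Y : full_subcategory (projectively_generated I))
    (d : Ext2 R (F (sval Y)) (desusp (F (sval Y)))) : Prop :=
  exists L0 : lifting I F (F (sval Y)),
    canonical_lifting E L0 /\
    relative_obstruction (self_lifting F (svalP Y)) L0 d.

(* The chosen d is the only one when is_obstruction_class is satisfied by a   *)
(* unique d, and a junk value otherwise.                                      *)
Definition obstruction_class (T : triangulated_category)
    (I : morphism_class T) (A : stable_category) (F : stable_functor T A)
    (E : even_structure A) (R : forall X : A, resolution X)
    (Y : full_subcategory (projectively_generated I)) :
    Ext2 R (F (sval Y)) (desusp (F (sval Y))) :=
  xget 0 [set d | is_obstruction_class E d].

Definition Fdelta_ob (T : triangulated_category) (I : morphism_class T)
    (A : stable_category) (F : stable_functor T A) (E : even_structure A)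
    (R : forall X : A, resolution X)
    (Y : full_subcategory (projectively_generated I)) : delta_category R :=
  DeltaObject (obstruction_class F E R Y).

Definition Fdelta_functorial (T : triangulated_category)
    (I : morphism_class T) (A : stable_category) (F : stable_functor T A)
    (E : even_structure A) (R : forall X : A, resolution X) : Prop :=
  forall (Y Z : full_subcategory (projectively_generated I)) (f : mor Y Z),
    @delta_compatible A R (Fdelta_ob F E R Y) (Fdelta_ob F E R Z)
      (fmap F (f : mor (sval Y) (sval Z))).

Definition Fdelta_map (T : triangulated_category) (I : morphism_class T)
    (A : stable_category) (F : stable_functor T A) (E : even_structure A)
    (R : forall X : A, resolution X) (H : Fdelta_functorial I F E R)
    (Y Z : full_subcategory (projectively_generated I)) (f : mor Y Z) :
    mor (Fdelta_ob F E R Y) (Fdelta_ob F E R Z) :=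
  exist (fun g : mor (F (sval Y)) (F (sval Z)) =>
           delta_compatible (x := Fdelta_ob F E R Y) (y := Fdelta_ob F E R Z) g)
    (fmap F (f : mor (sval Y) (sval Z))) (H Y Z f).

Lemma Fdelta_map1 (T : triangulated_category) (I : morphism_class T)
    (A : stable_category) (F : stable_functor T A) (E : even_structure A)
    (R : forall X : A, resolution X) (H : Fdelta_functorial I F E R)
    (Y : full_subcategory (projectively_generated I)) :
  Fdelta_map H (idm Y) = idm (Fdelta_ob F E R Y).
Proof. by apply/val_inj; rewrite /= fmap1. Qed.

Lemma Fdelta_mapM (T : triangulated_category) (I : morphism_class T)
    (A : stable_category) (F : stable_functor T A) (E : even_structure A)
    (R : forall X : A, resolution X) (H : Fdelta_functorial I F E R)
    (X Y Z : full_subcategory (projectively_generated I))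
    (g : mor Y Z) (f : mor X Y) :
  Fdelta_map H (g ∘ f) = Fdelta_map H g ∘ Fdelta_map H f.
Proof. by apply/val_inj; rewrite /= fmapM. Qed.

Definition Fdelta (T : triangulated_category) (I : morphism_class T)
    (A : stable_category) (F : stable_functor T A) (E : even_structure A)
    (R : forall X : A, resolution X) (H : Fdelta_functorial I F E R)
    : functor (full_subcategory (projectively_generated I))
              (delta_category R) :=
  Functor (Fdelta_map1 H) (Fdelta_mapM H).

(* Main.v *)
Require Import Defs.
From HB Require Import structures.
From mathcomp Require Import all_boot all_algebra.
From mathcomp Require Import boolp classical_sets.

(** Why the theorem holds.

    The universal property of F is used to compare T with A on projective
    objects. Call an object X of A presented when it comes with an exact
    sequence F(Q) -> F(P) -> X -> 0, where Q -> P is a map of I-projective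
    objects of T, and let the morphisms of presented objects be the morphisms of
    A that lift to the generators P. These form a stable abelian category: a
    kernel is presented by an I-projective cover of a weak pullback in T. The
    functor F factors through it, so the universal property yields an exact
    functor from A to presented objects, and its uniqueness part says that
    forgetting the presentation again gives the identity of A. Hence every object
    of A is a quotient of some F(P), and every morphism F(P) -> F(Y) with P
    I-projective comes from a unique morphism P -> Y (iproj_full). Since
    idempotents of T split by the telescope construction, the left adjoint of F
    is defined at all projective objects, with invertible unit. The record
    lifts_projectives collects these facts.

    A morphism between generated objects which F inverts is an isomorphism: its
    cone is generated and contractible, so the identity of the cone is zero. This
    is the last claim of the theorem, and with fullness it gives injectivity on
    isomorphism classes.

    For the rest, take liftings L of X and L' of X' and a morphism f : X -> X'.
    With the triangle D -phi-> Q0 -> L that lifts the syzygy sequence of X, the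
    map k : Q0 -> L' adjoint to P0 -> X -> X' extends to L if and only if
    k phi = 0. As F kills k phi, the universal coefficient sequence of D turns it
    into a class in Ext^2(X, X'[-1]), the obstruction to lifting f. It vanishes
    if and only if f lifts, the relative obstruction class delta(L2, L1) is the
    obstruction of the identity of X from L2 to L1, and the obstruction is a
    derivation: ob(g f) = ob(g) f + g ob(f) (lift_obstruction_comp).

    Evenness makes Ext^2(X, X'[-1]) vanish when X and X' are both positive or both
    negative, so every morphism between canonical liftings lifts. Computing the
    obstruction of f : F(Y) -> F(Z) to a lift from Y to the canonical lifting of
    F(Z) through Z and through the canonical lifting of F(Y), the derivation rule
    gives ob(f) = f delta(Y) - delta(Z) f (obstruction_commutator). So f lifts to
    T if and only if it is a morphism in the category of pairs (A, delta), which
    proves at once that the functor is well defined and full. The derivation rule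
    for two canonical liftings also shows that delta does not depend on choices.
    Finally, any class is attained: adding to phi a map with prescribed universal
    coefficient class changes its cone to a lifting with prescribed obstruction
    (relative_obstruction_onto). *)

Set Implicit Arguments.
Unset Strict Implicit.
Unset Printing Implicit Defensive.

Import GRing.Theory.
Local Open Scope ring_scope.

(** * Isomorphisms, monomorphisms and epimorphisms *)

Lemma is_iso_comp (C : category) (X Y Z : C) (g : mor Y Z) (f : mor X Y) :
  is_iso g -> is_iso f -> is_iso (g ∘ f).
Proof.
move=> [g' [gK gVK]] [f' [fK fVK]]; exists (f' ∘ g'); split.
  by rewrite mcompA -(mcompA f') gK mcompm1.
by rewrite mcompA -(mcompA g) fVK mcompm1.
Qed.

Lemma is_iso_fmap (C D : category) (G : functor C D) (X Y : C) (f : mor X Y) :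
  is_iso f -> is_iso (fmap G f).
Proof.
by move=> [g [gf fg]]; exists (fmap G g); rewrite -!fmapM gf fg !fmap1.
Qed.

Lemma is_iso_inv (C : category) (X Y : C) (f : mor X Y) :
  is_iso f -> exists g : mor Y X, [/\ is_iso g, g ∘ f = idm X & f ∘ g = idm Y].
Proof. by move=> [g [gf fg]]; exists g; split=> //; exists f. Qed.

Lemma is_iso_mono (C : category) (X Y : C) (f : mor X Y) : is_iso f -> mono f.
Proof.
move=> [g [gf _]] W x y fxy.
by rewrite -(mcomp1m x) -(mcomp1m y) -gf -!mcompA fxy.
Qed.

Lemma is_iso_epi (C : category) (X Y : C) (f : mor X Y) : is_iso f -> epi f.
Proof.
move=> [g [_ fg]] W x y fxy.
by rewrite -(mcompm1 x) -(mcompm1 y) -fg !mcompA fxy.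
Qed.

Lemma epi_comp (C : category) (X Y Z : C) (g : mor Y Z) (f : mor X Y) :
  epi g -> epi f -> epi (g ∘ f).
Proof. by move=> eg ef W x y; rewrite !mcompA => /ef /eg. Qed.

Lemma mono_comp (C : category) (X Y Z : C) (g : mor Y Z) (f : mor X Y) :
  mono g -> mono f -> mono (g ∘ f).
Proof. by move=> mg mf W x y; rewrite -!mcompA => /mg /mf. Qed.

Section AdditiveBasics.
Variable C : additive_category.
Implicit Types X Y Z W : C.

Lemma mono_eq0 X Y W (f : mor X Y) (x : mor W X) : mono f -> f ∘ x = 0 -> x = 0.
Proof. by move=> mf fx; apply: mf; rewrite fx mcompm0. Qed.

Lemma epi_eq0 X Y W (f : mor X Y) (x : mor Y W) : epi f -> x ∘ f = 0 -> x = 0.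
Proof. by move=> ef xf; apply: ef; rewrite xf mcomp0m. Qed.

Lemma mono_of_eq0 X Y (f : mor X Y) :
  (forall W (x : mor W X), f ∘ x = 0 -> x = 0) -> mono f.
Proof.
move=> f0 W x y fxy; apply/eqP; rewrite -subr_eq0; apply/eqP/f0.
by rewrite mcompBr fxy subrr.
Qed.

Lemma epi_of_eq0 X Y (f : mor X Y) :
  (forall W (x : mor Y W), x ∘ f = 0 -> x = 0) -> epi f.
Proof.
move=> f0 W x y fxy; apply/eqP; rewrite -subr_eq0; apply/eqP/f0.
by rewrite mcompBl fxy subrr.
Qed.

Lemma kernel_mono X Y K (f : mor X Y) (k : mor K X) : is_kernel f k -> mono k.
Proof.
move=> [fk univ] W g h kgh.
have [|l [_ lu]] := univ W (k ∘ g); first by rewrite mcompA fk mcomp0m.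
by rewrite -(lu g) // -(lu h).
Qed.

Lemma kernel_factor X Y K W (f : mor X Y) (k : mor K X) (x : mor W X) :
  is_kernel f k -> f ∘ x = 0 -> exists y : mor W K, k ∘ y = x.
Proof. by move=> [_ univ] /univ[y [ky _]]; exists y. Qed.

Lemma is_kernelP X Y K (f : mor X Y) (k : mor K X) :
  f ∘ k = 0 -> mono k ->
  (forall W (x : mor W X), f ∘ x = 0 -> exists y : mor W K, k ∘ y = x) ->
  is_kernel f k.
Proof.
move=> fk mk kf; split=> // W x /kf[y ky].
by exists y; split=> // y' ky'; apply: mk; rewrite ky ky'.
Qed.

Lemma is_cokernelP X Y Q (f : mor X Y) (q : mor Y Q) :
  q ∘ f = 0 -> epi q ->
  (forall W (x : mor Y W), x ∘ f = 0 -> exists y : mor Q W, y ∘ q = x) ->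
  is_cokernel f q.
Proof.
move=> qf eq qfac; split=> // W x /qfac[y yq].
by exists y; split=> // y' yq'; apply: eq; rewrite yq yq'.
Qed.

Lemma cokernel_epi X Y Q (f : mor X Y) (q : mor Y Q) : is_cokernel f q -> epi q.
Proof.
move=> [qf univ] W g h gq.
have [|l [_ lu]] := univ W (g ∘ q); first by rewrite -mcompA qf mcompm0.
by rewrite -(lu g) // -(lu h).
Qed.

End AdditiveBasics.

(** * Computing in an abelian category with projective test objects *)

Definition enough_projective_objects (C : category) : Prop :=
  forall X : C, exists (P : C) (e : mor P X), projective P /\ epi e.

Section ProjectiveElements.
Variable C : additive_category.
Hypothesis enoughC : enough_projective_objects C.
Implicit Types X Y Z W P : C.

Lemma eq0_on_projectives X Y (f : mor X Y) :
  (forall P (x : mor P X), projective P -> f ∘ x = 0) -> f = 0.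
Proof.
by move=> f0; have [P [e [pP ee]]] := enoughC X; apply: (epi_eq0 ee); apply: f0.
Qed.

Lemma mono_on_projectives X Y (f : mor X Y) :
  (forall P (x : mor P X), projective P -> f ∘ x = 0 -> x = 0) -> mono f.
Proof.
move=> f0; apply: mono_of_eq0 => W x fx; apply: eq0_on_projectives => P y pP.
by apply: f0; rewrite // mcompA fx mcomp0m.
Qed.

Lemma epi_on_projectives X Y (f : mor X Y) :
  (forall P (y : mor P Y), projective P -> exists x, f ∘ x = y) -> epi f.
Proof.
move=> fl W x y xy; have [P [e [pP ee]]] := enoughC Y.
by apply: ee; have [z <-] := fl P e pP; rewrite !mcompA xy.
Qed.

Hypothesis abC : abelian C.

Lemma exact_on_projectives X Y Z (f : mor X Y) (g : mor Y Z) :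
  g ∘ f = 0 ->
  (forall P (y : mor P Y), projective P -> g ∘ y = 0 -> exists x, f ∘ x = y) ->
  exact_at f g.
Proof.
case: abC => kerC _ _ _ gf fl; have [K [k kk]] := kerC _ _ g.
have [q kq] := kernel_factor kk gf; exists K, k, q; split=> //.
apply: epi_on_projectives => P y pP.
have [|x fx] := fl P (k ∘ y) pP; first by rewrite mcompA kk.1 mcomp0m.
by exists x; apply: (kernel_mono kk); rewrite mcompA kq.
Qed.

(** A monomorphism is the kernel of some g, and g vanishes since f is epic. *)
Lemma mono_epi_iso X Y (f : mor X Y) : mono f -> epi f -> is_iso f.
Proof.
move=> mf ef; case: abC => _ _ monoC _; have [Z [g kf]] := monoC _ _ _ mf.
have g0 : g = 0 by apply: (epi_eq0 ef); exact: kf.1.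
have [|h fh] := kernel_factor (x := idm Y) kf; first by rewrite g0 mcomp0m.
by exists h; split=> //; apply: mf; rewrite mcompA fh mcomp1m mcompm1.
Qed.

(** An epimorphism is the cokernel of some g; h kills g because, on projective
    test objects, g factors through d. *)
Lemma exact_epi_factor X Y Z W (d : mor X Y) (f : mor Y Z) (h : mor Y W) :
  epi f -> exact_at d f -> h ∘ d = 0 -> exists h' : mor Z W, h' ∘ f = h.
Proof.
move=> ef df hd; case: abC => _ _ _ epiC; have [V [g cf]] := epiC _ _ _ ef.
have hg : h ∘ g = 0.
  apply: eq0_on_projectives => P x pP.
  have [|y dy] := exact_lift (x := g ∘ x) pP df.
    by rewrite mcompA cf.1 mcomp0m.
  by rewrite -mcompA -dy mcompA hd mcomp0m.
by have [h' [hf _]] := cf.2 _ _ hg; exists h'.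
Qed.

(** The kernel k of q receives f; the factorisation is epic since a proper
    subobject of k containing the image of f would have a larger cokernel. *)
Lemma cokernel_exact X Y Q (f : mor X Y) (q : mor Y Q) :
  is_cokernel f q -> exact_at f q.
Proof.
move=> cq; case: abC => kerC _ monoC _; have [K [k kk]] := kerC _ _ q.
have mk := kernel_mono kk.
have [m km] := kernel_factor kk cq.1; exists K, k, m; split=> //.
apply: epi_of_eq0 => W n nm; have [J [j kj]] := kerC _ _ n.
have [m' jm] := kernel_factor kj nm.
(* The subobject k j of Y contains the image of f, hence all of K. *)
have [Z [g kg]] := monoC _ _ _ (mono_comp mk (kernel_mono kj)).
have [|g' [gq _]] := cq.2 _ g.
  by rewrite -km -jm !mcompA -(mcompA g) kg.1 mcomp0m.
have [|s ks] := kernel_factor (x := k) kg.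
  by rewrite -gq -mcompA kk.1 mcompm0.
have js : j ∘ s = idm K by apply: mk; rewrite mcompA ks mcompm1.
by rewrite -(mcompm1 n) -js mcompA kj.1 mcomp0m.
Qed.

Lemma exact_0_epi X Y Z (f : mor X Y) : exact_at f (0 : mor Y Z) -> epi f.
Proof.
move=> fe; apply: epi_on_projectives => P y pP.
by apply: (exact_lift pP fe); rewrite mcomp0m.
Qed.

End ProjectiveElements.

(** * The suspension *)

Lemma eq_homE (C : category) (X : C) (e : X = X) : eq_hom e = idm X.
Proof. by rewrite (Prop_irrelevance e erefl). Qed.

Lemma eq_hom_trans (C : category) (X Y Z : C) (e : X = Y) (e' : Y = Z) :
  eq_hom e' ∘ eq_hom e = eq_hom (etrans e e').
Proof. by case: Z / e'; rewrite mcomp1m. Qed.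

Lemma eq_hom_iso (C : category) (X Y : C) (e : X = Y) : is_iso (eq_hom e).
Proof. by exists (eq_hom (esym e)); rewrite eq_homK eq_homVK. Qed.

Lemma fmap_eq_hom (C D : category) (G : functor C D) (X Y : C) (e : X = Y) :
  fmap G (eq_hom e) = eq_hom (congr1 G e).
Proof. by case: Y / e; rewrite /= fmap1. Qed.

Section Suspension.
Variable C : stable_category.
Implicit Types X Y Z W : C.

Lemma susp_inj X Y (f g : mor X Y) : fmap susp f = fmap susp g -> f = g.
Proof. exact: (can_inj (@fmap_suspK C X Y)). Qed.

(** Writing an object or a morphism as a suspension and forgetting how spares
    the transport along X[-1][1] = X. *)
Lemma susp_ob_surj X : exists X', X = susp X'.
Proof. by exists (desusp X); rewrite desuspK. Qed.

Lemma susp_surj X Y (g : mor (susp X) (susp Y)) :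
  exists f : mor X Y, fmap susp f = g.
Proof. by exists (unsusp g); rewrite unsuspK. Qed.

Lemma susp_map0 X Y : fmap susp (0 : mor X Y) = 0.
Proof. by apply: (addrI (fmap susp (0 : mor X Y))); rewrite -suspD !addr0. Qed.

Lemma suspN X Y (f : mor X Y) : fmap susp (- f) = - fmap susp f.
Proof.
by apply: (addrI (fmap susp f)); rewrite -suspD !subrr susp_map0.
Qed.

Lemma susp_eq0 X Y (f : mor X Y) : fmap susp f = 0 -> f = 0.
Proof. by move=> f0; apply: susp_inj; rewrite f0 susp_map0. Qed.

Lemma susp_epi X Y (f : mor X Y) : epi (fmap susp f) <-> epi f.
Proof.
split=> ef W g h gh.
  by apply: susp_inj; apply: ef; rewrite -!fmapM gh.
have [W' eW] := susp_ob_surj W; subst W.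
have [g' eg] := susp_surj g; have [h' eh] := susp_surj h; subst g h.
by congr fmap; apply: ef; apply: susp_inj; rewrite !fmapM.
Qed.

Lemma susp_mono X Y (f : mor X Y) : mono (fmap susp f) <-> mono f.
Proof.
split=> ef W g h gh.
  by apply: susp_inj; apply: ef; rewrite -!fmapM gh.
have [W' eW] := susp_ob_surj W; subst W.
have [g' eg] := susp_surj g; have [h' eh] := susp_surj h; subst g h.
by congr fmap; apply: ef; apply: susp_inj; rewrite !fmapM.
Qed.

Lemma susp_exact X Y Z (f : mor X Y) (g : mor Y Z) :
  exact_at (fmap susp f) (fmap susp g) <-> exact_at f g.
Proof.
split=> -[K [k [q [kk eq fkq]]]].
  have [K' eK] := susp_ob_surj K; subst K.
  have [k' ek] := susp_surj k; have [q' eq'] := susp_surj q; subst k q.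
  exists K', k', q'; split.
  - apply: is_kernelP.
    + by apply: susp_eq0; rewrite fmapM; exact: kk.1.
    + by apply/susp_mono; exact: kernel_mono kk.
    move=> W x gx; have [|y ky] := kernel_factor (x := fmap susp x) kk.
      by rewrite -fmapM gx susp_map0.
    have [y' ey] := susp_surj y; subst y; exists y'.
    by apply: susp_inj; rewrite fmapM.
  - by apply/susp_epi.
  by apply: susp_inj; rewrite fmapM.
exists (susp K), (fmap susp k), (fmap susp q); split.
- apply: is_kernelP.
  + by rewrite -fmapM kk.1 susp_map0.
  + by apply/susp_mono; exact: kernel_mono kk.
  move=> W x gx; have [W' eW] := susp_ob_surj W; subst W.
  have [x' ex] := susp_surj x; subst x.
  have [|y ky] := kernel_factor (x := x') kk.
    by apply: susp_eq0; rewrite fmapM.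
  by exists (fmap susp y); rewrite -fmapM ky.
- by apply/susp_epi.
by rewrite fkq fmapM.
Qed.

Lemma transposeD X Y (w w' : mor (susp X) Y) :
  transpose (w + w') = transpose w + transpose w'.
Proof. by apply: susp_inj; rewrite suspD /transpose !unsuspK mcompDr. Qed.

Lemma transpose_susp X X' Y (w : mor (susp X) Y) (f : mor X' X) :
  transpose (w ∘ fmap susp f) = transpose w ∘ f.
Proof. by apply: susp_inj; rewrite fmapM /transpose !unsuspK mcompA. Qed.

Lemma desusp_map_transpose X Y Y' (g : mor Y Y') (w : mor (susp X) Y) :
  desusp_map g ∘ transpose w = transpose (g ∘ w).
Proof.
apply: susp_inj; rewrite fmapM /desusp_map /transpose !unsuspK -!mcompA.
by congr (_ ∘ (_ ∘ _)); rewrite mcompA eq_homVK mcomp1m.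
Qed.

Lemma transpose_surj X Y (t : mor X (desusp Y)) :
  exists w : mor (susp X) Y, transpose w = t.
Proof.
exists (eq_hom (desuspK Y) ∘ fmap susp t); apply: susp_inj.
by rewrite /transpose unsuspK mcompA eq_homK mcomp1m.
Qed.

Lemma transpose_inj X Y (w w' : mor (susp X) Y) :
  transpose w = transpose w' -> w = w'.
Proof.
move=> /(congr1 (fmap susp)); rewrite /transpose !unsuspK.
by apply: is_iso_mono; exact: eq_hom_iso.
Qed.

Lemma desusp_epi X Y (f : mor X Y) : epi f -> epi (desusp_map f).
Proof.
move=> ef; apply/susp_epi; rewrite /desusp_map /transpose unsuspK mcompA.
apply: epi_comp; last exact: is_iso_epi (eq_hom_iso _).
by apply: epi_comp => //; apply: is_iso_epi; exact: eq_hom_iso.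
Qed.

End Suspension.

Section StableFunctor.
Variables (C D : stable_category) (F : stable_functor C D).
Implicit Types X Y : C.

Lemma fmap0 X Y : fmap F (0 : mor X Y) = 0.
Proof. by apply: (addrI (fmap F (0 : mor X Y))); rewrite -fmapD !addr0. Qed.

Lemma fmapN X Y (f : mor X Y) : fmap F (- f) = - fmap F f.
Proof. by apply: (addrI (fmap F f)); rewrite -fmapD !subrr fmap0. Qed.

Lemma fmapB X Y (f g : mor X Y) : fmap F (f - g) = fmap F f - fmap F g.
Proof. by rewrite fmapD fmapN. Qed.

Lemma fmap_susp_eq0 X Y (f : mor X Y) :
  fmap F (fmap susp f) = 0 <-> fmap F f = 0.
Proof.
have nat := fsusp_nat F f; split=> f0.
  apply: susp_eq0; apply: (mono_eq0 (is_iso_mono (fsusp_iso F Y))).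
  by rewrite nat f0 mcomp0m.
apply: (epi_eq0 (is_iso_epi (fsusp_iso F X))).
by rewrite -nat f0 susp_map0 mcompm0.
Qed.

Lemma fmap_susp_mono X Y (f : mor X Y) :
  mono (fmap F (fmap susp f)) <-> mono (fmap F f).
Proof.
have nat := fsusp_nat F f; split=> mf.
  apply/susp_mono => W x y xy; apply: (is_iso_mono (fsusp_iso F X)).
  by apply: mf; rewrite !mcompA -nat -!mcompA xy.
have [g [ig gF Fg]] := is_iso_inv (fsusp_iso F X).
have -> : fmap F (fmap susp f) = fsusp F Y ∘ fmap susp (fmap F f) ∘ g.
  by rewrite nat -mcompA Fg mcompm1.
apply: mono_comp (is_iso_mono ig); apply: mono_comp; last exact/susp_mono.
exact: is_iso_mono (fsusp_iso F Y).
Qed.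

Lemma fmap_susp_epi X Y (f : mor X Y) :
  epi (fmap F (fmap susp f)) <-> epi (fmap F f).
Proof.
have nat := fsusp_nat F f; split=> mf.
  apply/susp_epi => W x y xy.
  have [g [ig gF Fg]] := is_iso_inv (fsusp_iso F Y).
  apply: (is_iso_epi ig); apply: mf; apply: (is_iso_epi (fsusp_iso F X)).
  by rewrite -!mcompA -nat !mcompA -![_ ∘ g ∘ _]mcompA gF !mcompm1.
have [g [ig gF Fg]] := is_iso_inv (fsusp_iso F X).
have -> : fmap F (fmap susp f) = fsusp F Y ∘ fmap susp (fmap F f) ∘ g.
  by rewrite nat -mcompA Fg mcompm1.
apply: epi_comp (is_iso_epi ig); apply: epi_comp; last exact/susp_epi.
exact: is_iso_epi (fsusp_iso F Y).
Qed.

End StableFunctor.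

(** * Exact triangles *)

Section Triangles.
Variable T : triangulated_category.
Implicit Types X Y Z W : T.

Lemma zero_object_susp Z : zero_object Z -> zero_object (susp Z).
Proof.
move=> [Zl Zr]; split=> X f; have [X' eX] := susp_ob_surj X; subst X;
  have [f' ef] := susp_surj f; subst f.
  by rewrite (Zl _ f') susp_map0.
by rewrite (Zr _ f') susp_map0.
Qed.

Lemma triangle_mcomp0 X Y Z (f : mor X Y) (g : mor Y Z) (h : mor Z (susp X)) :
  triangle f g h -> g ∘ f = 0.
Proof.
move=> t; have [O zO] := ex_zero_object T.
have [c [cg _]] := triangle_mor (triangle_id X zO) t
  (a := idm X) (b := f) erefl.
by move: cg; rewrite (zO.2 _ c) mcomp0m => ->.
Qed.

Lemma triangle_mcomp0' X Y Z (f : mor X Y) (g : mor Y Z) (h : mor Z (susp X)) :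
  triangle f g h -> h ∘ g = 0.
Proof. by move/triangle_rot/triangle_mcomp0. Qed.

(** Compare the triangle with the one on the identity of W, rotated so that W
    comes second. *)
Lemma triangle_factorl X Y Z W (f : mor X Y) (g : mor Y Z)
    (h : mor Z (susp X)) (x : mor Y W) :
  triangle f g h -> x ∘ f = 0 -> exists y : mor Z W, y ∘ g = x.
Proof.
move=> t xf; have [O zO] := ex_zero_object T.
have tW : triangle (0 : mor O W) (idm W) 0.
  apply/triangle_rot; rewrite susp_map0 oppr0.
  by apply: triangle_id; exact: zero_object_susp.
have [|c [cg _]] := triangle_mor t tW (a := 0) (b := x).
  by rewrite xf mcompm0.
by exists c; rewrite cg mcomp1m.
Qed.

(** Compare the triangle on the identity of W with the rotation of the given
    one; the third component is the suspension of the factor. *)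
Lemma triangle_factorr X Y Z W (f : mor X Y) (g : mor Y Z)
    (h : mor Z (susp X)) (x : mor W Y) :
  triangle f g h -> g ∘ x = 0 -> exists y : mor W X, f ∘ y = x.
Proof.
move=> t gx; have [O zO] := ex_zero_object T.
move: (t) => /triangle_rot t'.
have /triangle_rot tW := triangle_id W zO.
have [|c [_ ch]] := triangle_mor tW t' (a := x) (b := 0).
  by rewrite gx mcomp0m.
have [y ey] := susp_surj c; subst c; exists y; apply: susp_inj.
by apply: oppr_inj; rewrite fmapM -mcompNl -ch fmap1 mcompNr mcompm1.
Qed.

Lemma triangle_fiber X Y (f : mor X Y) :
  exists (W : T) (k : mor W X) (h : mor Y (susp W)), triangle k f h.
Proof.
have [Z [g [h t]]] := triangle_ex f; have [W eW] := susp_ob_surj Z; subst Z.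
have [k ek] := susp_surj h; subst h; exists W, (- k), g.
by apply/triangle_rot; rewrite suspN opprK.
Qed.

Lemma triangle_iso_of_cone0 X Y Z (f : mor X Y) (g : mor Y Z)
    (h : mor Z (susp X)) : triangle f g h -> idm Z = 0 -> is_iso f.
Proof.
move=> t Z0.
have g0 : g = 0 by rewrite -(mcomp1m g) Z0 mcomp0m.
have h0 : h = 0 by rewrite -(mcompm1 h) Z0 mcompm0.
have [|n fn] := triangle_factorr (x := idm Y) t; first by rewrite g0 mcomp0m.
exists n; split=> //; apply/eqP; rewrite -subr_eq0; apply/eqP.
have [|y hy] := triangle_factorr (x := fmap susp (n ∘ f - idm X))
  ((triangle_rot _ _ _).1 ((triangle_rot _ _ _).1 t)).
  rewrite mcompNl -fmapM mcompBr mcompA fn mcomp1m mcompm1 subrr.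
  by rewrite susp_map0 oppr0.
by apply: susp_eq0; rewrite -hy h0 mcomp0m.
Qed.

End Triangles.

(** * Splitting idempotents *)

Section Telescope.
Variables (T : triangulated_category) (X S : T) (e : mor X X).
Variables (i : nat -> mor X S) (s : mor S S).
Hypotheses (ee : e ∘ e = e) (copS : is_coproduct (X := fun=> X) i).
Hypothesis si : forall n, s ∘ i n = i n - i n.+1 ∘ e.

Lemma coproduct_ext B (g h : mor S B) : (forall n, g ∘ i n = h ∘ i n) -> g = h.
Proof.
move=> gh; have [k [_ ku]] := copS (fun n => h ∘ i n).
by rewrite -(ku g) // -(ku h).
Qed.

(** The derived limit of ... -> T(X,B) -> T(X,B) along an idempotent vanishes:
    on the complement of e the equation f_n = g_n - g_(n+1) e reads f_n = g_n,
    and on the image of e it is solved by partial sums. *)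
Lemma telescope_solve B (x : mor S B) : exists y : mor S B, y ∘ s = x.
Proof.
pose f n := x ∘ i n; pose sums n := \sum_(k < n) f k ∘ e.
pose g n := f n - f n ∘ e - sums n.
have sumse n : sums n ∘ e = sums n.
  rewrite /sums; elim: n => [|n IH]; first by rewrite big_ord0 mcomp0m.
  by rewrite big_ord_recr /= mcompDl IH -mcompA ee.
have ge n : g n ∘ e = - sums n.
  by rewrite /g !mcompBl -(mcompA (f n)) ee subrr sub0r sumse.
have [y [yi _]] := copS g.
exists y; apply: coproduct_ext => n.
rewrite -mcompA si mcompBr mcompA !yi ge /g /sums big_ord_recr /= opprK.
by rewrite -/(sums n) -(addrA (f n)) -opprD [sums n + _]addrC subrK.
Qed.

End Telescope.

(** The telescope of X -e-> X -e-> ... represents the functor that sends B to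
    the e-invariant morphisms X -> B, and such a representing object is an
    image of e. *)
Lemma idempotent_split (T : triangulated_category) (X : T) (e : mor X X) :
  has_countable_coproducts T -> e ∘ e = e ->
  exists (Y : T) (r : mor X Y) (k : mor Y X), r ∘ k = idm Y /\ k ∘ r = e.
Proof.
move=> copT ee; have [S [i copS]] := copT (fun=> X).
have [s [si _]] := copS S (fun n => i n - i n.+1 ∘ e).
have solve := telescope_solve ee copS si.
have [Y [j [h t]]] := triangle_ex s.
have js : j ∘ s = 0 := triangle_mcomp0 t.
have step n : j ∘ i n = j ∘ i n.+1 ∘ e.
  apply/eqP; rewrite -subr_eq0 -!mcompA -mcompBr -si mcompA js.
  by rewrite mcomp0m.
have jie n : j ∘ i n ∘ e = j ∘ i n by rewrite step -mcompA ee.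
have ji n : j ∘ i n = j ∘ i 0%N.
  by elim: n => [|n IH] //; rewrite -IH [RHS]step jie.
(* Here k j = 0, so k factors through S[1]; every morphism out of S[1] factors
   through s[1], which composes to zero with Y -> S[1]. *)
have uniq B (k : mor Y B) : k ∘ (j ∘ i 0%N) = 0 -> k = 0.
  move=> k0; have kj : k ∘ j = 0.
    by apply: (coproduct_ext copS) => n; rewrite -mcompA ji k0 mcomp0m.
  have [l lh] := triangle_factorl ((triangle_rot _ _ _).1 t) kj.
  have hs : fmap susp s ∘ h = 0.
    by apply: oppr_inj; rewrite -mcompNl oppr0;
       exact: triangle_mcomp0 ((triangle_rot _ _ _).1 ((triangle_rot _ _ _).1 t)).
  have [B' eB] := susp_ob_surj B; subst B.
  have [l' el] := susp_surj l; subst l.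
  have [m ms] := solve _ l'.
  by rewrite -lh -ms fmapM -mcompA hs mcompm0.
(* The invariant morphism e itself gives the section k of X -> Y. *)
have [g [gi _]] := copS X (fun=> e).
have gs : g ∘ s = 0.
  by apply: (coproduct_ext copS) => n;
     rewrite -mcompA si mcompBr mcompA !gi ee subrr mcomp0m.
have [k kj] := triangle_factorl t gs.
exists Y, (j ∘ i 0%N), k; split; last by rewrite mcompA kj gi.
apply/eqP; rewrite -subr_eq0; apply/eqP/uniq.
by rewrite mcompBl mcomp1m -mcompA [k ∘ _]mcompA kj gi jie subrr.
Qed.

(** * Homological functors on triangles *)

Section HomologicalFunctor.
Variables (T : triangulated_category) (A : stable_abelian_category).
Variable F : stable_functor T A.
Hypotheses (homF : homological F) (enoughA : enough_projective_objects A).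
Variables (X Y Z : T) (f : mor X Y) (g : mor Y Z) (h : mor Z (susp X)).
Hypothesis t : triangle f g h.

Lemma homological_epi_mono : epi (fmap F g) -> mono (fmap F f).
Proof.
move=> eg; have h0 : fmap F h = 0.
  by apply: (epi_eq0 eg); rewrite -fmapM (triangle_mcomp0' t) fmap0.
apply/fmap_susp_mono; apply: (mono_on_projectives enoughA) => P x pP.
move=> fx; have ex := homF ((triangle_rot _ _ _).1 ((triangle_rot _ _ _).1 t)).
have [|y <-] := exact_lift (x := x) pP ex.
  by rewrite fmapN mcompNl fx oppr0.
by rewrite h0 mcomp0m.
Qed.

Lemma homological_mono_epi : mono (fmap F f) -> epi (fmap F g).
Proof.
move=> /fmap_susp_mono mf; have h0 : fmap F h = 0.
  apply: (mono_eq0 mf); rewrite -fmapM; apply: oppr_inj.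
  rewrite oppr0 -fmapN -mcompNl.
  by rewrite (triangle_mcomp0 ((triangle_rot _ _ _).1
       ((triangle_rot _ _ _).1 t))) fmap0.
apply: (epi_on_projectives enoughA) => P y pP.
apply: (exact_lift pP (homF ((triangle_rot _ _ _).1 t))).
by rewrite h0 mcomp0m.
Qed.

Lemma homological_iso_cone : is_iso (fmap F f) -> fmap F (idm Z) = 0.
Proof.
move=> If; have g0 : fmap F g = 0.
  apply: (epi_eq0 (is_iso_epi If)).
  by rewrite -fmapM (triangle_mcomp0 t) fmap0.
have := homological_mono_epi (is_iso_mono If).
by rewrite g0 fmap1 => e0; apply: (epi_eq0 e0); rewrite mcompm0.
Qed.

End HomologicalFunctor.

(** * Presented objects *)

(** F(Q) -> F(P) -> X -> 0 is a presentation by values of F on I-projective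
    objects. The relations Q enter by existence alone, as a morphism of
    presented objects is given on generators. *)
Definition presentation (T : triangulated_category) (I : morphism_class T)
    (A : stable_category) (F : stable_functor T A) (X : A) (P : T)
    (pi : mor (F P) X) : Prop :=
  [/\ ideal_projective I P, epi pi &
      exists (Q : T) (d : mor Q P),
        ideal_projective I Q /\ exact_at (fmap F d) pi].

Record presented (T : triangulated_category) (I : morphism_class T)
    (A : stable_category) (F : stable_functor T A) := Presented {
  pr_ob : A;
  pr_gen : T;
  pr_map : mor (F pr_gen) pr_ob;
  prP : presentation I pr_map }.

(** The morphisms of A that come from T on generators. Taking a subgroup of the
    morphisms of A, rather than homotopy classes of maps of presentations,
    makes the forgetful functor to A faithful by construction. *)
Definition liftable (T : triangulated_category) (I : morphism_class T)
    (A : stable_category) (F : stable_functor T A) (X Y : presented I F) :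
    {pred mor (pr_ob X) (pr_ob Y)} :=
  fun f => `[< exists a : mor (pr_gen X) (pr_gen Y),
                 f ∘ pr_map X = pr_map Y ∘ fmap F a >].

Arguments liftable {T I A F} X Y _.

Lemma liftable_zmod_closed (T : triangulated_category) (I : morphism_class T)
    (A : stable_category) (F : stable_functor T A) (X Y : presented I F) :
  zmod_closed (liftable X Y).
Proof.
split; first by apply/asboolP; exists 0; rewrite fmap0 mcomp0m mcompm0.
move=> f g /asboolP[a fa] /asboolP[b gb]; apply/asboolP; exists (a - b).
by rewrite fmapB mcompBl mcompBr fa gb.
Qed.

HB.instance Definition _ (T : triangulated_category) (I : morphism_class T)
    (A : stable_category) (F : stable_functor T A) (X Y : presented I F) :=
  GRing.isZmodClosed.Build (mor (pr_ob X) (pr_ob Y)) (liftable X Y)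
    (liftable_zmod_closed X Y).

Definition pres_mor (T : triangulated_category) (I : morphism_class T)
    (A : stable_category) (F : stable_functor T A) (X Y : presented I F) : Type :=
  {f : mor (pr_ob X) (pr_ob Y) | liftable X Y f}.

HB.instance Definition _ (T : triangulated_category) (I : morphism_class T)
    (A : stable_category) (F : stable_functor T A) (X Y : presented I F) :=
  [isSub of pres_mor X Y for @sval _ _].
HB.instance Definition _ (T : triangulated_category) (I : morphism_class T)
    (A : stable_category) (F : stable_functor T A) (X Y : presented I F) :=
  [Choice of pres_mor X Y by <:].
HB.instance Definition _ (T : triangulated_category) (I : morphism_class T)
    (A : stable_category) (F : stable_functor T A) (X Y : presented I F) :=
  [SubChoice_isSubZmodule of pres_mor X Y by <:].

Section PresentedCategory.
Variables (T : triangulated_category) (I : morphism_class T).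
Variables (A : stable_abelian_category) (F : stable_functor T A).
Implicit Types X Y Z : presented I F.

Lemma liftableP X Y (f : mor (pr_ob X) (pr_ob Y)) :
  reflect (exists a : mor (pr_gen X) (pr_gen Y),
             f ∘ pr_map X = pr_map Y ∘ fmap F a) (liftable X Y f).
Proof. exact: asboolP. Qed.

Lemma liftable1 X : liftable X X (idm (pr_ob X)).
Proof. by apply/liftableP; exists (idm _); rewrite fmap1 mcomp1m mcompm1. Qed.

Lemma liftableM X Y Z (g : mor (pr_ob Y) (pr_ob Z))
    (f : mor (pr_ob X) (pr_ob Y)) :
  liftable Y Z g -> liftable X Y f -> liftable X Z (g ∘ f).
Proof.
move=> /liftableP[b gb] /liftableP[a fa]; apply/liftableP; exists (b ∘ a).
by rewrite fmapM -mcompA fa mcompA gb mcompA.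
Qed.

Definition PresMor X Y (f : mor (pr_ob X) (pr_ob Y)) (hf : liftable X Y f) :
  pres_mor X Y := exist (fun g => is_true (liftable X Y g)) f hf.

Definition pres_id X : pres_mor X X := PresMor (liftable1 X).

Definition pres_comp X Y Z (g : pres_mor Y Z) (f : pres_mor X Y) :
  pres_mor X Z := PresMor (liftableM (svalP g) (svalP f)).

Lemma pres_comp1m X Y (f : pres_mor X Y) : pres_comp (pres_id Y) f = f.
Proof. by apply: val_inj; rewrite /= mcomp1m. Qed.

Lemma pres_compm1 X Y (f : pres_mor X Y) : pres_comp f (pres_id X) = f.
Proof. by apply: val_inj; rewrite /= mcompm1. Qed.

Lemma pres_compA X Y Z W (h : pres_mor Z W) (g : pres_mor Y Z)
    (f : pres_mor X Y) :
  pres_comp h (pres_comp g f) = pres_comp (pres_comp h g) f.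
Proof. by apply: val_inj; rewrite /= mcompA. Qed.

Definition pres_category : category :=
  Category pres_comp1m pres_compm1 pres_compA.

Definition pres_enriched : enriched_category :=
  @EnrichedCategory pres_category
    (fun X Y => GRing.Zmodule.class (pres_mor X Y : zmodType)).

End PresentedCategory.

(** * Presented objects form an additive category *)

Section PresentedAdditive.
Variables (T : triangulated_category) (I : morphism_class T).
Variables (A : stable_abelian_category) (F : stable_functor T A).
Hypothesis homF : homological F.
Hypothesis kerF : forall (X Y : T) (f : mor X Y), @I X Y f <-> fmap F f = 0.
Hypothesis enoughT : enough_projectives I.
Hypothesis enoughA : enough_projective_objects A.

Let abA : abelian A := stable_abelianP A.

Lemma iproj_eq0 P B (f : mor P B) :
  ideal_projective I P -> fmap F f = 0 -> f = 0.
Proof. by move=> pP /kerF; exact: pP. Qed.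

Lemma iproj_inj P B (f g : mor P B) :
  ideal_projective I P -> fmap F f = fmap F g -> f = g.
Proof.
move=> pP fg; apply/eqP; rewrite -subr_eq0; apply/eqP/(iproj_eq0 pP).
by rewrite fmapB fg subrr.
Qed.

Lemma iproj_retract P Y (r : mor P Y) (k : mor Y P) :
  r ∘ k = idm Y -> ideal_projective I P -> ideal_projective I Y.
Proof.
move=> rk pP B f /kerF f0; rewrite -(mcompm1 f) -rk mcompA.
by rewrite (iproj_eq0 (f := f ∘ r) pP) ?mcomp0m // fmapM f0 mcomp0m.
Qed.

Lemma iproj_susp P : ideal_projective I P -> ideal_projective I (susp P).
Proof.
move=> pP B f /kerF; have [B' eB] := susp_ob_surj B; subst B.
have [f' ef] := susp_surj f; subst f.
by move/fmap_susp_eq0/(iproj_eq0 pP)->; rewrite susp_map0.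
Qed.

Lemma iproj_unsusp P : ideal_projective I (susp P) -> ideal_projective I P.
Proof.
move=> pP B f /kerF /fmap_susp_eq0 f0; apply: susp_eq0.
exact: iproj_eq0 pP f0.
Qed.

Lemma iproj_biproduct P Q (S : biproduct P Q) :
  ideal_projective I P -> ideal_projective I Q -> ideal_projective I S.
Proof.
move=> pP pQ B f /kerF f0; rewrite -(mcompm1 f) -(bp_sum S) mcompDr !mcompA.
rewrite (iproj_eq0 (f := f ∘ bp_inl S) pP) ?fmapM ?f0 ?mcomp0m //.
rewrite (iproj_eq0 (f := f ∘ bp_inr S) pQ) ?fmapM ?f0 ?mcomp0m //.
by rewrite addr0.
Qed.

Lemma iproj_zero O : zero_object O -> ideal_projective I O.
Proof. by move=> zO B f _; exact: zO.2. Qed.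

Lemma fmap_bp_sum X Y (S : biproduct X Y) :
  fmap F (bp_inl S) ∘ fmap F (bp_prl S) + fmap F (bp_inr S) ∘ fmap F (bp_prr S)
  = idm (F S).
Proof. by rewrite -!fmapM -fmapD bp_sum fmap1. Qed.

Lemma ideal_epic_epi P X (f : mor P X) : ideal_epic I f -> epi (fmap F f).
Proof.
move=> [Z [g [h [t /kerF g0]]]].
by apply: (@exact_0_epi _ enoughA _ _ (F Z)); rewrite -g0; exact: homF t.
Qed.

Lemma iproj_cover X : exists (P : T) (f : mor P X),
  ideal_projective I P /\ epi (fmap F f).
Proof.
by have [P [f [pP /ideal_epic_epi ef]]] := enoughT X; exists P, f.
Qed.

(** The obstruction to factoring m through c is its composite to the cone of c.
    The hypothesis says that F kills this composite, and on an I-projective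
    object that makes it zero. *)
Lemma iproj_factor P Q Y (c : mor Q Y) (m : mor P Y) :
  ideal_projective I P ->
  (forall W (x : mor W (F P)), projective W ->
     exists y : mor W (F Q), fmap F c ∘ y = fmap F m ∘ x) ->
  exists n : mor P Q, c ∘ n = m.
Proof.
move=> pP cm; have [Z [v [w t]]] := triangle_ex c.
apply: (triangle_factorr t); apply: (iproj_eq0 pP).
apply: (eq0_on_projectives enoughA) => W x pW.
have [y cy] := cm W x pW.
by rewrite fmapM -mcompA -cy mcompA -fmapM (triangle_mcomp0 t) fmap0 mcomp0m.
Qed.

Lemma iproj_lift_epi P Q X (f : mor Q X) (x : mor P X) :
  ideal_projective I P -> epi (fmap F f) -> exists y : mor P Q, f ∘ y = x.
Proof.
move=> pP ef; apply: (iproj_factor pP) => W z pW; exact: pW.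
Qed.

(** Kernels of maps between presented objects are covered from T: take an
    I-projective cover of the weak pullback of a along the relations d'. *)
Lemma presentation_kernel X' P P' (pi' : mor (F P') X') (a : mor P P') :
  presentation I pi' ->
  exists (Q : T) (c : mor Q P),
    ideal_projective I Q /\ exact_at (fmap F c) (pi' ∘ fmap F a).
Proof.
move=> [pP' epi' [Q' [d' [pQ' exd']]]].
have [S] := ex_biproduct P Q'.
pose m := a ∘ bp_prl S - d' ∘ bp_prr S.
have [N [n [h t]]] := triangle_fiber m.
have [Q [e [pQ ee]]] := iproj_cover N.
exists Q, (bp_prl S ∘ n ∘ e); split=> //.
have mn := triangle_mcomp0 t.
have an : a ∘ (bp_prl S ∘ n) = d' ∘ (bp_prr S ∘ n).
  by apply/eqP; rewrite -subr_eq0 !mcompA -mcompBl -/m mn.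
apply: (exact_on_projectives enoughA abA).
  rewrite -mcompA -fmapM mcompA an -mcompA fmapM mcompA.
  by rewrite (exact_mcomp0 exd') mcomp0m.
move=> W y pW; rewrite -mcompA => /(exact_lift pW exd')[z dz].
have [|w nw] := exact_lift (x := fmap F (bp_inl S) ∘ y + fmap F (bp_inr S) ∘ z)
  pW (homF t).
  rewrite mcompDr !mcompA -!fmapM /m !mcompBl -!mcompA.
  rewrite bp_ll bp_rl bp_lr bp_rr !mcompm1 !mcompm0 subr0 sub0r.
  by rewrite fmapN mcompNl dz subrr.
have [w' ew] := pW _ _ _ w ee; exists w'.
rewrite !fmapM -!mcompA ew nw mcompDr !mcompA -!fmapM bp_ll bp_lr.
by rewrite fmap1 fmap0 mcomp1m mcomp0m addr0.
Qed.

Lemma pres_compDl X Y Z (g g' : mor (Y : pres_enriched I F) Z) (f : mor X Y) :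
  (g + g') ∘ f = g ∘ f + g' ∘ f.
Proof. by apply: val_inj; exact: mcompDl. Qed.

Lemma pres_compDr X Y Z (g : mor (Y : pres_enriched I F) Z) (f f' : mor X Y) :
  g ∘ (f + f') = g ∘ f + g ∘ f'.
Proof. by apply: val_inj; exact: mcompDr. Qed.

Lemma pres_zero : exists Z : pres_enriched I F, zero_object Z.
Proof.
have [O zO] := ex_zero_object T; have [Z zZ] := ex_zero_object A.
have pO : presentation I (0 : mor (F O) Z).
  split; first exact: iproj_zero.
    by move=> W g h _; rewrite (zZ.2 _ g) (zZ.2 _ h).
  exists O, 0; split; first exact: iproj_zero.
  apply: (exact_on_projectives enoughA abA); first by rewrite mcomp0m.
  move=> P y _ _; exists 0; rewrite mcompm0 -(mcomp1m y) -fmap1.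
  by rewrite (zO.2 _ (idm O)) fmap0 mcomp0m.
exists (Presented pO); split=> X f; apply: val_inj.
  exact: zZ.1.
exact: zZ.2.
Qed.

Lemma presentation_biproduct X Y P Q (pi : mor (F P) X) (rho : mor (F Q) Y)
    (S : biproduct X Y) (S' : biproduct P Q) :
  presentation I pi -> presentation I rho ->
  presentation I (bp_inl S ∘ pi ∘ fmap F (bp_prl S') +
                  bp_inr S ∘ rho ∘ fmap F (bp_prr S')).
Proof.
move=> [pP epi [P1 [d [pP1 exd]]]] [pQ erho [Q1 [d' [pQ1 exd']]]].
set sigma := _ + _.
have sl : sigma ∘ fmap F (bp_inl S') = bp_inl S ∘ pi.
  rewrite mcompDl -!mcompA -!fmapM bp_ll bp_rl fmap1 fmap0.
  by rewrite !mcompm0 mcompm1 addr0.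
have sr : sigma ∘ fmap F (bp_inr S') = bp_inr S ∘ rho.
  rewrite mcompDl -!mcompA -!fmapM bp_lr bp_rr fmap1 fmap0.
  by rewrite !mcompm0 mcompm1 add0r.
have ls : bp_prl S ∘ sigma = pi ∘ fmap F (bp_prl S').
  by rewrite mcompDr !mcompA bp_ll bp_lr mcomp1m !mcomp0m addr0.
have rs : bp_prr S ∘ sigma = rho ∘ fmap F (bp_prr S').
  by rewrite mcompDr !mcompA bp_rl bp_rr mcomp1m !mcomp0m add0r.
split; first exact: iproj_biproduct.
- apply: (epi_on_projectives enoughA) => W y pW.
  have [x ex] := pW _ _ _ (bp_prl S ∘ y) epi.
  have [z ez] := pW _ _ _ (bp_prr S ∘ y) erho.
  exists (fmap F (bp_inl S') ∘ x + fmap F (bp_inr S') ∘ z).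
  rewrite mcompDr !mcompA sl sr -!mcompA ex ez !mcompA -mcompDl bp_sum.
  exact: mcomp1m.
have [S1] := ex_biproduct P1 Q1.
pose m := bp_inl S' ∘ d ∘ bp_prl S1 + bp_inr S' ∘ d' ∘ bp_prr S1.
exists S1, m; split; first exact: iproj_biproduct.
apply: (exact_on_projectives enoughA abA).
  rewrite /m fmapD mcompDr !fmapM !mcompA sl sr -![_ ∘ _ ∘ fmap F d]mcompA.
  rewrite -![_ ∘ _ ∘ fmap F d']mcompA (exact_mcomp0 exd) (exact_mcomp0 exd').
  by rewrite !mcompm0 !mcomp0m addr0.
move=> W y pW sy.
have [|x ex] := exact_lift (x := fmap F (bp_prl S') ∘ y) pW exd.
  by rewrite mcompA -ls -mcompA sy mcompm0.
have [|z ez] := exact_lift (x := fmap F (bp_prr S') ∘ y) pW exd'.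
  by rewrite mcompA -rs -mcompA sy mcompm0.
exists (fmap F (bp_inl S1) ∘ x + fmap F (bp_inr S1) ∘ z).
rewrite mcompDr !mcompA -!fmapM /m !mcompDl -!mcompA bp_ll bp_rl bp_lr bp_rr.
rewrite !mcompm1 !mcompm0 addr0 add0r !fmapM -!mcompA ex ez !mcompA -mcompDl.
by rewrite fmap_bp_sum mcomp1m.
Qed.

Lemma pres_biproduct (X Y : pres_enriched I F) : inhabited (biproduct X Y).
Proof.
have [S] := ex_biproduct (pr_ob X) (pr_ob Y).
have [S'] := ex_biproduct (pr_gen X) (pr_gen Y).
pose Z : pres_enriched I F :=
  Presented (presentation_biproduct S S' (prP X) (prP Y)).
have hl : liftable X Z (bp_inl S).
  apply/liftableP; exists (bp_inl S'); rewrite /= mcompDl -!mcompA -!fmapM.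
  by rewrite bp_ll bp_rl fmap1 fmap0 !mcompm0 mcompm1 addr0.
have hr : liftable Y Z (bp_inr S).
  apply/liftableP; exists (bp_inr S'); rewrite /= mcompDl -!mcompA -!fmapM.
  by rewrite bp_lr bp_rr fmap1 fmap0 !mcompm0 mcompm1 add0r.
have pl : liftable Z X (bp_prl S).
  apply/liftableP; exists (bp_prl S'); rewrite /= mcompDr !mcompA.
  by rewrite bp_ll bp_lr mcomp1m !mcomp0m addr0.
have pr : liftable Z Y (bp_prr S).
  apply/liftableP; exists (bp_prr S'); rewrite /= mcompDr !mcompA.
  by rewrite bp_rl bp_rr mcomp1m !mcomp0m add0r.
constructor; apply: (@Biproduct _ X Y Z (PresMor hl) (PresMor hr) (PresMor pl)
  (PresMor pr)); apply: val_inj.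
- exact: bp_ll.
- exact: bp_rr.
- exact: bp_lr.
- exact: bp_rl.
exact: bp_sum.
Qed.

Definition pres_additive : additive_category :=
  AdditiveCategory pres_compDl pres_compDr pres_zero pres_biproduct.

End PresentedAdditive.

Arguments iproj_susp {T I A F} kerF [P].
Arguments iproj_unsusp {T I A F} kerF [P].
Arguments iproj_biproduct {T I A F} kerF [P Q S].
Arguments iproj_retract {T I A F} kerF [P Y r k].

(** * Presented objects form an abelian category *)

Section PresentedAbelian.
Variables (T : triangulated_category) (I : morphism_class T).
Variables (A : stable_abelian_category) (F : stable_functor T A).
Hypothesis homF : homological F.
Hypothesis kerF : forall (X Y : T) (f : mor X Y), @I X Y f <-> fmap F f = 0.
Hypothesis enoughT : enough_projectives I.
Hypothesis enoughA : enough_projective_objects A.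

Let abA : abelian A := stable_abelianP A.
Let B : additive_category := pres_additive kerF enoughA.
Implicit Types X Y Z W : B.

Definition pres_val X Y (f : mor X Y) : mor (pr_ob X) (pr_ob Y) := sval f.

Lemma pres_val_inj X Y (f g : mor X Y) : pres_val f = pres_val g -> f = g.
Proof. exact: val_inj. Qed.

Lemma pres_valM X Y Z (g : mor Y Z) (f : mor X Y) :
  pres_val (g ∘ f) = pres_val g ∘ pres_val f.
Proof. by []. Qed.

Lemma pres_lift X Y (f : mor X Y) :
  exists a : mor (pr_gen X) (pr_gen Y),
    pres_val f ∘ pr_map X = pr_map Y ∘ fmap F a.
Proof. exact/liftableP/(svalP f). Qed.

Lemma pres_mk X Y (f : mor (pr_ob X) (pr_ob Y))
    (a : mor (pr_gen X) (pr_gen Y)) :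
  f ∘ pr_map X = pr_map Y ∘ fmap F a -> exists g : mor X Y, pres_val g = f.
Proof.
move=> fa; have hf : liftable X Y f by apply/liftableP; exists a.
by exists (PresMor hf).
Qed.

(** The kernel in A is presented, and a morphism into it lifts to generators
    because its composite to X does and generators are I-projective. *)
Lemma pres_kernel X Y (g : mor X Y) :
  exists (K : B) (k : mor K X),
    is_kernel g k /\ is_kernel (pres_val g) (pres_val k).
Proof.
have [a ga] := pres_lift g.
case: (abA) => kerA _ _ _; have [K [k kk]] := kerA _ _ (pres_val g).
have mk := kernel_mono kk.
have [Q [c [pQ exc]]] := presentation_kernel homF kerF enoughT enoughA a (prP Y).
have [|piK kpi] := kernel_factor (x := pr_map X ∘ fmap F c) kk.
  by rewrite mcompA ga (exact_mcomp0 exc).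
have pK : presentation I piK.
  split=> //.
    apply: (epi_on_projectives enoughA) => W y pW; case: (prP X) => _ eX _.
    have [z ez] := pW _ _ _ (k ∘ y) eX.
    have [|w ew] := exact_lift (x := z) pW exc.
      by rewrite -ga -mcompA ez mcompA kk.1 mcomp0m.
    by exists w; apply: mk; rewrite mcompA kpi -mcompA ew.
  have [Q2 [c2 [pQ2 exc2]]] :=
    presentation_kernel homF kerF enoughT enoughA c (prP X).
  exists Q2, c2; split=> //; apply: (exact_on_projectives enoughA abA).
    by apply: (mono_eq0 mk); rewrite mcompA kpi (exact_mcomp0 exc2).
  move=> W y pW piy; apply: (exact_lift pW exc2).
  by rewrite -kpi -mcompA piy mcompm0.
pose KB : B := Presented pK.
have [kB ek] := pres_mk (X := KB) (Y := X) kpi.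
exists KB, kB; rewrite ek; split=> //; apply: is_kernelP.
- by apply: pres_val_inj; rewrite pres_valM ek kk.1.
- by move=> W x y /(congr1 (@pres_val _ _)); rewrite !pres_valM ek => /mk e;
     apply: pres_val_inj.
move=> W h /(congr1 (@pres_val _ _)); rewrite pres_valM => gh.
have [y ky] := kernel_factor kk gh.
have [b hb] := pres_lift h; case: (prP W) => pW _ _.
have [|n cn] := iproj_factor kerF enoughA (c := c) (m := b) pW.
  move=> V x pV; apply: (exact_lift pV exc).
  by rewrite -ga -mcompA (mcompA (pr_map X)) -hb -!mcompA mcompA gh mcomp0m.
have [|yB ey] := pres_mk (X := W) (Y := KB) (f := y) (a := n).
  by apply: mk; rewrite mcompA ky hb mcompA kpi -mcompA -fmapM cn.
by exists yB; apply: pres_val_inj; rewrite pres_valM ek ey.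
Qed.

(** The generator of Y also generates the cokernel; the generator of X adds
    relations. *)
Lemma pres_cokernel X Y (g : mor X Y) :
  exists (Q : B) (q : mor Y Q),
    is_cokernel g q /\ is_cokernel (pres_val g) (pres_val q).
Proof.
have [a ga] := pres_lift g.
case: (abA) => _ cokA _ _; have [Q [q kq]] := cokA _ _ (pres_val g).
have eq := cokernel_epi kq; case: (prP Y) => pY eY [P1 [d [pP1 exd]]].
case: (prP X) => pX eX _.
have pQ : presentation I (q ∘ pr_map Y).
  split=> //; first exact: epi_comp.
  have [S] := ex_biproduct (pr_gen X) P1.
  exists S, (a ∘ bp_prl S + d ∘ bp_prr S); split.
    exact: (iproj_biproduct kerF).
  apply: (exact_on_projectives enoughA abA).
    rewrite fmapD !fmapM mcompDr -!mcompA.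
    rewrite (mcompA (pr_map Y) (fmap F a)) -ga -mcompA mcompA kq.1 mcomp0m.
    rewrite (mcompA (pr_map Y) (fmap F d)) (exact_mcomp0 exd) mcomp0m.
    by rewrite mcompm0 addr0.
  move=> W y pW qy.
  have [|x ex] := exact_lift (x := pr_map Y ∘ y) pW (cokernel_exact abA kq).
    by rewrite mcompA.
  have [x' ex'] := pW _ _ _ x eX; subst x.
  have [|z ez] := exact_lift (x := y - fmap F a ∘ x') pW exd.
    by rewrite mcompBr mcompA -ga -mcompA ex subrr.
  exists (fmap F (bp_inl S) ∘ x' + fmap F (bp_inr S) ∘ z).
  rewrite mcompDr !mcompA -!fmapM !mcompDl -!mcompA.
  rewrite bp_ll bp_rl bp_lr bp_rr !mcompm1 !mcompm0 addr0 add0r ez.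
  by rewrite addrC subrK.
pose QB : B := Presented pQ.
have [|qB eqB] := pres_mk (X := Y) (Y := QB) (f := q) (a := idm _).
  by rewrite fmap1 mcompm1.
exists QB, qB; rewrite eqB; split=> //; apply: is_cokernelP.
- by apply: pres_val_inj; rewrite pres_valM eqB kq.1.
- by move=> W x y /(congr1 (@pres_val _ _)); rewrite !pres_valM eqB => /eq e;
     apply: pres_val_inj.
move=> W h /(congr1 (@pres_val _ _)); rewrite pres_valM => hg.
have [y [yq _]] := kq.2 _ _ hg; have [b hb] := pres_lift h.
have [|yB ey] := pres_mk (X := QB) (Y := W) (f := y) (a := b).
  by rewrite /= mcompA yq.
by exists yB; apply: pres_val_inj; rewrite pres_valM eqB ey.
Qed.

Lemma pres_val_mono X Y (f : mor X Y) : mono f -> mono (pres_val f).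
Proof.
move=> mf; have [K [k [kk kv]]] := pres_kernel f.
have k0 := mono_eq0 mf kk.1.
apply: mono_of_eq0 => W x fx; have [y <-] := kernel_factor kv fx.
by rewrite k0 mcomp0m.
Qed.

Lemma pres_val_epi X Y (f : mor X Y) : epi f -> epi (pres_val f).
Proof.
move=> ef; have [Q [q [kq qv]]] := pres_cokernel f.
have q0 := epi_eq0 ef kq.1.
apply: epi_of_eq0 => W x xf; have [y [<- _]] := qv.2 _ _ xf.
by rewrite q0 mcompm0.
Qed.

Lemma epi_pres_val X Y (f : mor X Y) : epi (pres_val f) -> epi f.
Proof.
move=> mf W x y /(congr1 (@pres_val _ _)); rewrite !pres_valM.
by move=> /mf e; apply: pres_val_inj.
Qed.

(** A lift a : P -> Q of the epimorphism f, together with the relations d of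
    its target, covers Q; so the identity of Q factors through (a, d), and the
    relations disappear in the target. *)
Lemma pres_epi_section X Y (f : mor X Y) : epi f ->
  exists s : mor (pr_gen Y) (pr_gen X),
    pres_val f ∘ pr_map X ∘ fmap F s = pr_map Y.
Proof.
move=> /pres_val_epi ef; have [a fa] := pres_lift f.
case: (prP X) (prP Y) => [pX eX _] [pY eY [P1 [d [pP1 exd]]]].
have [S] := ex_biproduct (pr_gen X) P1.
pose m := a ∘ bp_prl S + d ∘ bp_prr S.
have [|n mn] := iproj_factor kerF enoughA (c := m) (m := idm (pr_gen Y)) pY.
  move=> W x pW; have [z ez] := pW _ _ _ (pr_map Y ∘ x) (epi_comp ef eX).
  have [|w ew] := exact_lift (x := x - fmap F a ∘ z) pW exd.
    by rewrite mcompBr mcompA -fa ez subrr.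
  exists (fmap F (bp_inl S) ∘ z + fmap F (bp_inr S) ∘ w).
  rewrite mcompDr !mcompA -!fmapM !mcompDl -!mcompA.
  rewrite bp_ll bp_rl bp_lr bp_rr !mcompm1 !mcompm0 addr0 add0r ew.
  by rewrite fmap1 mcomp1m addrC subrK.
exists (bp_prl S ∘ n); rewrite fmapM mcompA fa -mcompA.
rewrite -[RHS]mcompm1 -fmap1 -mn mcompDl fmapD mcompDr !fmapM !mcompA.
by rewrite (exact_mcomp0 exd) !mcomp0m addr0.
Qed.

(** Kernels and cokernels are those of A, so the factorisations required of
    monomorphisms and epimorphisms exist in A. They are liftable: for a
    monomorphism by factoring through its lift and the relations of its target,
    for an epimorphism by a section on generators. *)
Lemma pres_abelian : abelian B.
Proof.
split.
- by move=> X Y f; have [K [k [kk _]]] := pres_kernel f; exists K, k.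
- by move=> X Y f; have [K [k [kk _]]] := pres_cokernel f; exists K, k.
- move=> X Y f mf; have [Q [q [kq qv]]] := pres_cokernel f.
  exists Q, q; apply: is_kernelP => //; first exact: kq.1.
  move=> W h /(congr1 (@pres_val _ _)); rewrite pres_valM => qh.
  have mv := pres_val_mono mf.
  have exf := cokernel_exact abA qv; have [K [k [r [kk er fkr]]]] := exf.
  have ir : is_iso r.
    apply: (mono_epi_iso abA _ er) => V x y xy.
    by apply: mv; rewrite fkr -!mcompA xy.
  have [s [_ sr rs]] := is_iso_inv ir.
  have [z kz] := kernel_factor kk qh.
  have fy : pres_val f ∘ (s ∘ z) = pres_val h.
    by rewrite fkr -mcompA (mcompA r) rs mcomp1m.
  have [b hb] := pres_lift h; have [a fa] := pres_lift f.
  case: (prP W) (prP X) (prP Y) => [pW eW _] [pX eX _] [pY eY [P1 [d [pP1 exd]]]].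
  have [S] := ex_biproduct (pr_gen X) P1.
  pose m := a ∘ bp_prl S + d ∘ bp_prr S.
  have [|n mn] := iproj_factor kerF enoughA (c := m) (m := b) pW.
    move=> V x pV.
    have [y ey] := pV _ _ _ (s ∘ z ∘ pr_map W ∘ x) eX.
    have [|w ew] := exact_lift (x := fmap F b ∘ x - fmap F a ∘ y) pV exd.
      rewrite mcompBr !mcompA -fa -hb -!mcompA ey !mcompA.
      by rewrite -(mcompA (pres_val f)) fy subrr.
    exists (fmap F (bp_inl S) ∘ y + fmap F (bp_inr S) ∘ w).
    rewrite mcompDr !mcompA -!fmapM !mcompDl -!mcompA.
    rewrite bp_ll bp_rl bp_lr bp_rr !mcompm1 !mcompm0 addr0 add0r ew.
    by rewrite addrC subrK.
  have [|yB ey] := pres_mk (X := W) (Y := X) (f := s ∘ z) (a := bp_prl S ∘ n).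
    apply: mv; rewrite mcompA fy hb -mn mcompDl fmapD mcompDr !fmapM !mcompA.
    by rewrite (exact_mcomp0 exd) !mcomp0m addr0 fa.
  by exists yB; apply: pres_val_inj; rewrite pres_valM ey.
move=> X Y f ef; have [K [k [kk kv]]] := pres_kernel f.
exists K, k; apply: is_cokernelP => //; first exact: kk.1.
move=> W h /(congr1 (@pres_val _ _)); rewrite pres_valM => hk.
have exk : exact_at (pres_val k) (pres_val f).
  by exists (pr_ob K), (pres_val k), (idm _); rewrite mcompm1; split=> // V x y;
     rewrite !mcompm1.
have [y yf] := exact_epi_factor enoughA abA (pres_val_epi ef) exk hk.
have [s fs] := pres_epi_section ef; have [b hb] := pres_lift h.
have [|yB ey] := pres_mk (X := Y) (Y := W) (f := y) (a := b ∘ s).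
  by rewrite -fs !mcompA yf hb fmapM mcompA.
by exists yB; apply: pres_val_inj; rewrite pres_valM ey.
Qed.

Lemma pres_val_exact X Y Z (f : mor X Y) (g : mor Y Z) :
  exact_at f g -> exact_at (pres_val f) (pres_val g).
Proof.
move=> [K [k [q [kk eq fkq]]]]; have [K' [k' [kk' kv]]] := pres_kernel g.
have [j kj] := kernel_factor kk kk'.1.
apply: (exact_on_projectives enoughA abA).
  by rewrite -pres_valM fkq mcompA kk.1 mcomp0m.
move=> W y pW /(kernel_factor kv)[z <-].
have [x ex] := pW _ _ _ (pres_val j ∘ z) (pres_val_epi eq).
by exists x; rewrite fkq pres_valM -mcompA ex mcompA -pres_valM kj.
Qed.

Lemma exact_pres_val X Y Z (f : mor X Y) (g : mor Y Z) :
  exact_at (pres_val f) (pres_val g) -> exact_at f g.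
Proof.
move=> exv; have [K [k [kk kv]]] := pres_kernel g.
have [|q kq] := kernel_factor (x := f) kk.
  by apply: pres_val_inj; rewrite pres_valM (exact_mcomp0 exv).
exists K, k, q; split=> //; apply: epi_pres_val.
apply: (epi_on_projectives enoughA) => W y pW.
have [|x ex] := exact_lift (x := pres_val k ∘ y) pW exv.
  by rewrite mcompA kv.1 mcomp0m.
by exists x; apply: (kernel_mono kv); rewrite mcompA -pres_valM kq.
Qed.

End PresentedAbelian.

(** * The suspension of presented objects *)

Section PresentedStable.
Variables (T : triangulated_category) (I : morphism_class T).
Variables (A : stable_abelian_category) (F : stable_functor T A).
Hypothesis homF : homological F.
Hypothesis kerF : forall (X Y : T) (f : mor X Y), @I X Y f <-> fmap F f = 0.
Hypothesis enoughT : enough_projectives I.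
Hypothesis enoughA : enough_projective_objects A.

Let abA : abelian A := stable_abelianP A.
Let B : additive_category := pres_additive kerF enoughA.
Implicit Types X Y Z W : B.

Definition fsusp_inv (X : T) : mor (F (susp X)) (susp (F X)) :=
  projT1 (cid (fsusp_iso F X)).

Lemma fsuspK (X : T) : fsusp_inv X ∘ fsusp F X = idm _.
Proof. by rewrite /fsusp_inv; case: cid => g []. Qed.

Lemma fsuspVK (X : T) : fsusp F X ∘ fsusp_inv X = idm _.
Proof. by rewrite /fsusp_inv; case: cid => g []. Qed.

Lemma fsusp_inv_nat (X Y : T) (f : mor X Y) :
  fsusp_inv Y ∘ fmap F (fmap susp f) = fmap susp (fmap F f) ∘ fsusp_inv X.
Proof.
rewrite -[LHS]mcompm1 -(fsuspVK X) -!mcompA (mcompA _ (fsusp F X)) -fsusp_nat.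
by rewrite !mcompA fsuspK mcomp1m.
Qed.

Lemma presentation_susp (X : A) (P : T) (pi : mor (F P) X) :
  presentation I (fmap susp pi ∘ fsusp_inv P) <-> presentation I pi.
Proof.
have epi_pi : epi (fmap susp pi ∘ fsusp_inv P) <-> epi pi.
  split=> ep.
    apply/susp_epi => W g h gh; apply: ep.
    by rewrite !mcompA gh.
  apply: epi_comp; first exact/susp_epi.
  by apply: is_iso_epi; exists (fsusp F P); rewrite fsuspK fsuspVK.
have ex_pi Q (d : mor Q P) :
    exact_at (fmap F (fmap susp d)) (fmap susp pi ∘ fsusp_inv P) <->
    exact_at (fmap F d) pi.
  split=> exd.
    apply/susp_exact; apply: (exact_on_projectives enoughA abA) => [|W y pW py].
      rewrite -(mcompm1 (fmap susp pi)) -(fsuspK P) -!mcompA fsusp_nat.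
      by rewrite !mcompA (exact_mcomp0 exd) mcomp0m.
    have [|z ez] := exact_lift (x := fsusp F P ∘ y) pW exd.
      by rewrite -mcompA (mcompA (fsusp_inv P)) fsuspK mcomp1m.
    exists (fsusp_inv Q ∘ z); apply: (is_iso_mono (fsusp_iso F P)).
    by rewrite mcompA fsusp_nat -mcompA (mcompA (fsusp F Q)) fsuspVK mcomp1m.
  have {}exd := (susp_exact _ _).2 exd.
  apply: (exact_on_projectives enoughA abA) => [|W y pW py].
    by rewrite -mcompA fsusp_inv_nat mcompA (exact_mcomp0 exd) mcomp0m.
  have [|z ez] := exact_lift (x := fsusp_inv P ∘ y) pW exd.
    by rewrite mcompA.
  exists (fsusp F Q ∘ z).
  by rewrite mcompA -fsusp_nat -mcompA ez mcompA fsuspVK mcomp1m.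
split=> -[pP /epi_pi ep [Q [d [pQ exd]]]].
  split=> //; first exact: (iproj_unsusp kerF pP).
  have [Q' eQ] := susp_ob_surj Q; subst Q; have [d' ed] := susp_surj d; subst d.
  by exists Q', d'; split; [exact: (iproj_unsusp kerF pQ) | exact/ex_pi].
split=> //; first exact: (iproj_susp kerF pP).
by exists (susp Q), (fmap susp d); split; [exact: (iproj_susp kerF pQ) | exact/ex_pi].
Qed.

Lemma presentation_eq (X X' : A) (P P' : T) (pi : mor (F P) X) (eX : X = X')
    (eP : P' = P) :
  presentation I pi -> presentation I (eq_hom eX ∘ pi ∘ fmap F (eq_hom eP)).
Proof. by case: X' / eX; case: P / eP pi => pi; rewrite fmap1 mcompm1 mcomp1m. Qed.

(** Suspension has to be invertible on the nose, so the objects X[1][-1] and X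
    must be equal; this reduces equality of presented objects to an identity
    between morphisms. *)
Lemma presented_eq X Y (eX : pr_ob X = pr_ob Y) (eP : pr_gen X = pr_gen Y) :
  eq_hom eX ∘ pr_map X = pr_map Y ∘ fmap F (eq_hom eP) -> X = Y.
Proof.
case: X Y eX eP => [X P pi hX] [Y Q rho hY] /= eX eP; subst Y Q.
rewrite /= fmap1 mcomp1m mcompm1 => e; subst rho.
by rewrite (Prop_irrelevance hX hY).
Qed.

Definition pres_susp_ob X : B := Presented ((presentation_susp _).2 (prP X)).

Lemma pres_susp_liftable X Y (f : mor X Y) :
  liftable (pres_susp_ob X) (pres_susp_ob Y) (fmap susp (pres_val f)).
Proof.
have [a fa] := pres_lift f; apply/liftableP; exists (fmap susp a).
by rewrite /= mcompA -fmapM fa -mcompA fsusp_inv_nat fmapM mcompA.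
Qed.

Definition pres_susp_fmap X Y (f : mor X Y) :
  mor (pres_susp_ob X) (pres_susp_ob Y) := PresMor (pres_susp_liftable f).

Lemma pres_susp_fmap1 X : pres_susp_fmap (idm X) = idm (pres_susp_ob X).
Proof. by apply: pres_val_inj; exact: fmap1. Qed.

Lemma pres_susp_fmapM X Y Z (g : mor Y Z) (f : mor X Y) :
  pres_susp_fmap (g ∘ f) = pres_susp_fmap g ∘ pres_susp_fmap f.
Proof. by apply: pres_val_inj; exact: fmapM. Qed.

Definition pres_susp : functor B B :=
  Functor pres_susp_fmap1 pres_susp_fmapM.

Lemma pres_suspD X Y (f g : mor X Y) :
  fmap pres_susp (f + g) = fmap pres_susp f + fmap pres_susp g.
Proof. by apply: pres_val_inj; exact: suspD. Qed.

Definition pres_desusp_map X : mor (F (desusp (pr_gen X))) (desusp (pr_ob X)) :=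
  unsusp (eq_hom (esym (desuspK (pr_ob X))) ∘ pr_map X ∘
          fmap F (eq_hom (desuspK (pr_gen X))) ∘ fsusp F (desusp (pr_gen X))).

Lemma pres_desusp_presentation X : presentation I (pres_desusp_map X).
Proof.
apply/presentation_susp; rewrite /pres_desusp_map unsuspK -mcompA fsuspVK.
by rewrite mcompm1; exact: (presentation_eq _ _ (prP X)).
Qed.

Definition pres_desusp_ob X : B := Presented (pres_desusp_presentation X).

Lemma pres_suspK : cancel pres_susp pres_desusp_ob.
Proof.
move=> X; apply: (@presented_eq (pres_desusp_ob (pres_susp X)) X
  (suspK (pr_ob X)) (suspK (pr_gen X))).
apply: susp_inj; rewrite !fmapM /= unsuspK /=.
rewrite !mcompA (fmap_eq_hom susp) eq_hom_trans eq_homE mcomp1m.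
rewrite -!mcompA; congr (_ ∘ _).
have -> : desuspK (susp (pr_gen X)) = congr1 susp (suspK (pr_gen X)).
  exact: Prop_irrelevance.
rewrite -(fmap_eq_hom susp) (mcompA (fsusp_inv _)) fsusp_inv_nat.
by rewrite -mcompA fsuspK mcompm1.
Qed.

Lemma pres_desuspK : cancel pres_desusp_ob pres_susp.
Proof.
move=> X; apply: (@presented_eq (pres_susp (pres_desusp_ob X)) X
  (desuspK (pr_ob X)) (desuspK (pr_gen X))).
rewrite /= unsuspK -mcompA fsuspVK mcompm1 !mcompA.
by rewrite eq_homVK mcomp1m.
Qed.

Lemma pres_unsusp_liftable X Y (f : mor (pres_susp X) (pres_susp Y)) :
  liftable X Y (unsusp (pres_val f)).
Proof.
have [a fa] := pres_lift f; apply/liftableP; exists (unsusp a).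
apply: susp_inj; rewrite !fmapM unsuspK.
apply: (is_iso_epi (f := fsusp_inv (pr_gen X))).
  by exists (fsusp F (pr_gen X)); rewrite fsuspK fsuspVK.
by rewrite -!mcompA -fsusp_inv_nat unsuspK [RHS]mcompA; exact: fa.
Qed.

Definition pres_unsusp X Y (f : mor (pres_susp X) (pres_susp Y)) : mor X Y :=
  PresMor (pres_unsusp_liftable f).

Lemma pres_fmap_suspK X Y :
  cancel (fun f : mor X Y => fmap pres_susp f) (@pres_unsusp X Y).
Proof. by move=> f; apply: pres_val_inj; exact: fmap_suspK. Qed.

Lemma pres_unsuspK X Y :
  cancel (@pres_unsusp X Y) (fun f : mor X Y => fmap pres_susp f).
Proof. by move=> f; apply: pres_val_inj; exact: unsuspK. Qed.

Definition pres_stable : stable_category :=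
  StableCategory pres_suspD pres_suspK pres_desuspK
    pres_fmap_suspK pres_unsuspK.

Definition pres_stable_abelian : stable_abelian_category :=
  @StableAbelianCategory pres_stable
    (pres_abelian homF kerF enoughT enoughA).

(** * The functor from T to presented objects *)

Definition pres_val_functor : functor pres_stable_abelian A :=
  @Functor pres_stable_abelian A (fun X => pr_ob X) (fun X Y f => pres_val f)
    (fun X => erefl) (fun X Y Z g f => erefl).

Definition pres_val_stable : stable_functor pres_stable_abelian A :=
  @StableFunctor pres_stable_abelian A pres_val_functor
    (fun X Y f g => erefl) (fun X => idm (susp (pr_ob X)))
    (fun X => is_iso_idm _)
    (fun X Y f => etrans (mcomp1m _) (esym (mcompm1 _))).

Definition cover_sig (X : T) := cid (iproj_cover homF kerF enoughT enoughA X).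
Definition cover_gen (X : T) : T := projT1 (cover_sig X).
Definition cover_map (X : T) : mor (cover_gen X) X :=
  projT1 (cid (projT2 (cover_sig X))).

Lemma cover_proj (X : T) : ideal_projective I (cover_gen X).
Proof. by rewrite /cover_gen; case: (projT2 (cid (projT2 (cover_sig X)))). Qed.

Lemma cover_epi (X : T) : epi (fmap F (cover_map X)).
Proof. by rewrite /cover_map; case: (projT2 (cid (projT2 (cover_sig X)))). Qed.

Lemma cover_presentation (X : T) : presentation I (fmap F (cover_map X)).
Proof.
split; [exact: cover_proj | exact: cover_epi |].
have [N [n [h t]]] := triangle_fiber (cover_map X).
have [Q [e [pQ ee]]] := iproj_cover homF kerF enoughT enoughA N.
exists Q, (n ∘ e); split=> //.
apply: (exact_on_projectives enoughA abA).
  by rewrite -fmapM mcompA (triangle_mcomp0 t) mcomp0m fmap0.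
move=> W y pW /(exact_lift pW (homF t))[z <-].
by have [w <-] := pW _ _ _ z ee; exists w; rewrite fmapM mcompA.
Qed.

Definition pres_of (X : T) : B := Presented (cover_presentation X).

(** Generators are I-projective and covers are I-epic, so a morphism of T lifts
    to the chosen covers. *)
Lemma pres_of_liftable (X Y : T) (f : mor X Y) :
  liftable (pres_of X) (pres_of Y) (fmap F f).
Proof.
have [a fa] := iproj_lift_epi kerF enoughA (f ∘ cover_map X)
  (@cover_proj X) (@cover_epi Y).
by apply/liftableP; exists a; rewrite /= -!fmapM fa.
Qed.

Definition pres_of_map (X Y : T) (f : mor X Y) : mor (pres_of X) (pres_of Y) :=
  PresMor (pres_of_liftable f).

Lemma pres_of_map1 (X : T) : pres_of_map (idm X) = idm (pres_of X).
Proof. by apply: pres_val_inj; exact: fmap1. Qed.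

Lemma pres_of_mapM (X Y Z : T) (g : mor Y Z) (f : mor X Y) :
  pres_of_map (g ∘ f) = pres_of_map g ∘ pres_of_map f.
Proof. by apply: pres_val_inj; exact: fmapM. Qed.

Definition pres_functor : functor T pres_stable_abelian :=
  @Functor T pres_stable_abelian pres_of pres_of_map pres_of_map1 pres_of_mapM.

Lemma pres_fmapD (X Y : T) (f g : mor X Y) :
  fmap pres_functor (f + g) = fmap pres_functor f + fmap pres_functor g.
Proof. by apply: pres_val_inj; exact: fmapD. Qed.

Lemma pres_fsusp_liftable (X : T) :
  liftable (pres_susp (pres_of X)) (pres_of (susp X)) (fsusp F X).
Proof.
have [a ea] := iproj_lift_epi kerF enoughA (fmap susp (cover_map X))
  (iproj_susp kerF (@cover_proj X)) (@cover_epi (susp X)).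
apply/liftableP; exists a; rewrite /= -fmapM ea mcompA fsusp_nat -mcompA.
by rewrite fsuspVK mcompm1.
Qed.

Definition pres_fsusp (X : T) :
  mor (pres_susp (pres_of X)) (pres_of (susp X)) :=
  PresMor (pres_fsusp_liftable X).

Lemma pres_fsusp_iso (X : T) :
  is_iso (pres_fsusp X : mor (susp (pres_functor X)) (pres_functor (susp X))).
Proof.
have hV : liftable (pres_of (susp X)) (pres_susp (pres_of X)) (fsusp_inv X).
  have [|a ea] := iproj_lift_epi kerF enoughA (cover_map (susp X))
    (@cover_proj (susp X)) (f := fmap susp (cover_map X)).
    by apply/fmap_susp_epi; exact: cover_epi.
  by apply/liftableP; exists a; rewrite /= -ea fmapM mcompA fsusp_inv_nat.
exists (PresMor hV); split; apply: pres_val_inj.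
  exact: fsuspK.
exact: fsuspVK.
Qed.

Lemma pres_fsusp_nat (X Y : T) (f : mor X Y) :
  (pres_fsusp Y : mor (susp (pres_functor Y)) (pres_functor (susp Y))) ∘
    fmap susp (fmap pres_functor f) =
  fmap pres_functor (fmap susp f) ∘ pres_fsusp X.
Proof. by apply: pres_val_inj; exact: fsusp_nat. Qed.

Definition pres_stable_functor : stable_functor T pres_stable_abelian :=
  StableFunctor pres_fmapD pres_fsusp_iso pres_fsusp_nat.

Lemma pres_ideal_exact : ideal_exact I pres_stable_functor.
Proof.
split=> [X Y Z f g h t|X Y f /kerF f0].
  apply: (exact_pres_val homF enoughT (f := pres_of_map f)
    (g := pres_of_map g)); exact: (homF t).
by apply: pres_val_inj.
Qed.

End PresentedStable.

(** * What the universal property gives *)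

Definition id_functor (C : category) : functor C C :=
  @Functor C C id (fun X Y f => f) (fun X => erefl) (fun X Y Z g f => erefl).

Definition id_stable_functor (C : stable_category) : stable_functor C C :=
  @StableFunctor C C (id_functor C) (fun X Y f g => erefl)
    (fun X => idm (susp X)) (fun X => is_iso_idm _)
    (fun X Y f => etrans (mcomp1m _) (esym (mcompm1 _))).

Section FunctorComposition.
Variables (C D E : stable_category).
Variables (G : stable_functor D E) (F : stable_functor C D).

Let obj (X : C) : E := G (F X).
Let map (X Y : C) (f : mor X Y) : mor (obj X) (obj Y) := fmap G (fmap F f).

Lemma functor_comp1 (X : C) : map (idm X) = idm (obj X).
Proof. by rewrite /map !fmap1. Qed.

Lemma functor_compM (X Y Z : C) (g : mor Y Z) (f : mor X Y) :
  map (g ∘ f) = map g ∘ map f.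
Proof. by rewrite /map !fmapM. Qed.

Definition functor_comp : functor C E := Functor functor_comp1 functor_compM.

Lemma functor_compD (X Y : C) (f g : mor X Y) :
  fmap functor_comp (f + g) = fmap functor_comp f + fmap functor_comp g.
Proof. by rewrite /= /map !fmapD. Qed.

Definition fsusp_comp (X : C) : mor (susp (obj X)) (obj (susp X)) :=
  fmap G (fsusp F X) ∘ fsusp G (F X).

Lemma fsusp_comp_iso (X : C) : is_iso (fsusp_comp X).
Proof.
by apply: is_iso_comp (fsusp_iso _ _); apply: is_iso_fmap; exact: fsusp_iso.
Qed.

Lemma fsusp_comp_nat (X Y : C) (f : mor X Y) :
  fsusp_comp Y ∘ fmap susp (map f) = map (fmap susp f) ∘ fsusp_comp X.
Proof.
by rewrite /fsusp_comp /map -mcompA fsusp_nat !mcompA -!fmapM fsusp_nat.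
Qed.

Definition stable_functor_comp : stable_functor C E :=
  @StableFunctor C E functor_comp functor_compD fsusp_comp fsusp_comp_iso
    fsusp_comp_nat.

End FunctorComposition.

(** Some homological functor has kernel I, and it factors through F. *)
Lemma universal_kernel (T : triangulated_category) (I : morphism_class T)
    (A : stable_abelian_category) (F : stable_functor T A) :
  stable_homological_ideal I -> universal_exact I F ->
  forall (X Y : T) (f : mor X Y), I X Y f <-> fmap F f = 0.
Proof.
move=> [B [H [homH kerH]]] [[homF vanF] univF] X Y f; split=> [|f0].
  exact: vanF.
have [|[G [_ [g [gi gn _]]]] _] := univF B H; first by split=> // ? ? ? /kerH.
apply/kerH; apply: (epi_eq0 (is_iso_epi (gi X))).
by rewrite -gn f0 fmap0 mcompm0.
Qed.

Lemma enough_of_global_dimension (C : enriched_category) :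
  global_dimension_le2 C -> enough_projective_objects C.
Proof.
move=> gd X; have [r] := gd X.
by exists (res0 r), (res_eps r); split; [exact: res_proj0 | exact: res_epi].
Qed.

Section Universal.
Variables (T : triangulated_category) (I : morphism_class T).
Variables (A : stable_abelian_category) (F : stable_functor T A).
Hypothesis univF : universal_exact I F.
Hypothesis kerF : forall (X Y : T) (f : mor X Y), @I X Y f <-> fmap F f = 0.
Hypothesis enoughT : enough_projectives I.
Hypothesis enoughA : enough_projective_objects A.

Let homF : homological F := univF.1.1.
Let B : stable_abelian_category := pres_stable_abelian homF kerF enoughT enoughA.
Let H : stable_functor T B := pres_stable_functor homF kerF enoughT enoughA.
Let U : stable_functor B A := pres_val_stable homF kerF enoughT enoughA.

(** F factors through presented objects, hence so does the functor that F
    induces from A to A; uniqueness identifies the latter with the identity. *)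
Lemma presented_retraction :
  exists (G : stable_functor A B) (gamma : forall X : T, mor (G (F X)) (H X))
         (rho : forall X : A, mor X (U (G X))),
    [/\ (forall X, is_iso (gamma X)) /\ (forall X, is_iso (rho X)),
        forall (X Y : T) (f : mor X Y),
          gamma Y ∘ fmap G (fmap F f) = fmap H f ∘ gamma X &
        forall (X Y : A) (f : mor X Y),
          rho Y ∘ f = fmap U (fmap G f) ∘ rho X].
Proof.
have [[G [exG [gamma [gi gn gs]]]] _] :=
  univF.2 B H (pres_ideal_exact homF kerF enoughT enoughA).
have exUG : exact_functor (stable_functor_comp U G).
  by move=> X Y Z f g /exG exfg; exact: (pres_val_exact homF enoughT exfg).
have facUG : factors_through F (stable_functor_comp U G) F.
  exists (fun X => fmap U (gamma X)); split=> [X|X Y f|X].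
  - exact: (is_iso_fmap U (gi X)).
  - exact: (congr1 (fun z => fmap U z) (gn X Y f)).
  rewrite /= /fsusp_comp /= mcompm1; exact: (congr1 (fun z => fmap U z) (gs X)).
have exid : exact_functor (id_stable_functor A) by [].
have facid : factors_through F (id_stable_functor A) F.
  exists (fun X => idm (F X)); split=> [X|X Y f|X].
  - exact: is_iso_idm.
  - by rewrite mcomp1m mcompm1.
  by rewrite fmap1 !mcompm1 mcomp1m.
have [rho [ri rn]] := (univF.2 A F univF.1).2 _ _ exid facid exUG facUG.
by exists G, gamma, rho; split.
Qed.

(** X is isomorphic to the object underlying G(X), which is presented. *)
Lemma object_cover (X : A) : exists (P : T) (pi : mor (F P) X),
  ideal_projective I P /\ epi pi.
Proof.
have [G [gamma [rho [[gi ri] gn rn]]]] := presented_retraction.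
have [r [ir _ _]] := is_iso_inv (ri X); case: (prP (G X)) => pP epi _.
by exists (pr_gen (G X)), (r ∘ pr_map (G X)); split=> //;
   apply: epi_comp epi; exact: is_iso_epi.
Qed.

(** The cover of an I-projective object splits. *)
Lemma pres_of_split P Y (f : mor (pres_of homF kerF enoughT enoughA P) Y) :
  ideal_projective I P ->
  exists k : mor P (pr_gen Y), pres_val f = pr_map Y ∘ fmap F k.
Proof.
move=> pP; have [a fa] := pres_lift f.
have [s cs] := iproj_lift_epi kerF enoughA (idm P) pP
  (@cover_epi _ _ _ _ homF kerF enoughT enoughA P).
by exists (a ∘ s); rewrite fmapM mcompA -fa -mcompA -fmapM cs fmap1 mcompm1.
Qed.

(** G(g) lifts to generators, so it comes from some k : P -> Y. The two
    identifications of U G F with F differ by an automorphism psi of F, which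
    is harmless since F(k) commutes with psi. *)
Lemma iproj_full P Y (g : mor (F P) (F Y)) :
  ideal_projective I P -> exists k : mor P Y, fmap F k = g.
Proof.
move=> pP; have [G [gamma [rho [[gi ri] gn rn]]]] := presented_retraction.
have [gV [_ gVP _]] := is_iso_inv (gi P).
pose psi (X : T) : mor (F X) (F X) := fmap U (gamma X) ∘ rho (F X).
have psin (X X' : T) (f : mor X X') : psi X' ∘ fmap F f = fmap F f ∘ psi X.
  rewrite /psi -mcompA rn !mcompA; congr (_ ∘ _).
  exact: (congr1 (fun z => fmap U z) (gn X X' f)).
have ipsi (X : T) : is_iso (psi X).
  by apply: is_iso_comp (ri _); exact: (is_iso_fmap U (gi X)).
have [a ga] := pres_of_split (gamma Y ∘ fmap G g ∘ gV) pP.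
exists (cover_map homF kerF enoughT enoughA Y ∘ a).
apply: (is_iso_mono (ipsi Y)); rewrite psin fmapM.
transitivity (fmap U (gamma Y ∘ fmap G g ∘ gV) ∘ psi P).
  by congr (_ ∘ _); rewrite -[RHS]/(pres_val _) ga.
transitivity (fmap U (gamma Y ∘ fmap G g ∘ gV ∘ gamma P) ∘ rho (F P)).
  by rewrite /psi mcompA -fmapM.
by rewrite -[_ ∘ gV ∘ _]mcompA gVP mcompm1 fmapM -mcompA -rn mcompA.
Qed.

End Universal.

(** * The left adjoint at projective objects *)

(** A projective object X is a retract of some F(P); the corresponding
    idempotent of F(P) lifts to P and splits there. *)
Lemma adjoint_at_projective (T : triangulated_category) (I : morphism_class T)
    (A : stable_abelian_category) (F : stable_functor T A) :
  has_countable_coproducts T -> universal_exact I F ->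
  (forall (X Y : T) (f : mor X Y), I X Y f <-> fmap F f = 0) ->
  enough_projectives I -> enough_projective_objects A ->
  forall X : A, projective X -> exists (Q : T) (eta : mor X (F Q)),
    ideal_projective I Q /\ is_iso eta.
Proof.
move=> copT univF kerF enoughT enoughA X pX.
have [P [pi [pP epi]]] := object_cover univF kerF enoughT enoughA X.
have [s pis] := pX _ _ _ (idm X) epi.
have [e Fe] := iproj_full univF kerF enoughT enoughA (s ∘ pi) pP.
have ee : e ∘ e = e.
  apply: (iproj_inj kerF pP).
  by rewrite fmapM Fe -mcompA (mcompA pi) pis mcomp1m.
have [Y [r [k [rk kr]]]] := idempotent_split copT ee.
exists Y, (fmap F r ∘ s); split; first exact: (iproj_retract kerF rk pP).
exists (pi ∘ fmap F k); split.
  rewrite -!mcompA (mcompA (fmap F k)) -fmapM kr Fe !mcompA pis mcomp1m.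
  exact: pis.
rewrite -!mcompA (mcompA s) -Fe -!fmapM.
by rewrite -kr -!mcompA rk mcompm1 rk fmap1.
Qed.

(** * The localising subcategory generated by the projective objects *)

Section Generated.
Variables (T : triangulated_category) (I : morphism_class T).
Variables (A : stable_abelian_category) (F : stable_functor T A).
Hypothesis homF : homological F.
Hypothesis kerF : forall (X Y : T) (f : mor X Y), @I X Y f <-> fmap F f = 0.
Hypothesis enoughA : enough_projective_objects A.

Lemma generated_iproj P : ideal_projective I P -> projectively_generated I P.
Proof. by move=> pP L _; exact. Qed.

Arguments generated_iproj [P] pP.

Lemma generated_susp X :
  projectively_generated I X <-> projectively_generated I (susp X).
Proof.
split=> gX L lL pL; have [_ sL _ _] := lL.
  by apply: (sL X).1; exact: gX.
by apply: (sL X).2; exact: gX.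
Qed.

Lemma generated_cone X Y Z (f : mor X Y) (g : mor Y Z) (h : mor Z (susp X)) :
  triangle f g h -> projectively_generated I X -> projectively_generated I Y ->
  projectively_generated I Z.
Proof.
move=> t gX gY L lL pL; have [_ _ cL _] := lL.
by apply: (cL _ _ _ _ _ _ t); [exact: (gX L) | exact: (gY L)].
Qed.

Arguments generated_cone [X Y Z f g h] t gX gY.

Lemma generated_fiber X Y Z (f : mor X Y) (g : mor Y Z) (h : mor Z (susp X)) :
  triangle f g h -> projectively_generated I Y -> projectively_generated I Z ->
  projectively_generated I X.
Proof.
move=> /triangle_rot t gY gZ; apply: (generated_susp X).2.
exact: (generated_cone t gY gZ).
Qed.

Arguments generated_fiber [X Y Z f g h] t gY gZ.

Lemma generated_biproduct X Y (S : biproduct X Y) :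
  projectively_generated I X -> projectively_generated I Y ->
  projectively_generated I S.
Proof.
move=> gX gY L lL pL; have [_ _ cL sL] := lL.
have [O zO] := ex_zero_object T.
have lX := gX L lL pL; have lY := gY L lL pL.
have lO : L O by exact: (cL _ _ _ _ _ _ (triangle_id X zO) lX lX).
(* A biproduct is the countable coproduct of X, Y, 0, 0, ... *)
pose Z n := match n with 0 => X | 1 => Y | _ => O end.
pose i n : mor (Z n) S :=
  match n with 0 => bp_inl S | 1 => bp_inr S | _ => 0 end.
apply: (sL Z S i) => [B f|[|[|n]]] //.
exists (f 0%N ∘ bp_prl S + f 1%N ∘ bp_prr S); split=> [[|[|n]]|g gi] /=.
- by rewrite mcompDl -!mcompA bp_ll bp_rl mcompm1 mcompm0 addr0.
- by rewrite mcompDl -!mcompA bp_lr bp_rr mcompm1 mcompm0 add0r.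
- by rewrite mcompm0 (zO.2 _ (f n.+2)).
by rewrite -(mcompm1 g) -(bp_sum S) mcompDr !mcompA -(gi 0%N) -(gi 1%N).
Qed.

Arguments generated_biproduct [X Y S] gX gY.

(** The objects without nonzero morphisms to contractible ones form a localising
    subcategory, because contractibility is invariant under suspension. *)
Lemma generated_contractible X C (x : mor X C) :
  projectively_generated I X -> fmap F (idm C) = 0 -> x = 0.
Proof.
move=> gX; move: C x.
apply: (gX (fun X => forall C (x : mor X C), fmap F (idm C) = 0 -> x = 0));
  last first.
  move=> P pP C x C0; apply: (iproj_eq0 kerF pP).
  by rewrite -(mcomp1m x) fmapM C0 mcomp0m.
split.
- move=> Y Z [f [g [gf fg]]] hY C z C0.
  by rewrite -(mcompm1 z) -fg mcompA (hY C (z ∘ f) C0) mcomp0m.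
- move=> Y; split=> hY C y C0.
    have [C' eC] := susp_ob_surj C; subst C; have [y' ey] := susp_surj y; subst y.
    by rewrite (hY C' y') ?susp_map0 //; apply/fmap_susp_eq0; rewrite fmap1.
  apply: susp_eq0; apply: hY; rewrite -fmap1; exact/fmap_susp_eq0.
- move=> Y Z W f g h t hY hZ C w C0.
  have [u <-] := triangle_factorl ((triangle_rot _ _ _).1 t) (hZ C (w ∘ g) C0).
  have [C' eC] := susp_ob_surj C; subst C; have [u' eu] := susp_surj u; subst u.
  rewrite (hY C' u') ?susp_map0 ?mcomp0m //.
  by apply/fmap_susp_eq0; rewrite fmap1.
move=> Z S i copS hZ C f C0; have [k [_ ku]] := copS C (fun n => 0).
have <- : k = f by apply: ku => n; exact: (hZ n C _ C0).
by apply: ku => n; rewrite mcomp0m.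
Qed.

(** The cone of a morphism inverted by F is contractible and generated, so
    its identity vanishes. *)
Lemma generated_iso X Y (f : mor X Y) :
  projectively_generated I X -> projectively_generated I Y ->
  is_iso (fmap F f) -> is_iso f.
Proof.
move=> gX gY If; have [Z [g [h t]]] := triangle_ex f.
apply: (triangle_iso_of_cone0 t); apply: generated_contractible.
  exact: (generated_cone t gX gY).
exact: (homological_iso_cone homF enoughA t If).
Qed.

End Generated.

(** * The universal coefficient sequence *)

(** The form in which the universality of F enters the rest of the argument:
    on I-projective objects F is fully faithful, and its left adjoint exists on
    projective objects, with invertible unit. *)
Record lifts_projectives (T : triangulated_category) (I : morphism_class T)
    (A : stable_abelian_category) (F : stable_functor T A) : Prop :=
  LiftsProjectives {
    lp_hom : homological F;
    lp_ker : forall (X Y : T) (f : mor X Y), I X Y f <-> fmap F f = 0;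
    lp_enough : enough_projective_objects A;
    lp_full : forall P Y (g : mor (F P) (F Y)), ideal_projective I P ->
      exists k : mor P Y, fmap F k = g;
    lp_adjoint : forall X : A, projective X ->
      exists (Q : T) (eta : mor X (F Q)), ideal_projective I Q /\ is_iso eta }.

Lemma left_adjoint_inj (C D : category) (F : functor C D) (P : D) (Q : C)
    (eta : mor P (F Q)) (B : C) (k k' : mor Q B) :
  left_adjoint_value eta -> fmap F k ∘ eta = fmap F k' ∘ eta -> k = k'.
Proof.
move=> adj kk; have [l [_ lu]] := adj B (fmap F k' ∘ eta).
by rewrite -(lu k) // -(lu k').
Qed.

Lemma left_adjoint_ex (C D : category) (F : functor C D) (P : D) (Q : C)
    (eta : mor P (F Q)) (B : C) (g : mor P (F B)) :
  left_adjoint_value eta -> exists k : mor Q B, fmap F k ∘ eta = g.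
Proof. by move=> /(_ B g)[k [kg _]]; exists k. Qed.

Section Syzygy.
Variables (C : additive_category) (X : C) (r : resolution X) (W : syzygy r).

Lemma syz_mono : mono (syz_in W).
Proof. exact: kernel_mono (syz_ker W). Qed.

Lemma syz_in0 : res_eps r ∘ syz_in W = 0.
Proof. exact: (syz_ker W).1. Qed.

Lemma syz_pr_d2 : syz_pr W ∘ res_d2 r = 0.
Proof.
apply: (mono_eq0 syz_mono); rewrite mcompA syz_prP.
exact: exact_mcomp0 (@res_exact1 _ _ r).
Qed.

Lemma syz_pr_lift P (x : mor P W) :
  projective P -> exists y : mor P (res1 r), syz_pr W ∘ y = x.
Proof.
move=> pP.
have [|y dy] := exact_lift (x := syz_in W ∘ x) pP (@res_exact0 _ _ r).
  by rewrite mcompA syz_in0 mcomp0m.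
by exists y; apply: syz_mono; rewrite mcompA syz_prP.
Qed.

Lemma syz_pr_exact P (x : mor P (res1 r)) :
  projective P -> syz_pr W ∘ x = 0 -> exists y, res_d2 r ∘ y = x.
Proof.
move=> pP x0; apply: (exact_lift pP (@res_exact1 _ _ r)).
by rewrite -(syz_prP W) -mcompA x0 mcompm0.
Qed.

End Syzygy.

Lemma syzygy_ex (C : additive_category) (X : C) (r : resolution X) :
  abelian C -> inhabited (syzygy r).
Proof.
move=> [kerC _ _ _]; have [W [i ki]] := kerC _ _ (res_eps r).
have [p ip] := kernel_factor ki (exact_mcomp0 (@res_exact0 _ _ r)).
by constructor; exact: (Syzygy ki ip).
Qed.

Lemma ext_class0 (C : additive_category) (R : forall X : C, resolution X)
    (X B : C) : ext_class (0 : mor (res2 (R X)) B) = 0.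
Proof. exact: raddf0. Qed.

Lemma ext_classD (C : additive_category) (R : forall X : C, resolution X)
    (X B : C) (u v : mor (res2 (R X)) B) :
  ext_class (u + v) = ext_class u + ext_class v.
Proof. exact: raddfD. Qed.

Section UniversalCoefficients.
Variables (T : triangulated_category) (I : morphism_class T).
Variables (A : stable_abelian_category) (F : stable_functor T A).
Hypothesis LP : lifts_projectives I F.
Variable R : forall X : A, resolution X.

Let homF := lp_hom LP.
Let kerF := lp_ker LP.
Let enoughA := lp_enough LP.
Let abA : abelian A := stable_abelianP A.

Lemma adjoint_of_iso (X : A) (Q : T) (eta : mor X (F Q)) :
  ideal_projective I Q -> is_iso eta -> left_adjoint_value eta.
Proof.
move=> pQ [eta' [e1 e2]] B g; have [k Fk] := lp_full LP (g ∘ eta') pQ.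
exists k; split=> [|k' kg]; first by rewrite Fk -mcompA e1 mcompm1.
by apply: (iproj_inj kerF pQ); rewrite Fk -kg -mcompA e2 mcompm1.
Qed.

Lemma adjoint_ex (X : A) : projective X ->
  exists (Q : T) (eta : mor X (F Q)), left_adjoint_value eta.
Proof.
move=> /(lp_adjoint LP)[Q [eta [pQ ie]]]; exists Q, eta.
exact: adjoint_of_iso.
Qed.

Lemma adjoint_iso (X : A) (Q : T) (eta : mor X (F Q)) :
  projective X -> left_adjoint_value eta ->
  is_iso eta /\ ideal_projective I Q.
Proof.
move=> /(lp_adjoint LP)[Q' [eta' [pQ' ie']]] adj.
have adj' := adjoint_of_iso pQ' ie'.
have [k ke] := left_adjoint_ex eta adj'.
have [k' ke'] := left_adjoint_ex eta' adj.
have kk' : k ∘ k' = idm Q.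
  by apply: (left_adjoint_inj adj); rewrite fmapM -mcompA ke' ke fmap1 mcomp1m.
have k'k : k' ∘ k = idm Q'.
  by apply: (left_adjoint_inj adj'); rewrite fmapM -mcompA ke ke' fmap1 mcomp1m.
split; last exact: (iproj_retract kerF kk' pQ').
by rewrite -ke; apply: is_iso_comp ie'; apply: is_iso_fmap; exists k'.
Qed.

Section Tower.
Variables (X : A) (W : syzygy (R X)) (D : lifting I F W).

(** A lift to T of the resolution 0 -> P2 -> P1 -> Omega X. *)
Record syzygy_triangle := SyzygyTriangle {
  st_1 : T;
  st_2 : T;
  st_eta1 : mor (res1 (R X)) (F st_1);
  st_eta2 : mor (res2 (R X)) (F st_2);
  st_q : mor st_2 st_1;
  st_p : mor st_1 D;
  st_b : mor (D : T) (susp st_2);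
  st_adj1 : left_adjoint_value st_eta1;
  st_adj2 : left_adjoint_value st_eta2;
  st_qE : fmap F st_q ∘ st_eta2 = st_eta1 ∘ res_d2 (R X);
  st_pE : lift_map D ∘ fmap F st_p ∘ st_eta1 = syz_pr W;
  st_triangle : triangle st_q st_p st_b }.

(** The fibre of Q1 -> D is generated and has image P2 under F, so it is the
    value at P2 of the left adjoint. *)
Lemma syzygy_triangle_ex : inhabited syzygy_triangle.
Proof.
have [Q1 [eta1 adj1]] := adjoint_ex (@res_proj1 _ _ (R X)).
have [Q2 [eta2 adj2]] := adjoint_ex (@res_proj2 _ _ (R X)).
have [ie1 pQ1] := adjoint_iso (@res_proj1 _ _ (R X)) adj1.
have [ie2 pQ2] := adjoint_iso (@res_proj2 _ _ (R X)) adj2.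
have [q qE] := left_adjoint_ex (eta1 ∘ res_d2 (R X)) adj2.
have [al [ial alK alVK]] := is_iso_inv (lift_iso D).
have [p pE] := left_adjoint_ex (al ∘ syz_pr W) adj1.
have [N [n [h t]]] := triangle_fiber p.
have gN : projectively_generated I N.
  by apply: (generated_fiber t); [exact: generated_iproj | exact: lift_generated].
have ep : epi (fmap F p).
  apply: (epi_on_projectives enoughA) => V x pV.
  have [y ey] := syz_pr_lift (lift_map D ∘ x) pV.
  by exists (eta1 ∘ y); rewrite mcompA pE -mcompA ey mcompA alK mcomp1m.
have mn : mono (fmap F n) := homological_epi_mono homF enoughA t ep.
have [|m nm] := triangle_factorr (x := q) t.
  apply: (left_adjoint_inj adj2); rewrite fmapM -mcompA qE mcompA pE -mcompA.
  by rewrite syz_pr_d2 mcompm0 fmap0 mcomp0m.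
have mq : mono (fmap F q).
  have [e2 [ie2' _ e2K]] := is_iso_inv ie2.
  have -> : fmap F q = eta1 ∘ res_d2 (R X) ∘ e2.
    by rewrite -qE -mcompA e2K mcompm1.
  apply: mono_comp (is_iso_mono ie2'); apply: mono_comp (@res_mono _ _ (R X)).
  exact: is_iso_mono.
have im : is_iso m.
  apply: (generated_iso homF kerF enoughA _ gN); first exact: generated_iproj.
  apply: (mono_epi_iso abA).
    by move=> V x y xy; apply: mq; rewrite -nm fmapM -!mcompA xy.
  apply: (epi_on_projectives enoughA) => V z pV.
  have [e1 [ie1' e1K e1VK]] := is_iso_inv ie1.
  have [|y ey] := syz_pr_exact (W := W) (x := e1 ∘ fmap F n ∘ z) pV.
    apply: (is_iso_mono ial); rewrite mcompm0 !mcompA -pE -(mcompA _ eta1).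
    by rewrite e1VK mcompm1 -fmapM (triangle_mcomp0 t) fmap0 mcomp0m.
  exists (eta2 ∘ y); apply: mn.
  by rewrite !mcompA -fmapM nm qE -mcompA ey !mcompA e1VK mcomp1m.
have [mV [_ mVK mKV]] := is_iso_inv im.
constructor; exists Q1 Q2 eta1 eta2 q p (fmap susp mV ∘ h) => //.
  by rewrite -mcompA pE mcompA alVK mcomp1m.
apply: (triangle_iso _ (is_iso_idm Q1) (is_iso_idm D) _ _ _ t (a := mV)).
- by exists m.
- by rewrite mcomp1m -nm -mcompA mKV mcompm1.
- by rewrite mcomp1m mcompm1.
by rewrite mcompm1.
Qed.

Variable t : syzygy_triangle.

Lemma st_iso1 : is_iso (st_eta1 t).
Proof. exact: (adjoint_iso (@res_proj1 _ _ (R X)) (st_adj1 t)).1. Qed.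

Lemma st_iso2 : is_iso (st_eta2 t).
Proof. exact: (adjoint_iso (@res_proj2 _ _ (R X)) (st_adj2 t)).1. Qed.

Lemma st_proj1 : ideal_projective I (st_1 t).
Proof. exact: (adjoint_iso (@res_proj1 _ _ (R X)) (st_adj1 t)).2. Qed.

Lemma st_proj2 : ideal_projective I (st_2 t).
Proof. exact: (adjoint_iso (@res_proj2 _ _ (R X)) (st_adj2 t)).2. Qed.

Lemma st_p_epi : epi (fmap F (st_p t)).
Proof.
have [e1 [ie1' e1K e1VK]] := is_iso_inv st_iso1.
have [al [ial alK alVK]] := is_iso_inv (lift_iso D).
apply: (epi_on_projectives enoughA) => V x pV.
have [y ey] := syz_pr_lift (lift_map D ∘ x) pV.
exists (st_eta1 t ∘ y); apply: (is_iso_mono (lift_iso D)).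
by rewrite -ey -(st_pE t) !mcompA.
Qed.

(** The composite F(Q1) -> F(D) -> F(B) comes from T and kills Q2. *)
Lemma uct_lift B (g : mor (F D) (F B)) : exists x : mor (D : T) B, fmap F x = g.
Proof.
have [k Fk] := lp_full LP (g ∘ fmap F (st_p t)) st_proj1.
have [|x xp] := triangle_factorl (x := k) (st_triangle t).
  apply: (iproj_eq0 kerF st_proj2); rewrite fmapM Fk -mcompA -fmapM.
  by rewrite (triangle_mcomp0 (st_triangle t)) fmap0 mcompm0.
by exists x; apply: st_p_epi; rewrite -fmapM xp.
Qed.

Lemma uct_factor B (x : mor (D : T) B) :
  fmap F x = 0 <-> exists u, x = u ∘ st_b t.
Proof.
split=> [x0|[u ->]].
  have [|u <-] := triangle_factorl (x := x) ((triangle_rot _ _ _).1 (st_triangle t)).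
    by apply: (iproj_eq0 kerF st_proj1); rewrite fmapM x0 mcomp0m.
  by exists u.
apply: (epi_eq0 st_p_epi).
by rewrite -fmapM -mcompA (triangle_mcomp0' (st_triangle t)) mcompm0 fmap0.
Qed.

(** The cochain P2 -> F(B)[-1] adjoint to u : Q2[1] -> B. *)
Definition uct_cochain B (u : mor (susp (st_2 t)) B) :
    mor (res2 (R X)) (desusp (F B)) :=
  transpose (fmap F u ∘ fsusp F (st_2 t) ∘ fmap susp (st_eta2 t)).

Definition uct_value B (u : mor (susp (st_2 t)) B) :
    Ext2 R X (desusp (F B)) := ext_class (uct_cochain u).

Lemma uct_cochainD B (u v : mor (susp (st_2 t)) B) :
  uct_cochain (u + v) = uct_cochain u + uct_cochain v.
Proof. by rewrite /uct_cochain fmapD !mcompDl transposeD. Qed.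

Lemma uct_cochain0 B : uct_cochain (0 : mor _ B) = 0.
Proof.
by apply: (addrI (uct_cochain (0 : mor _ B))); rewrite -uct_cochainD !addr0.
Qed.

Lemma uct_cochain_iso : is_iso (fsusp F (st_2 t) ∘ fmap susp (st_eta2 t)).
Proof.
by apply: is_iso_comp (fsusp_iso _ _) (is_iso_fmap _ st_iso2).
Qed.

Lemma uct_cochain_surj B (c : mor (res2 (R X)) (desusp (F B))) :
  exists u, uct_cochain u = c.
Proof.
have [w <-] := transpose_surj c; have [e [_ eK _]] := is_iso_inv uct_cochain_iso.
have [u Fu] := lp_full LP (w ∘ e) (iproj_susp kerF st_proj2).
by exists u; rewrite /uct_cochain -mcompA Fu -mcompA eK mcompm1.
Qed.

Lemma uct_cochain_inj B (u v : mor (susp (st_2 t)) B) :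
  uct_cochain u = uct_cochain v -> u = v.
Proof.
move/transpose_inj; rewrite -!mcompA => /(is_iso_epi uct_cochain_iso).
exact: (iproj_inj kerF (iproj_susp kerF st_proj2)).
Qed.

Lemma uct_value_surj B (c : Ext2 R X (desusp (F B))) :
  exists u : mor (susp (st_2 t)) B, uct_value u = c.
Proof.
have [u uc] := uct_cochain_surj (ext_repr c).
by exists u; rewrite /uct_value uc ext_reprK.
Qed.

(** Both sides say that u - v factors through the suspension of Q2 -> Q1. *)
Lemma uct_value_eq B (u v : mor (susp (st_2 t)) B) :
  uct_value u = uct_value v <-> u ∘ st_b t = v ∘ st_b t.
Proof.
have tr := (triangle_rot _ _ _).1 ((triangle_rot _ _ _).1 (st_triangle t)).
have susp_q (w : mor (susp (st_1 t)) B) :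
    uct_cochain (w ∘ fmap susp (st_q t)) =
    transpose (fmap F w ∘ fsusp F _ ∘ fmap susp (st_eta1 t)) ∘ res_d2 (R X).
  rewrite /uct_cochain -transpose_susp fmapM -!mcompA (mcompA _ (fsusp F _)).
  by rewrite -fsusp_nat -!mcompA -!fmapM (st_qE t).
rewrite ext_classP; split=> [[c]|uv].
  have [w <-] := transpose_surj c.
  have i1 : is_iso (fsusp F (st_1 t) ∘ fmap susp (st_eta1 t)).
    by apply: is_iso_comp (fsusp_iso _ _) (is_iso_fmap _ st_iso1).
  have [e [_ eK _]] := is_iso_inv i1.
  have [k Fk] := lp_full LP (w ∘ e) (iproj_susp kerF st_proj1).
  have <- : fmap F k ∘ fsusp F (st_1 t) ∘ fmap susp (st_eta1 t) = w.
    by rewrite -mcompA Fk -mcompA eK mcompm1.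
  rewrite -susp_q => /(congr1 (fun z => z + uct_cochain v)).
  rewrite subrK -uct_cochainD => /uct_cochain_inj ->.
  have qb : fmap susp (st_q t) ∘ st_b t = 0.
    by apply: oppr_inj; rewrite oppr0 -mcompNl (triangle_mcomp0 tr).
  by rewrite mcompDl -mcompA qb mcompm0 add0r.
have [|w wq] := triangle_factorl (x := u - v) tr.
  by rewrite mcompBl uv subrr.
exists (transpose (fmap F (- w) ∘ fsusp F _ ∘ fmap susp (st_eta1 t))).
rewrite -susp_q mcompNl -mcompNr wq.
by apply/eqP; rewrite subr_eq -uct_cochainD subrK.
Qed.

End Tower.
End UniversalCoefficients.

(** * The universal coefficient class of a morphism killed by F *)

Section UniversalCoefficientClass.
Variables (T : triangulated_category) (I : morphism_class T).
Variables (A : stable_abelian_category) (F : stable_functor T A).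
Hypothesis LP : lifts_projectives I F.
Variable R : forall X : A, resolution X.

Let homF := lp_hom LP.
Let enoughA := lp_enough LP.

(** After composition with the monomorphism Omega X' -> P0', this says that F(w)
    is the map of syzygies induced by c0. *)
Definition covers (X X' : A) (W : syzygy (R X)) (W' : syzygy (R X'))
    (D : lifting I F W) (D' : lifting I F W')
    (c0 : mor (res0 (R X)) (res0 (R X'))) (w : mor (D : T) D') : Prop :=
  syz_in W' ∘ lift_map D' ∘ fmap F w = c0 ∘ syz_in W ∘ lift_map D.

(** Naturality in D: the morphism of triangles over omega restricts to the
    chain map c2 on Q2, because Q2 -> Q1 is monic under F. *)
Lemma uct_value_pull (X X' : A) (W : syzygy (R X)) (W' : syzygy (R X'))
    (D : lifting I F W) (D' : lifting I F W')
    (t : syzygy_triangle D) (t' : syzygy_triangle D') (f : mor X X')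
    (c0 : mor (res0 (R X)) (res0 (R X')))
    (c1 : mor (res1 (R X)) (res1 (R X')))
    (c2 : mor (res2 (R X)) (res2 (R X'))) (w : mor (D : T) D')
    (B : T) (u' : mor (susp (st_2 t')) B) :
  res_eps (R X') ∘ c0 = f ∘ res_eps (R X) ->
  res_d1 (R X') ∘ c1 = c0 ∘ res_d1 (R X) ->
  res_d2 (R X') ∘ c2 = c1 ∘ res_d2 (R X) ->
  covers c0 w ->
  exists u : mor (susp (st_2 t)) B,
    u ∘ st_b t = u' ∘ st_b t' ∘ w /\
    uct_value u = ext_pull f (uct_value u').
Proof.
move=> h0 h1 h2 cw.
have [k1 k1E] := left_adjoint_ex (st_eta1 t' ∘ c1) (st_adj1 t).
have pk : w ∘ st_p t = st_p t' ∘ k1.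
  apply/esym.
  apply: (left_adjoint_inj (st_adj1 t)); rewrite !fmapM -!mcompA k1E.
  apply: (is_iso_mono (lift_iso D')); apply: (@syz_mono _ _ _ W').
  rewrite !mcompA -[syz_in W' ∘ _ ∘ _ ∘ _]mcompA -[syz_in W' ∘ _ ∘ _]mcompA.
  rewrite [lift_map D' ∘ _]mcompA st_pE syz_prP h1 cw.
  rewrite -!mcompA; congr (_ ∘ _); rewrite [lift_map D ∘ _]mcompA st_pE.
  by rewrite syz_prP.
have [k2s [kb qk]] := triangle_mor ((triangle_rot _ _ _).1 (st_triangle t))
  ((triangle_rot _ _ _).1 (st_triangle t')) pk.
have [k2 ek] := susp_surj k2s; subst k2s.
have qk2 : st_q t' ∘ k2 = k1 ∘ st_q t.
  apply: susp_inj; apply: oppr_inj.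
  by rewrite !fmapM -mcompNl -qk mcompNr.
have mq : mono (fmap F (st_q t')).
  apply: (homological_epi_mono homF enoughA (st_triangle t')).
  exact: st_p_epi.
have k2E : fmap F k2 ∘ st_eta2 t = st_eta2 t' ∘ c2.
  apply: mq; rewrite !mcompA -fmapM qk2 fmapM -mcompA st_qE mcompA k1E.
  by rewrite st_qE -!mcompA h2.
exists (u' ∘ fmap susp k2); split; first by rewrite -mcompA kb mcompA.
have cl : chain_lift R f c2 by exists c0, c1.
rewrite /uct_value (ext_pullE _ cl) /uct_cochain -transpose_susp.
congr (ext_class (transpose _)); rewrite fmapM -!mcompA; congr (_ ∘ _).
by rewrite (mcompA _ (fsusp F _)) -fsusp_nat -!mcompA -!fmapM k2E.
Qed.

Section Class.
Variables (X : A) (W : syzygy (R X)) (D : lifting I F W).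

Lemma uct_classP B (x : mor (D : T) B) (c : Ext2 R X (desusp (F B))) :
  uct_class x c <->
  exists (t : syzygy_triangle D) (u : mor (susp (st_2 t)) B),
    x = u ∘ st_b t /\ c = uct_value u.
Proof.
split=> [|[t [u [xu cu]]]].
  move=> [Q1 [Q2 [e1 [e2 [q [p [b [u [[a1 a2 qE pE] [t xu cu]]]]]]]]]].
  by exists (SyzygyTriangle a1 a2 qE pE t), u.
exists (st_1 t), (st_2 t), (st_eta1 t), (st_eta2 t), (st_q t), (st_p t).
exists (st_b t), u; split; split=> //.
- exact: st_adj1.
- exact: st_adj2.
- exact: st_qE.
- exact: st_pE.
exact: st_triangle.
Qed.

(** Two triangles over D are compared by naturality along the identity of D. *)
Lemma uct_class_value (t : syzygy_triangle D) B (x : mor (D : T) B)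
    (c : Ext2 R X (desusp (F B))) :
  uct_class x c <-> exists u, x = u ∘ st_b t /\ c = uct_value (t := t) u.
Proof.
split=> [/uct_classP[t' [u' [xu cu]]]|[u xu]]; last first.
  by apply/uct_classP; exists t, u.
have [|||| u [ub uc]] := uct_value_pull t u' (f := idm X) (c0 := idm _)
  (c1 := idm _) (c2 := idm _) (w := idm (D : T));
  rewrite ?mcompm1 ?mcomp1m //.
  by rewrite /covers fmap1 mcompm1 mcomp1m.
by exists u; rewrite xu cu uc ext_pull1 ub mcompm1.
Qed.

Lemma uct_class_ker B (x : mor (D : T) B) c : uct_class x c -> fmap F x = 0.
Proof.
by move=> /uct_classP[t [u [xu _]]]; apply/(uct_factor LP t); exists u.
Qed.

Lemma uct_class_ex B (x : mor (D : T) B) :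
  fmap F x = 0 -> exists c, uct_class x c.
Proof.
have [t] := syzygy_triangle_ex LP D; move=> /(uct_factor LP t)[u xu].
by exists (uct_value u); apply/uct_classP; exists t, u.
Qed.

Lemma uct_class_onto B (c : Ext2 R X (desusp (F B))) :
  exists x : mor (D : T) B, uct_class x c.
Proof.
have [t] := syzygy_triangle_ex LP D; have [u uc] := uct_value_surj LP t c.
by exists (u ∘ st_b t); apply/uct_classP; exists t, u.
Qed.

Lemma uct_class_fun B (x : mor (D : T) B) c c' :
  uct_class x c -> uct_class x c' -> c = c'.
Proof.
have [t] := syzygy_triangle_ex LP D.
move=> /(uct_class_value t)[u [xu ->]] /(uct_class_value t)[u' [xu' ->]].
by apply/(uct_value_eq LP); rewrite -xu -xu'.
Qed.

Lemma uct_class_inj B (x x' : mor (D : T) B) c :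
  uct_class x c -> uct_class x' c -> x = x'.
Proof.
have [t] := syzygy_triangle_ex LP D.
move=> /(uct_class_value t)[u [-> cu]] /(uct_class_value t)[u' [-> cu']].
by apply/(uct_value_eq LP); rewrite -cu -cu'.
Qed.

Lemma uct_class0 B : uct_class (0 : mor (D : T) B) 0.
Proof.
have [t] := syzygy_triangle_ex LP D; apply/uct_classP; exists t, 0.
by rewrite mcomp0m /uct_value uct_cochain0 ext_class0.
Qed.

Lemma uct_classD B (x x' : mor (D : T) B) c c' :
  uct_class x c -> uct_class x' c' -> uct_class (x + x') (c + c').
Proof.
have [t] := syzygy_triangle_ex LP D.
move=> /(uct_class_value t)[u [-> ->]] /(uct_class_value t)[u' [-> ->]].
apply/uct_classP; exists t, (u + u').
by rewrite mcompDl /uct_value uct_cochainD ext_classD.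
Qed.

Lemma uct_class_push B B' (x : mor (D : T) B) c (g : mor B B') :
  uct_class x c -> uct_class (g ∘ x) (ext_push (desusp_map (fmap F g)) c).
Proof.
move=> /uct_classP[t [u [-> ->]]]; apply/uct_classP; exists t, (g ∘ u).
rewrite mcompA; split=> //; rewrite ext_pushE desusp_map_transpose.
by rewrite /uct_value /uct_cochain fmapM !mcompA.
Qed.

End Class.

Lemma uct_class_pull (X X' : A) (W : syzygy (R X)) (W' : syzygy (R X'))
    (D : lifting I F W) (D' : lifting I F W') (f : mor X X')
    (c0 : mor (res0 (R X)) (res0 (R X'))) (w : mor (D : T) D')
    (B : T) (x : mor (D' : T) B) (c : Ext2 R X' (desusp (F B))) :
  res_eps (R X') ∘ c0 = f ∘ res_eps (R X) -> covers c0 w ->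
  uct_class x c -> uct_class (x ∘ w) (ext_pull f c).
Proof.
move=> h0 cw /uct_classP[t' [u' [-> ->]]].
have [t] := syzygy_triangle_ex LP D.
have [|c1 h1] := exact_lift (x := c0 ∘ res_d1 (R X)) (@res_proj1 _ _ (R X))
                   (@res_exact0 _ _ (R X')).
  by rewrite mcompA h0 -mcompA (exact_mcomp0 (@res_exact0 _ _ (R X))) mcompm0.
have [|c2 h2] := exact_lift (x := c1 ∘ res_d2 (R X)) (@res_proj2 _ _ (R X))
                   (@res_exact1 _ _ (R X')).
  by rewrite mcompA h1 -mcompA (exact_mcomp0 (@res_exact1 _ _ (R X))) mcompm0.
have [u [ub uc]] := uct_value_pull t u' h0 h1 h2 cw.
by apply/uct_classP; exists t, u.
Qed.

End UniversalCoefficientClass.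

(** * The obstruction to lifting a morphism *)

Lemma ext_pushD (C : additive_category) (R : forall X : C, resolution X)
    (X B B' : C) (g : mor B B') (x y : Ext2 R X B) :
  ext_push g (x + y) = ext_push g x + ext_push g y.
Proof.
by rewrite -(ext_reprK x) -(ext_reprK y) -ext_classD !ext_pushE mcompDr ext_classD.
Qed.

Lemma ext_push0 (C : additive_category) (R : forall X : C, resolution X)
    (X B B' : C) (g : mor B B') : ext_push g (0 : Ext2 R X B) = 0.
Proof. by rewrite -(ext_class0 R X B) ext_pushE mcompm0 ext_class0. Qed.

Lemma ext_pull0 (C : additive_category) (R : forall X : C, resolution X)
    (X Y B : C) (f : mor X Y) : ext_pull f (0 : Ext2 R Y B) = 0.
Proof.
have [c2 hc] := chain_lift_ex R f.
by rewrite -(ext_class0 R Y B) (ext_pullE _ hc) mcomp0m ext_class0.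
Qed.

Section Obstruction.
Variables (T : triangulated_category) (I : morphism_class T).
Variables (A : stable_abelian_category) (F : stable_functor T A).
Hypothesis LP : lifts_projectives I F.
Variable R : forall X : A, resolution X.

Let homF := lp_hom LP.
Let enoughA := lp_enough LP.
Let abA : abelian A := stable_abelianP A.

Section Tower.
Variables (X : A) (W : syzygy (R X)) (Q0 : T) (eta0 : mor (res0 (R X)) (F Q0)).
Hypothesis adj0 : left_adjoint_value eta0.

Lemma eta0_iso : is_iso eta0.
Proof. exact: (adjoint_iso LP (@res_proj0 _ _ (R X)) adj0).1. Qed.

Lemma eta0_generated : projectively_generated I Q0.
Proof.
exact: generated_iproj (adjoint_iso LP (@res_proj0 _ _ (R X)) adj0).2.
Qed.

(** The fibre of the map Q0 -> L adjoint to P0 -> X is a lifting of the syzygy,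
    because Q0 -> L is epic under F. *)
Lemma presents_ex (L : lifting I F X) :
  exists (D : lifting I F W) (phi : mor (D : T) Q0), presents eta0 L phi.
Proof.
have [al [ial alK alVK]] := is_iso_inv (lift_iso L).
have [a aE] := left_adjoint_ex (al ∘ res_eps (R X)) adj0.
have aE' : lift_map L ∘ fmap F a ∘ eta0 = res_eps (R X).
  by rewrite -mcompA aE mcompA alVK mcomp1m.
have [D [phi [b t]]] := triangle_fiber a.
have gD : projectively_generated I D.
  by apply: (generated_fiber t eta0_generated); exact: lift_generated.
have [e [ie eK eVK]] := is_iso_inv eta0_iso.
have ea : epi (fmap F a).
  move=> V x y xy; apply: (is_iso_epi ial); apply: (@res_epi _ _ (R X)).
  by rewrite -!mcompA -aE !mcompA xy.
have mphi := homological_epi_mono homF enoughA t ea.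
have [|be inbe] := kernel_factor (x := e ∘ fmap F phi) (syz_ker W).
  rewrite -aE' !mcompA -(mcompA _ eta0) eVK mcompm1 -mcompA -fmapM.
  by rewrite (triangle_mcomp0 t) fmap0 mcompm0.
have ibe : is_iso be.
  apply: (mono_epi_iso abA).
    move=> V x y xy; apply: (mono_comp (is_iso_mono ie) mphi).
    by rewrite -inbe -!mcompA xy.
  apply: (epi_on_projectives enoughA) => V y pV.
  have [|x phix] := exact_lift (x := eta0 ∘ (syz_in W ∘ y)) pV (homF t).
    by rewrite mcompA aE -mcompA (mcompA (res_eps _)) syz_in0 mcomp0m mcompm0.
  exists x; apply: (@syz_mono _ _ _ W); rewrite mcompA inbe -mcompA phix mcompA.
  by rewrite eK mcomp1m.
exists (Lifting gD ibe), phi, a, b; split=> //=.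
by rewrite -mcompA inbe mcompA eVK mcomp1m.
Qed.

(** The cone of phi is a lifting of X: since phi stays monic under F, the cone
    goes to the cokernel of the inclusion of the syzygy into P0. *)
Lemma lifting_of_syzygy (D : lifting I F W) (phi : mor (D : T) Q0) :
  fmap F phi = eta0 ∘ syz_in W ∘ lift_map D ->
  exists L : lifting I F X, presents eta0 L phi.
Proof.
move=> phiE; have [L [a [b t]]] := triangle_ex phi.
have gL : projectively_generated I L.
  by apply: (generated_cone t _ eta0_generated); exact: lift_generated.
have [e [ie eK eVK]] := is_iso_inv eta0_iso.
have mphi : mono (fmap F phi).
  rewrite phiE; apply: mono_comp (is_iso_mono (lift_iso D)).
  by apply: mono_comp (is_iso_mono eta0_iso) _; exact: syz_mono.
have ea := homological_mono_epi homF enoughA t mphi.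
have [|al alE] := exact_epi_factor (h := res_eps (R X) ∘ e) enoughA abA ea (homF t).
  rewrite phiE !mcompA -(mcompA _ e) eK mcompm1 syz_in0.
  by rewrite mcomp0m.
have ial : is_iso al.
  apply: (mono_epi_iso abA).
    apply: (mono_on_projectives enoughA) => V x pV alx.
    have [y ay] := pV _ _ _ x ea.
    have [|z inz] := kernel_factor (x := e ∘ y) (syz_ker W).
      by rewrite mcompA -alE -mcompA ay.
    have [d [_ dK dVK]] := is_iso_inv (lift_iso D).
    rewrite -ay -(mcomp1m y) -eVK -mcompA -inz.
    rewrite -(mcomp1m z) -dVK !mcompA -(mcompA _ eta0) -(mcompA _ _ (lift_map D)).
    by rewrite -phiE -fmapM (triangle_mcomp0 t) fmap0 !mcomp0m.
  move=> V x y xy; apply: (@res_epi _ _ (R X)); apply: (is_iso_epi ie).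
  by rewrite -!mcompA -alE !mcompA xy.
exists (Lifting gL ial), a, b; split=> //=.
by rewrite alE -mcompA eK mcompm1.
Qed.

End Tower.

(** The cone of Q2 -> Q1 lifts the syzygy; the inclusion of the syzygy into P0
    lifts to a map to Q0, whose cone lifts X. *)
Lemma lifting_ex (X : A) : inhabited (lifting I F X).
Proof.
have [W] := syzygy_ex (R X) abA.
have [Q0 [eta0 adj0]] := adjoint_ex LP (@res_proj0 _ _ (R X)).
have [Q1 [eta1 adj1]] := adjoint_ex LP (@res_proj1 _ _ (R X)).
have [Q2 [eta2 adj2]] := adjoint_ex LP (@res_proj2 _ _ (R X)).
have [ie1 pQ1] := adjoint_iso LP (@res_proj1 _ _ (R X)) adj1.
have [ie2 pQ2] := adjoint_iso LP (@res_proj2 _ _ (R X)) adj2.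
have [q qE] := left_adjoint_ex (eta1 ∘ res_d2 (R X)) adj2.
have [e1 [ie1' e1K e1VK]] := is_iso_inv ie1.
have [e2 [ie2' e2K e2VK]] := is_iso_inv ie2.
have [D [p [b t]]] := triangle_ex q.
have gD : projectively_generated I D.
  by apply: (generated_cone t); exact: generated_iproj.
have mq : mono (fmap F q).
  have -> : fmap F q = eta1 ∘ res_d2 (R X) ∘ e2.
    by rewrite -qE -mcompA e2VK mcompm1.
  apply: mono_comp (is_iso_mono ie2'); apply: mono_comp (@res_mono _ _ (R X)).
  exact: is_iso_mono.
have ep := homological_mono_epi homF enoughA t mq.
have [|be beE] := exact_epi_factor (h := syz_pr W ∘ e1) enoughA abA ep (homF t).
  apply: (is_iso_epi ie2); rewrite -mcompA qE mcomp0m mcompA -(mcompA _ e1) e1K.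
  by rewrite mcompm1 syz_pr_d2.
have ibe : is_iso be.
  apply: (mono_epi_iso abA).
    apply: (mono_on_projectives enoughA) => V x pV bex.
    have [y py] := pV _ _ _ x ep.
    have [|z d2z] := syz_pr_exact (W := W) (x := e1 ∘ y) pV.
      by rewrite mcompA -beE -mcompA py.
    rewrite -py -(mcomp1m y) -e1VK -mcompA -d2z (mcompA eta1) -qE !mcompA.
    by rewrite -fmapM (triangle_mcomp0 t) fmap0 !mcomp0m.
  apply: (epi_on_projectives enoughA) => V y pV.
  have [x sx] := syz_pr_lift y pV; exists (fmap F p ∘ eta1 ∘ x).
  by rewrite !mcompA beE -(mcompA _ e1) e1K mcompm1.
pose DL : lifting I F W := Lifting gD ibe.
have [st] := syzygy_triangle_ex LP DL.
have [phi phiE] := uct_lift LP st (eta0 ∘ syz_in W ∘ lift_map DL).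
by have [L _] := lifting_of_syzygy adj0 phiE; constructor.
Qed.

(** The obstruction to lifting f : X -> X' to a morphism between liftings:
    the map Q0 -> L' adjoint to P0 -> X -> X' extends over Q0 -> L if and only
    if it kills phi : D -> Q0, and its composite with phi is a class in
    Ext^2(X, X'[-1]). *)
Definition lift_obstruction (X X' : A) (L : lifting I F X)
    (L' : lifting I F X') (f : mor X X') (o : Ext2 R X (desusp X')) : Prop :=
  exists (W : syzygy (R X)) (Q0 : T) (eta0 : mor (res0 (R X)) (F Q0))
         (D : lifting I F W) (phi : mor (D : T) Q0) (k : mor Q0 L')
         (c : Ext2 R X (desusp (F L'))),
    [/\ left_adjoint_value eta0, presents eta0 L phi,
        lift_map L' ∘ fmap F k ∘ eta0 = f ∘ res_eps (R X),
        uct_class (k ∘ phi) c & o = ext_push (desusp_map (lift_map L')) c].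

Lemma presents_mcomp0 (X X' : A) (W : syzygy (R X)) (Q0 : T)
    (eta0 : mor (res0 (R X)) (F Q0)) (D : lifting I F W) (phi : mor (D : T) Q0)
    (L : lifting I F X) (L' : lifting I F X') (f : mor X X') (k : mor Q0 L') :
  presents eta0 L phi ->
  lift_map L' ∘ fmap F k ∘ eta0 = f ∘ res_eps (R X) -> fmap F (k ∘ phi) = 0.
Proof.
move=> [a [b [_ _ phiE]]] kE.
apply: (mono_eq0 (is_iso_mono (lift_iso L'))).
rewrite fmapM phiE !mcompA kE -(mcompA f) syz_in0.
by rewrite mcompm0 mcomp0m.
Qed.

Lemma lift_obstruction_with (X X' : A) (W : syzygy (R X)) (Q0 : T)
    (eta0 : mor (res0 (R X)) (F Q0)) (D : lifting I F W) (phi : mor (D : T) Q0)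
    (L : lifting I F X) (L' : lifting I F X') (f : mor X X') (k : mor Q0 L') :
  left_adjoint_value eta0 -> presents eta0 L phi ->
  lift_map L' ∘ fmap F k ∘ eta0 = f ∘ res_eps (R X) ->
  exists c, uct_class (k ∘ phi) c /\
            lift_obstruction L L' f (ext_push (desusp_map (lift_map L')) c).
Proof.
move=> adj0 pr kE; have [c hc] := uct_class_ex LP (presents_mcomp0 pr kE).
by exists c; split=> //; exists W, Q0, eta0, D, phi, k, c.
Qed.

Lemma adjoint_lift (X X' : A) (Q0 : T) (eta0 : mor (res0 (R X)) (F Q0))
    (L' : lifting I F X') (f : mor X X') :
  left_adjoint_value eta0 ->
  exists k : mor Q0 L', lift_map L' ∘ fmap F k ∘ eta0 = f ∘ res_eps (R X).
Proof.
move=> adj0; have [al [_ alK alVK]] := is_iso_inv (lift_iso L').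
have [k kE] := left_adjoint_ex (al ∘ f ∘ res_eps (R X)) adj0.
by exists k; rewrite -mcompA kE !mcompA alVK mcomp1m.
Qed.

Lemma adjoint_lift_unique (X X' : A) (Q0 : T) (eta0 : mor (res0 (R X)) (F Q0))
    (L' : lifting I F X') (k k' : mor Q0 L') :
  left_adjoint_value eta0 ->
  lift_map L' ∘ fmap F k ∘ eta0 = lift_map L' ∘ fmap F k' ∘ eta0 -> k = k'.
Proof.
move=> adj0; rewrite -!mcompA => /(is_iso_mono (lift_iso L')).
exact: left_adjoint_inj.
Qed.

Lemma lift_obstruction_ex (X X' : A) (L : lifting I F X) (L' : lifting I F X')
    (f : mor X X') : exists o, lift_obstruction L L' f o.
Proof.
have [W] := syzygy_ex (R X) abA.
have [Q0 [eta0 adj0]] := adjoint_ex LP (@res_proj0 _ _ (R X)).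
have [D [phi pr]] := presents_ex W adj0 L.
have [k kE] := adjoint_lift L' f adj0.
by have [c [_ ho]] := lift_obstruction_with adj0 pr kE; eexists; exact: ho.
Qed.

Lemma lift_obstruction_id (X : A) (L : lifting I F X) :
  lift_obstruction L L (idm X) 0.
Proof.
have [W] := syzygy_ex (R X) abA.
have [Q0 [eta0 adj0]] := adjoint_ex LP (@res_proj0 _ _ (R X)).
have [D [phi pr]] := presents_ex W adj0 L; have [a [b [aE t _]]] := pr.
exists W, Q0, eta0, D, phi, a, 0; split=> //.
- by rewrite mcomp1m.
- by rewrite (triangle_mcomp0 t); exact: uct_class0.
by rewrite ext_push0.
Qed.

(** Over a morphism h that lifts f, the map D -> D' may be chosen so that
    D -> Q0 -> Q0' and D -> D' -> Q0' agree exactly; the obstruction is then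
    transported by naturality of the universal coefficient class. *)
Lemma lift_obstruction_pull (X X' X'' : A) (L : lifting I F X)
    (L' : lifting I F X') (L'' : lifting I F X'') (f : mor X X')
    (g : mor X' X'') (h : mor (L : T) L') o' o :
  lift_map L' ∘ fmap F h = f ∘ lift_map L ->
  lift_obstruction L' L'' g o' -> lift_obstruction L L'' (g ∘ f) o ->
  o = ext_pull f o'.
Proof.
move=> hE [W' [Q' [eta' [D' [phi' [k' [c' [adj' pr' kE' cE' ->]]]]]]]].
move=> [W [Q [eta [D [phi [k [c [adj pr kE cE ->]]]]]]]].
have [a' [b' [aE' t' phiE']]] := pr'; have [a [b [aE t phiE]]] := pr.
have [c0 c0E] := res_proj0 (f ∘ res_eps (R X)) (@res_epi _ _ (R X')).
have [m mE] := left_adjoint_ex (eta' ∘ c0) adj.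
have am : a' ∘ m = h ∘ a.
  apply: (adjoint_lift_unique adj); rewrite !fmapM !mcompA hE.
  rewrite -(mcompA _ (fmap F m)) mE mcompA aE' c0E.
  by rewrite -!mcompA; congr (_ ∘ _); rewrite mcompA aE.
have [|w wE] := triangle_factorr (x := m ∘ phi) t'.
  by rewrite mcompA am -mcompA (triangle_mcomp0 t) mcompm0.
have cw : covers c0 w.
  apply: (is_iso_mono (eta0_iso adj')); rewrite !mcompA -phiE' -fmapM wE.
  by rewrite fmapM phiE !mcompA mE.
have kk : k = k' ∘ m.
  apply: (adjoint_lift_unique adj); rewrite kE fmapM !mcompA.
  by rewrite -(mcompA _ (fmap F m)) mE mcompA kE' -!mcompA c0E.
have := uct_class_pull LP c0E cw cE'.
rewrite -mcompA wE mcompA -kk => /(uct_class_fun LP cE) ->.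
by rewrite ext_pull_push.
Qed.

Lemma lift_obstruction_fun (X X' : A) (L : lifting I F X) (L' : lifting I F X')
    (f : mor X X') o o' :
  lift_obstruction L L' f o -> lift_obstruction L L' f o' -> o = o'.
Proof.
move=> ho ho'.
rewrite (@lift_obstruction_pull _ _ _ L L L' (idm X) f (idm (L : T)) o' o) //.
- exact: ext_pull1.
- by rewrite fmap1 mcomp1m mcompm1.
by rewrite mcompm1.
Qed.

Lemma lift_obstruction_of_lift (X X' : A) (L : lifting I F X)
    (L' : lifting I F X') (f : mor X X') (h : mor (L : T) L') :
  lift_map L' ∘ fmap F h = f ∘ lift_map L -> lift_obstruction L L' f 0.
Proof.
move=> hE; have [o ho] := lift_obstruction_ex L L' f.
have e := lift_obstruction_pull (o := o) hE (lift_obstruction_id L').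
by rewrite mcomp1m ext_pull0 in e; rewrite -(e ho).
Qed.

Lemma lift_of_obstruction0 (X X' : A) (L : lifting I F X)
    (L' : lifting I F X') (f : mor X X') :
  lift_obstruction L L' f 0 ->
  exists h : mor (L : T) L', lift_map L' ∘ fmap F h = f ∘ lift_map L.
Proof.
move=> [W [Q [eta [D [phi [k [c [adj pr kE cE c0]]]]]]]].
have [a [b [aE t phiE]]] := pr.
have [al [_ alK _]] := is_iso_inv (lift_iso L').
have {}c0 : c = 0.
  rewrite -(ext_push1 c) -desusp_map1 -alK desusp_mapM ext_pushM -c0.
  exact: ext_push0.
have k0 : k ∘ phi = 0.
  by rewrite c0 in cE; exact: (uct_class_inj LP cE (uct_class0 LP _ _)).
have [h ha] := triangle_factorl t k0; exists h.
have [be [ibe beK _]] := is_iso_inv (lift_iso L).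
have eae : epi (fmap F a ∘ eta).
  have -> : fmap F a ∘ eta = be ∘ res_eps (R X).
    by rewrite -aE !mcompA beK mcomp1m.
  by apply: epi_comp (@res_epi _ _ (R X)); exact: is_iso_epi.
apply: eae; rewrite !mcompA -(mcompA _ (fmap F h)) -fmapM ha kE -aE.
by rewrite !mcompA.
Qed.

(** The obstruction is a derivation.  Comparing the maps phi : D -> Q0 and
    phi' : D' -> Q0' over a chain map that lifts f, the difference of
    D -> Q0 -> Q0' and D -> D' -> Q0' represents the obstruction of f after
    composition with Q0' -> L', and contributes g times it to that of g f. *)
Lemma lift_obstruction_comp (X X' X'' : A) (L : lifting I F X)
    (L' : lifting I F X') (L'' : lifting I F X'') (f : mor X X')
    (g : mor X' X'') o o' o'' :
  lift_obstruction L L' f o -> lift_obstruction L' L'' g o' ->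
  lift_obstruction L L'' (g ∘ f) o'' ->
  o'' = ext_pull f o' + ext_push (desusp_map g) o.
Proof.
move=> [W [Q [eta [D [phi [k [c [adj pr kE cE ->]]]]]]]].
move=> [W' [Q' [eta' [D' [phi' [k' [c' [adj' pr' kE' cE' ->]]]]]]]] ho.
have [a' [b' [aE' t' phiE']]] := pr'; have [a [b [aE t phiE]]] := pr.
have [c0 c0E] := res_proj0 (f ∘ res_eps (R X)) (@res_epi _ _ (R X')).
have [m mE] := left_adjoint_ex (eta' ∘ c0) adj.
have [|wf wfE] := kernel_factor (x := c0 ∘ syz_in W) (syz_ker W').
  by rewrite mcompA c0E -mcompA syz_in0 mcompm0.
have [al [_ alK alVK]] := is_iso_inv (lift_iso D').
have [st] := syzygy_triangle_ex LP D.
have [w wE] := uct_lift LP st (al ∘ wf ∘ lift_map D).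
have cw : covers c0 w.
  by rewrite /covers wE -!mcompA (mcompA _ al) alVK mcomp1m !mcompA wfE.
have [|e eE] := uct_class_ex LP (x := m ∘ phi - phi' ∘ w).
  rewrite fmapB !fmapM phiE phiE' !mcompA mE -!mcompA.
  have := cw; rewrite /covers -!mcompA => ->.
  by rewrite subrr.
have km : k = a' ∘ m.
  apply: (adjoint_lift_unique adj); rewrite kE fmapM !mcompA.
  by rewrite -(mcompA _ (fmap F m)) mE mcompA aE' c0E.
have kphi : k ∘ phi = a' ∘ (m ∘ phi - phi' ∘ w).
  by rewrite mcompBr km !mcompA (triangle_mcomp0 t') mcomp0m subr0.
have {}cE : c = ext_push (desusp_map (fmap F a')) e.
  by apply: (uct_class_fun LP cE); rewrite kphi; exact: uct_class_push.
have kmE : lift_map L'' ∘ fmap F (k' ∘ m) ∘ eta = g ∘ f ∘ res_eps (R X).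
  rewrite fmapM !mcompA -(mcompA _ (fmap F m)) mE mcompA kE'.
  by rewrite -!mcompA c0E.
have [c'' [cE'' ho'']] := lift_obstruction_with adj pr kmE.
rewrite (lift_obstruction_fun ho ho'').
have -> : c'' = ext_pull f c' + ext_push (desusp_map (fmap F k')) e.
  apply: (uct_class_fun LP cE'').
  have -> : k' ∘ m ∘ phi = k' ∘ phi' ∘ w + k' ∘ (m ∘ phi - phi' ∘ w).
    by rewrite mcompBr !mcompA addrC subrK.
  apply: (uct_classD LP); last exact: uct_class_push.
  exact: (uct_class_pull LP c0E cw cE').
rewrite ext_pushD ext_pull_push cE -!ext_pushM -!desusp_mapM.
congr (_ + ext_push (desusp_map _) _).
apply: (is_iso_epi (eta0_iso adj')); rewrite kE' -!mcompA; congr (_ ∘ _).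
by rewrite mcompA aE'.
Qed.

End Obstruction.

(** * Relative obstruction classes *)

Section Relative.
Variables (T : triangulated_category) (I : morphism_class T).
Variables (A : stable_abelian_category) (F : stable_functor T A).
Hypothesis LP : lifts_projectives I F.
Variable R : forall X : A, resolution X.

Let homF := lp_hom LP.
Let kerF := lp_ker LP.
Let enoughA := lp_enough LP.
Let abA : abelian A := stable_abelianP A.

(** If a1 : Q0 -> L1 is the map in the triangle of phi1, then a1 phi1 = 0, so the
    obstruction a1 phi2 to extending a1 over L2 is a1 (phi2 - phi1). *)
Lemma relative_lift_obstruction (X : A) (L2 L1 : lifting I F X)
    (d : Ext2 R X (desusp X)) :
  relative_obstruction L2 L1 d -> lift_obstruction L2 L1 (idm X) d.
Proof.
move=> [W [Q0 [eta0 [D [phi1 [phi2 [c0 [[adj pr1 pr2] [hc ->]]]]]]]]].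
have [a1 [b1 [a1E t1 _]]] := pr1.
exists W, Q0, eta0, D, phi2, a1.
exists (ext_push (desusp_map (fmap F a1)) (ext_push (desusp_map eta0) c0)).
split=> //; first by rewrite mcomp1m.
  have -> : a1 ∘ phi2 = a1 ∘ (phi2 - phi1).
    by rewrite mcompBr (triangle_mcomp0 t1) subr0.
  exact: uct_class_push.
by rewrite -!ext_pushM -!desusp_mapM a1E.
Qed.

(** Two liftings present X from the same lifting of its syzygy, since the
    identity of the syzygy lifts to an isomorphism. *)
Lemma relative_obstruction_ex (X : A) (L2 L1 : lifting I F X) :
  exists d : Ext2 R X (desusp X), relative_obstruction L2 L1 d.
Proof.
have [W] := syzygy_ex (R X) abA.
have [Q0 [eta0 adj]] := adjoint_ex LP (@res_proj0 _ _ (R X)).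
have [D [phi1 pr1]] := presents_ex LP W adj L1.
have [D2 [psi pr2]] := presents_ex LP W adj L2.
have [st] := syzygy_triangle_ex LP D.
have [al [ial alK alVK]] := is_iso_inv (lift_iso D2).
have [w wE] := uct_lift LP st (al ∘ lift_map D).
have iw : is_iso w.
  apply: (generated_iso homF kerF enoughA); try exact: lift_generated.
  by rewrite wE; apply: is_iso_comp ial (lift_iso D).
have pr2' : presents eta0 L2 (psi ∘ w).
  have [a [b [aE t psiE]]] := pr2; have [v [iv vw wv]] := is_iso_inv iw.
  exists a, (fmap susp v ∘ b); split=> //.
    apply: (triangle_iso iv (is_iso_idm Q0) (is_iso_idm (L2 : T)) _ _ _ t).
    - by rewrite mcomp1m -mcompA wv mcompm1.
    - by rewrite mcomp1m mcompm1.
    by rewrite mcompm1.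
  by rewrite fmapM psiE wE -!mcompA (mcompA _ al) alVK mcomp1m.
have [a1 [b1 [_ _ phi1E]]] := pr1; have [a2 [b2 [_ _ phi2E]]] := pr2'.
have [|c hc] := uct_class_ex LP (x := psi ∘ w - phi1).
  by rewrite fmapB phi1E phi2E subrr.
have [e [_ eK eVK]] := is_iso_inv (eta0_iso LP adj).
exists (ext_push (desusp_map (res_eps (R X))) (ext_push (desusp_map e) c)).
exists W, Q0, eta0, D, phi1, (psi ∘ w), (ext_push (desusp_map e) c).
by do 2!split=> //; rewrite -ext_pushM -desusp_mapM eVK desusp_map1 ext_push1.
Qed.

(** Add to phi1 a map with the prescribed class and take the cone. The class
    comes from Ext^1(Omega X, P0[-1]) because P0[-1] -> X[-1] is epic and P2 is
    projective. *)
Lemma relative_obstruction_onto (X : A) (L1 : lifting I F X)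
    (d : Ext2 R X (desusp X)) :
  exists L2 : lifting I F X, relative_obstruction L2 L1 d.
Proof.
have [W] := syzygy_ex (R X) abA.
have [Q0 [eta0 adj]] := adjoint_ex LP (@res_proj0 _ _ (R X)).
have [D [phi1 pr1]] := presents_ex LP W adj L1.
have [u uE] := res_proj2 (ext_repr d) (desusp_epi (@res_epi _ _ (R X))).
pose c0 : Ext2 R X (desusp (res0 (R X))) := ext_class u.
have [x hx] := uct_class_onto LP D (ext_push (desusp_map eta0) c0).
have [a1 [b1 [_ _ phi1E]]] := pr1.
have [|L2 pr2] := lifting_of_syzygy LP adj (phi := phi1 + x).
  by rewrite fmapD (uct_class_ker LP hx) addr0.
exists L2, W, Q0, eta0, D, phi1, (phi1 + x), c0; split=> //.
by split; [rewrite [phi1 + x]addrC addrK | rewrite ext_pushE uE ext_reprK].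
Qed.

(** * Even categories *)

Section Even.
Variable E : even_structure A.

Definition swap_even : even_structure A.
Proof.
apply: (@EvenStructure A (neg E) (pos E)).
- exact: neg_replete.
- exact: pos_replete.
- by move=> X Y f; exact: hom_neg_pos.
- by move=> X Y f; exact: hom_pos_neg.
- move=> X; have [Xp [Xm [S [pX mX iX]]]] := even_decomposition E X.
  exists Xm, Xp, (Biproduct (bp_rr S) (bp_ll S) (bp_rl S) (bp_lr S)
    (etrans (addrC _ _) (bp_sum S))); split=> //.
- by move=> X; exact: neg_desusp.
by move=> X; exact: pos_desusp.
Defined.

End Even.

Definition negative_projection (E : even_structure A) (X : A) (e : mor X X) : Prop :=
  exists (Xp Xm : A) (ip : mor Xp X) (im : mor Xm X) (pp : mor X Xp)
         (pm : mor X Xm),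
    [/\ pos E Xp, neg E Xm, ip ∘ pp + im ∘ pm = idm X, e = im ∘ pm &
        pm ∘ im = idm Xm].

Lemma even_split (E : even_structure A) (X : A) :
  exists (Xp Xm : A) (ip : mor Xp X) (im : mor Xm X) (pp : mor X Xp)
         (pm : mor X Xm),
    [/\ pos E Xp, neg E Xm, pp ∘ ip = idm Xp /\ pm ∘ im = idm Xm,
        pp ∘ im = 0 /\ pm ∘ ip = 0 & ip ∘ pp + im ∘ pm = idm X].
Proof.
have [Xp [Xm [S [pX mX [f [g [gf fg]]]]]]] := even_decomposition E X.
exists Xp, Xm, (f ∘ bp_inl S), (f ∘ bp_inr S), (bp_prl S ∘ g), (bp_prr S ∘ g).
split=> //.
- by rewrite -!mcompA !(mcompA g) gf !mcomp1m bp_ll bp_rr.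
- by rewrite -!mcompA !(mcompA g) gf !mcomp1m bp_lr bp_rl.
by rewrite -!mcompA -mcompDr !mcompA -mcompDl bp_sum mcomp1m fg.
Qed.

Lemma negative_projection_ex (E : even_structure A) (X : A) :
  exists e, negative_projection E (X := X) e.
Proof.
have [Xp [Xm [ip [im [pp [pm [pX mX [_ mm] _ sum]]]]]]] := even_split E X.
by exists (im ∘ pm), Xp, Xm, ip, im, pp, pm; split.
Qed.

Lemma negative_projection_nat (E : even_structure A) (X Y : A) (e : mor X X)
    (e' : mor Y Y) (f : mor X Y) :
  negative_projection E e -> negative_projection E e' -> e' ∘ f = f ∘ e.
Proof.
move=> [Xp [Xm [ip [im [pp [pm [pX mX sX -> _]]]]]]].
move=> [Yp [Ym [jp [jm [qp [qm [pY mY sY -> _]]]]]]].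
have z1 : qm ∘ f ∘ ip = 0 := hom_pos_neg _ pX mY.
have z2 : qp ∘ f ∘ im = 0 := hom_neg_pos _ mX pY.
transitivity (jm ∘ (qm ∘ f ∘ im) ∘ pm).
  rewrite -[LHS]mcompm1 -sX mcompDr !mcompA -(mcompA jm) -(mcompA jm) z1.
  by rewrite mcompm0 mcomp0m add0r !mcompA.
rewrite -[RHS]mcomp1m -sY mcompDl -!mcompA (mcompA f) (mcompA qp) (mcompA qp).
by rewrite z2 mcomp0m mcompm0 add0r.
Qed.

Lemma negative_projection_pos (E : even_structure A) (X : A) (e : mor X X) :
  pos E X -> negative_projection E e -> e = 0.
Proof.
move=> pX [Xp [Xm [ip [im [pp [pm [_ mX _ -> _]]]]]]].
by rewrite (hom_pos_neg pm pX mX) mcompm0.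
Qed.

Lemma negative_projection_neg (E : even_structure A) (X : A) (e : mor X X) :
  neg E X -> negative_projection E e -> e = idm X.
Proof.
move=> mX [Xp [Xm [ip [im [pp [pm [pX _ <- -> _]]]]]]].
by rewrite (hom_neg_pos pp mX pX) mcompm0 add0r.
Qed.

(** The negative parts of a resolution of X, for X positive, resolve 0; as a
    chain map the projection to them is therefore homotopic to 0. *)
Lemma ext_pos_neg (E : even_structure A) (X B : A) (c : Ext2 R X B) :
  pos E X -> neg E B -> c = 0.
Proof.
move=> pX mB.
have [e0 n0] := negative_projection_ex E (res0 (R X)).
have [e1 n1] := negative_projection_ex E (res1 (R X)).
have [e2 n2] := negative_projection_ex E (res2 (R X)).
have [eX nX] := negative_projection_ex E X.
have [eB nB] := negative_projection_ex E B.
have cl : chain_lift R (0 : mor X X) e2.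
  exists e0, e1; split; last 2 first.
  - by rewrite (negative_projection_nat _ n1 n0).
  - by rewrite (negative_projection_nat _ n2 n1).
  by rewrite -(negative_projection_nat _ n0 nX) (negative_projection_pos pX nX).
have cl0 : chain_lift R (0 : mor X X) 0.
  by exists 0, 0; rewrite !mcompm0 !mcomp0m.
have [s hs] := chain_lift_unique cl cl0.
rewrite -(ext_reprK c) -(ext_class0 R X B); apply/ext_classP.
exists (ext_repr c ∘ s); rewrite subr0 -mcompA -hs subr0.
by rewrite -(negative_projection_nat _ n2 nB) (negative_projection_neg mB nB) mcomp1m.
Qed.

(** X'[-1] is negative, so the obstruction lies in a zero group. *)
Lemma pos_lift (E : even_structure A) (X X' : A) (L : lifting I F X)
    (L' : lifting I F X') (f : mor X X') :
  pos E X -> pos E X' ->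
  exists h : mor (L : T) L', lift_map L' ∘ fmap F h = f ∘ lift_map L.
Proof.
move=> pX pX'; have [o ho] := lift_obstruction_ex LP R L L' f.
apply: (lift_of_obstruction0 LP (R := R)).
by rewrite -(@ext_pos_neg E _ _ o) //; apply/pos_desusp.
Qed.

Section Canonical.
Variable E : even_structure A.

Lemma canonical_lifting_ex (X : A) :
  exists L : lifting I F X, canonical_lifting E L.
Proof.
have [Xp [Xm [ip [im [pp [pm [pX mX [ppi pmi] [ppm pmp] sum]]]]]]] := even_split E X.
have [Lp] := lifting_ex LP R Xp; have [Lm] := lifting_ex LP R Xm.
have [S] := ex_biproduct (Lp : T) Lm.
have gS : projectively_generated I S.
  by apply: generated_biproduct; exact: lift_generated.
have [ap [_ apK apVK]] := is_iso_inv (lift_iso Lp).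
have [am [_ amK amVK]] := is_iso_inv (lift_iso Lm).
pose al := ip ∘ lift_map Lp ∘ fmap F (bp_prl S) +
           im ∘ lift_map Lm ∘ fmap F (bp_prr S).
have ial : is_iso al.
  exists (fmap F (bp_inl S) ∘ ap ∘ pp + fmap F (bp_inr S) ∘ am ∘ pm); split.
    rewrite /al mcompDr !mcompDl -!mcompA !(mcompA pp) !(mcompA pm).
    rewrite ppi ppm pmp pmi !mcomp0m !mcompm0 !mcomp1m addr0 add0r.
    rewrite !(mcompA ap) !(mcompA am) apK amK !mcomp1m -!fmapM -fmapD bp_sum.
    exact: fmap1.
  rewrite /al mcompDr !mcompDl -!mcompA !(mcompA (fmap F _) (fmap F _)) -!fmapM.
  rewrite bp_ll bp_rl bp_lr bp_rr !fmap1 !fmap0 !mcomp0m !mcompm0 !mcomp1m.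
  by rewrite addr0 add0r !(mcompA (lift_map _)) apVK amVK !mcomp1m.
exists (Lifting gS ial).
exists Xp, Xm, ip, im, pp, pm, Lp, Lm, (bp_inl S), (bp_inr S), (bp_prl S), (bp_prr S).
split=> //; split=> //.
- exact: bp_ll.
- exact: bp_rr.
- exact: bp_lr.
- exact: bp_rl.
exact: bp_sum.
Qed.

(** By evenness f has no mixed components, and its two other components lift. *)
Lemma canonical_lift (X X' : A) (L : lifting I F X) (L' : lifting I F X')
    (f : mor X X') :
  canonical_lifting E L -> canonical_lifting E L' ->
  exists h : mor (L : T) L', lift_map L' ∘ fmap F h = f ∘ lift_map L.
Proof.
move=> [Xp [Xm [ip [im [pp [pm [Lp [Lm [jp [jm [qp [qm [pX mX
  [ppi pmi ppm pmp sX] [qpj qmj qpm qmp sL] LE]]]]]]]]]]]]].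
move=> [Xp' [Xm' [ip' [im' [pp' [pm' [Lp' [Lm' [jp' [jm' [qp' [qm' [pX' mX'
  [ppi' pmi' ppm' pmp' sX'] [qpj' qmj' qpm' qmp' sL'] LE']]]]]]]]]]]]].
have [hp hpE] := pos_lift Lp Lp' (pp' ∘ f ∘ ip) pX pX'.
have [hm hmE] := @pos_lift (swap_even E) _ _ Lm Lm' (pm' ∘ f ∘ im) mX mX'.
have zpm : pm' ∘ f ∘ ip = 0 := hom_pos_neg _ pX mX'.
have zmp : pp' ∘ f ∘ im = 0 := hom_neg_pos _ mX pX'.
have fip : f ∘ ip = ip' ∘ (pp' ∘ f ∘ ip).
  by rewrite -[LHS]mcomp1m -sX' mcompDl -!mcompA (mcompA pm') zpm mcompm0 addr0.
have fim : f ∘ im = im' ∘ (pm' ∘ f ∘ im).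
  by rewrite -[LHS]mcomp1m -sX' mcompDl -!mcompA (mcompA pp') zmp mcompm0 add0r.
pose h := jp' ∘ hp ∘ qp + jm' ∘ hm ∘ qm; exists h.
have hp' : qp' ∘ h = hp ∘ qp.
  by rewrite mcompDr !mcompA qpj' qpm' mcomp1m !mcomp0m addr0.
have hm' : qm' ∘ h = hm ∘ qm.
  by rewrite mcompDr !mcompA qmj' qmp' mcomp1m !mcomp0m add0r.
rewrite LE LE' mcompDl -!mcompA -!fmapM hp' hm' !fmapM mcompDr.
by rewrite !mcompA fip fim -!mcompA (mcompA (lift_map Lp'))
  (mcompA (lift_map Lm')) hpE hmE !mcompA.
Qed.

Lemma canonical_obstruction (X X' : A) (L : lifting I F X)
    (L' : lifting I F X') (f : mor X X') o :
  canonical_lifting E L -> canonical_lifting E L' ->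
  lift_obstruction (R := R) L L' f o -> o = 0.
Proof.
move=> cL cL' ho; have [h hE] := canonical_lift f cL cL'.
exact: (lift_obstruction_fun LP ho (lift_obstruction_of_lift LP R hE)).
Qed.

End Canonical.
End Relative.

(** * Classification of the generated objects *)

Section Classification.
Variables (T : triangulated_category) (I : morphism_class T).
Variables (A : stable_abelian_category) (F : stable_functor T A).
Hypothesis LP : lifts_projectives I F.
Variables (E : even_structure A) (R : forall X : A, resolution X).

Let gen := full_subcategory (projectively_generated I).

(** Two canonical liftings have no obstruction relative to each other, so the
    canonical lifting in the definition of the class may be replaced. *)
Lemma obstruction_of_class (Y : gen)
    (d : Ext2 R (F (sval Y)) (desusp (F (sval Y))))
    (L0 : lifting I F (F (sval Y))) :
  canonical_lifting E L0 -> is_obstruction_class E d ->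
  lift_obstruction (self_lifting F (svalP Y)) L0 (idm _) d.
Proof.
move=> c0 [L1 [c1 /relative_lift_obstruction hd]].
have [z hz] := lift_obstruction_ex LP R L1 L0 (idm _).
have z0 := canonical_obstruction LP c1 c0 hz; subst z.
have [o ho] := lift_obstruction_ex LP R (self_lifting F (svalP Y)) L0 (idm _ ∘ idm _).
have := lift_obstruction_comp LP hd hz ho.
by rewrite ext_pull0 desusp_map1 ext_push1 add0r => <-; rewrite mcomp1m in ho.
Qed.

Lemma obstruction_class_exists_unique (Y : gen) :
  exists! d : Ext2 R (F (sval Y)) (desusp (F (sval Y))),
    is_obstruction_class E d.
Proof.
have [L0 c0] := canonical_lifting_ex LP R E (F (sval Y)).
have [d hd] := relative_obstruction_ex LP R (self_lifting F (svalP Y)) L0.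
have od : is_obstruction_class E d by exists L0.
exists d; split=> // d' od'.
exact: (lift_obstruction_fun LP (obstruction_of_class c0 od)
          (obstruction_of_class c0 od')).
Qed.

Lemma obstruction_classP (Y : gen) (L0 : lifting I F (F (sval Y))) :
  canonical_lifting E L0 ->
  lift_obstruction (self_lifting F (svalP Y)) L0 (idm _)
    (obstruction_class F E R Y).
Proof.
move=> c0; apply: obstruction_of_class c0 _.
have [d [od _]] := obstruction_class_exists_unique Y.
exact: (@xgetPex _ 0 [set d | is_obstruction_class E d] (ex_intro _ d od)).
Qed.

(** Compute the obstruction to lifting f to a morphism from Y to the canonical
    lifting of F(Z) in two ways: through Z, and through the canonical lifting of
    F(Y). Morphisms between canonical liftings are unobstructed, and what
    remains says that o is f delta(Y) - delta(Z) f. *)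
Lemma obstruction_commutator (Y Z : gen) (f : mor (F (sval Y)) (F (sval Z))) o :
  lift_obstruction (self_lifting F (svalP Y)) (self_lifting F (svalP Z)) f o ->
  ext_pull f (obstruction_class F E R Z) + o =
  ext_push (desusp_map f) (obstruction_class F E R Y).
Proof.
move=> ho; have [LY cY] := canonical_lifting_ex LP R E (F (sval Y)).
have [LZ cZ] := canonical_lifting_ex LP R E (F (sval Z)).
have [z hz] := lift_obstruction_ex LP R LY LZ f.
have z0 := canonical_obstruction LP cY cZ hz; subst z.
have [o1 ho1] := lift_obstruction_ex LP R (self_lifting F (svalP Y)) LZ f.
have e1 := lift_obstruction_comp LP (o'' := o1) (obstruction_classP cY) hz.
have e2 := lift_obstruction_comp LP (o'' := o1) ho (obstruction_classP cZ).
move: e1 e2; rewrite mcomp1m mcompm1 => /(_ ho1) e1 /(_ ho1) e2.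
by move: e1; rewrite e2 desusp_map1 ext_push1 ext_pull0 add0r.
Qed.

Lemma compatible_lift (Y Z : gen) (f : mor (F (sval Y)) (F (sval Z))) :
  @delta_compatible A R (Fdelta_ob F E R Y) (Fdelta_ob F E R Z) f <->
  exists h : mor Y Z, fmap F (h : mor (sval Y) (sval Z)) = f.
Proof.
split=> [/eqP cf|[h <-]].
  have [o ho] := lift_obstruction_ex LP R (self_lifting F (svalP Y))
    (self_lifting F (svalP Z)) f.
  have o0 : o = 0.
    apply: (addrI (ext_pull f (obstruction_class F E R Z))).
    by rewrite (obstruction_commutator ho) addr0; exact/esym.
  subst o; have [h hE] := lift_of_obstruction0 LP ho.
  by exists h; move: hE; rewrite /= mcomp1m mcompm1.
have ho : lift_obstruction (R := R) (self_lifting F (svalP Y))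
    (self_lifting F (svalP Z)) (fmap F h) 0.
  apply: (@lift_obstruction_of_lift _ _ _ _ LP R _ _ (self_lifting F (svalP Y))
    (self_lifting F (svalP Z)) _ h).
  by rewrite /= mcomp1m mcompm1.
by apply/eqP; rewrite -(obstruction_commutator ho) addr0.
Qed.

Lemma Fdelta_is_functorial : Fdelta_functorial I F E R.
Proof. by move=> Y Z f; apply/compatible_lift; exists f. Qed.

Lemma Fdelta_full (H : Fdelta_functorial I F E R) : full_functor (Fdelta H).
Proof.
move=> Y Z [f cf]; have [h hf] := (compatible_lift f).1 cf.
by exists h; apply: val_inj.
Qed.

Lemma Fdelta_reflects_iso (H : Fdelta_functorial I F E R) (Y Z : gen)
    (f : mor Y Z) :
  is_iso (fmap (Fdelta H) f) -> is_iso (f : mor (sval Y) (sval Z)).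
Proof.
move=> [g [gf fg]].
apply: (generated_iso (lp_hom LP) (lp_ker LP) (lp_enough LP) (svalP Y) (svalP Z)).
by exists (sval g); split; [exact: (congr1 sval gf) | exact: (congr1 sval fg)].
Qed.

Lemma delta_iso (x y : delta_object R) (f : mor (x : A) y) :
  is_iso f -> delta_compatible f -> isomorphic (x : delta_category R) y.
Proof.
move=> [g [gf fg]] cf.
have cg : delta_compatible (x := y) (y := x) g.
  move/eqP: cf => cf; apply/eqP.
  rewrite -[delta_class y in RHS]ext_pull1 -fg ext_pullM cf -ext_pull_push.
  by rewrite -ext_pushM -desusp_mapM gf desusp_map1 ext_push1.
exists (exist (fun g => is_true (delta_compatible g)) f cf).
exists (exist (fun g => is_true (delta_compatible g)) g cg).
by split; apply: val_inj.
Qed.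

(** The lifting L of A whose obstruction relative to a canonical one is delta
    realises (A, delta): the obstruction of lift_map L, computed through L and
    through the canonical lifting of F(L), shows that it is compatible. *)
Lemma Fdelta_surjective (H : Fdelta_functorial I F E R)
    (Z : delta_category R) :
  exists Y : gen, isomorphic (Fdelta H Y) Z.
Proof.
have [L0 c0] := canonical_lifting_ex LP R E (delta_ob Z).
have [L hL] := relative_obstruction_onto LP L0 (delta_class Z).
have {}hL := relative_lift_obstruction hL.
pose Y : gen := exist _ (L : T) (lift_generated L); exists Y.
apply: (@delta_iso (Fdelta_ob F E R Y) Z (lift_map L) (lift_iso L)).
have [LY cY] := canonical_lifting_ex LP R E (F (sval Y)).
have [z hz] := lift_obstruction_ex LP R LY L0 (lift_map L).
have z0 := canonical_obstruction LP cY c0 hz; subst z.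
have [o ho] := lift_obstruction_ex LP R (self_lifting F (svalP Y)) L0 (lift_map L).
have e1 : o = ext_pull (idm _) 0 +
    ext_push (desusp_map (lift_map L)) (obstruction_class F E R Y).
  by apply: (lift_obstruction_comp LP (obstruction_classP cY) hz);
     rewrite mcompm1.
have e2 : o = ext_pull (lift_map L) (delta_class Z).
  apply: (@lift_obstruction_pull _ _ _ _ LP R _ _ _ (self_lifting F (svalP Y))
    L L0 (lift_map L) (idm _) (idm (L : T)) _ o _ hL); last by rewrite mcomp1m.
  by rewrite fmap1.
by apply/eqP; move: e1; rewrite e2 ext_pull0 add0r.
Qed.

End Classification.

Lemma universal_lifts_projectives (T : triangulated_category)
    (I : morphism_class T) (A : stable_abelian_category)
    (F : stable_functor T A) :
  has_countable_coproducts T -> stable_homological_ideal I ->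
  enough_projectives I -> universal_exact I F ->
  enough_projective_objects A -> lifts_projectives I F.
Proof.
move=> hT hI hP hF enoughA; have kerF := universal_kernel hI hF.
split=> //; first exact: hF.1.1.
  by move=> P Y g; exact: (iproj_full hF kerF hP enoughA).
exact: (adjoint_at_projective hT hF kerF hP enoughA).
Qed.

Theorem theorem2p17 (T : triangulated_category) (I : morphism_class T)
    (A : stable_abelian_category) (F : stable_functor T A)
    (E : even_structure A)
    (hT : has_countable_coproducts T)
    (hI : stable_homological_ideal I)
    (hIsum : compatible_with_countable_coproducts I)
    (hIproj : enough_projectives I)
    (hF : universal_exact I F)
    (hA : global_dimension_le2 A)
    (R : forall X : A, resolution X) :
  (forall Y : full_subcategory (projectively_generated I),
     exists! d : Ext2 R (F (sval Y)) (desusp (F (sval Y))),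
       is_obstruction_class E d) /\
  exists H : Fdelta_functorial I F E R,
    [/\ full_functor (Fdelta H),
        bijective_on_iso_classes (Fdelta H) &
        forall (Y Z : full_subcategory (projectively_generated I))
               (f : mor Y Z),
          is_iso (fmap (Fdelta H) f) -> is_iso (f : mor (sval Y) (sval Z))].
Proof.
have LP := universal_lifts_projectives hT hI hIproj hF
  (enough_of_global_dimension hA).
split; first exact: obstruction_class_exists_unique LP E R.
pose H := Fdelta_is_functorial LP E R; exists H; split.
- exact: Fdelta_full.
- split=> [X Y [g ig]|Z]; last exact: Fdelta_surjective.
  have [f fg] := Fdelta_full LP g; exists f; subst g.
  exact: (Fdelta_reflects_iso LP ig).
by move=> Y Z f; exact: Fdelta_reflects_iso.
Qed.
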